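(* Let $\Lambda$ be a countable discrete group acting on a nonempty countable set $I$ without invariant mean. Let $\Gamma<\mathbf R^+_0$ be any nontrivial countable subgroup and let $\Gamma\cap(0,1)=\{\gamma_n\mid n\ge1\}$ be an enumeration. Let $Y=\bigsqcup_{n\ge1}\{0,1\}^{(n)}$ be a disjoint union of copies of $\{0,1\}$, equipped with the probability measure $\eta=\sum_{n\ge1}\frac{1}{2^n(1+\gamma_n)}\left(\delta_0^{(n)}+\gamma_n\delta_1^{(n)}\right)$, where $\delta_j^{(n)}$ is the Dirac mass at the point $j$ of the $n$-th copy. Let $\mathcal S$ be the equivalence relation on $(Y,\eta)$ whose classes are the copies $\{0,1\}^{(n)}$, $n\ge1$. Then the generalized Bernoulli equivalence relation $\mathcal R=\mathcal S^{\otimes I}\rtimes\Lambda$ on $(X,\mu)=(Y,\eta)^I$ is almost periodic, strongly ergodic and $\mathrm{Sd}(\mathcal R)=\Gamma$.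
   Context: $\mathbf R^+_0=(0,\infty)$. An invariant mean for $\Lambda\curvearrowright I$ is a $\Lambda$-invariant finitely additive probability measure on the subsets of $I$. Generalized Bernoulli relations. On the product probability space $(X,\mu)=(Y,\eta)^I$, $\mathcal S^{\otimes I}$ is the equivalence relation in which $(x_i)_{i\in I}\sim(y_i)_{i\in I}$ iff there is a finite $\mathcal F\subset I$ with $(x_i,y_i)\in\mathcal S$ for $i\in\mathcal F$ and $x_i=y_i$ for $i\in I\setminus\mathcal F$. $\Lambda$ acts on $X$ by $\lambda\cdot(x_i)_{i}=(x_{\lambda^{-1}i})_{i}$. $\mathcal R=\mathcal S^{\otimes I}\rtimes\Lambda$ is the equivalence relation generated by $\mathcal S^{\otimes I}$ and the orbit equivalence relation $\mathcal R(\Lambda\curvearrowright X)$. Everything is up to null sets. $\mathcal M(X)$ is the set of $\sigma$-finite measures on $X$ equivalent to $\mu$. The full group $[\mathcal R]$ is the group of nonsingular automorphisms $\theta$ of $X$ with $(x,\theta(x))\in\mathcal R$ a.e. $\mathcal R$ is strongly ergodic if every sequence of measurable $A_n\subset X$ with $\mu(A_n\triangle\theta(A_n))\to0$ for all $\theta\in[\mathcal R]$ satisfies $\mu(A_n)(1-\mu(A_n))\to0$. For $\nu\in\mathcal M(X)$, let $\nu_\ell(W)=\int_X\sharp\{y:(x,y)\in W\}\,d\nu(x)$, $\nu_r(W)=\int_X\sharp\{x:(x,y)\in W\}\,d\nu(y)$ for measurable $W\subset\mathcal R$, and $\delta_\nu=\frac{d\nu_\ell}{d\nu_r}:\mathcal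 R\to\mathbf R^+_0$. $\nu$ is almost periodic if $\delta_\nu$ essentially takes countably many values, $\mathrm{Range}(\delta_\nu)$ being the set of values taken on non-null sets. $\mathcal R$ is almost periodic if such a $\nu$ exists, and then $\mathrm{Sd}(\mathcal R)$ is the intersection of $\mathrm{Range}(\delta_\nu)$ over all almost periodic $\nu\in\mathcal M(X)$. *)

(* Defs.v *)
From HB Require Import structures.
From Stdlib Require Import Relation_Operators.
From mathcomp Require Import all_boot all_order all_algebra finmap.
From mathcomp Require Import all_classical all_reals all_analysis.

Set Implicit Arguments.
Unset Strict Implicit.
Unset Printing Implicit Defensive.

Import Order.TTheory GRing.Theory Num.Theory.
Import numFieldNormedType.Exports.

Local Open Scope classical_set_scope.
Local Open Scope ring_scope.

Definition is_action (L : groupType) (I : Type) (act : L -> I -> I) : Prop :=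
  (forall i, act 1%g i = i) /\
  (forall g h i, act (g * h)%g i = act g (act h i)).

Definition invariant_mean (R : realType) (L I : Type) (act : L -> I -> I)
    (m : set I -> R) : Prop :=
  [/\ forall A, 0 <= m A,
      m setT = 1,
      forall A B, A `&` B = set0 -> m (A `|` B) = m A + m B
    & forall g A, m (act g @` A) = m A].

Definition pos_subgroup (R : realType) (G : set R) : Prop :=
  [/\ forall x, G x -> 0 < x,
      G 1,
      forall x y, G x -> G y -> G (x * y)
    & forall x, G x -> G x^-1].

Section product_space.
Context d (Y : measurableType d) (I : countType).

Definition coordinate_cylinders : set (set (I -> Y)) :=
  [set A | exists i, exists2 B : set Y, measurable B & A = [set x | B (x i)]].

Definition prod_space := g_sigma_algebraType coordinate_cylinders.

(* By uniqueness of the product probability this determines mu. *)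
Definition is_product_measure (R : realType) (eta : probability Y R)
    (mu : probability prod_space R) : Prop :=
  forall (F : {fset I}) (B : I -> set Y), (forall i, measurable (B i)) ->
    mu [set x | forall i, i \in F -> B i (x i)]
    = (\prod_(i <- F) eta (B i))%E.

Definition tensor_rel (S : Y -> Y -> Prop) (x y : I -> Y) : Prop :=
  exists F : set I, [/\ finite_set F,
    forall i, F i -> S (x i) (y i) & forall i, ~ F i -> x i = y i].

Definition shift (L : groupType) (act : L -> I -> I) (g : L) (x : I -> Y) :
    I -> Y := fun i => x (act g^-1%g i).

Definition orbit_rel (L : groupType) (act : L -> I -> I) (x y : I -> Y) :
    Prop := exists g, y = shift act g x.

Definition bernoulli_rel (S : Y -> Y -> Prop) (L : groupType)
    (act : L -> I -> I) : set (prod_space * prod_space) :=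
  [set w | clos_refl_sym_trans (I -> Y)
             (fun x y => tensor_rel S x y \/ orbit_rel act x y) w.1 w.2].

End product_space.

Section measured_relation.
Context (R : realType) d (X : measurableType d).
Implicit Types (mu : probability X R) (Rel : set (X * X)).

(* Modulo null sets, an almost everywhere defined nonsingular automorphism is
   represented by such a theta: restrict it to an invariant conull set and
   extend by the identity. *)
Definition nonsingular_automorphism mu (theta : X -> X) : Prop :=
  [/\ bijective theta,
      measurable_fun setT theta,
      forall A, measurable A -> measurable (theta @` A)
    & forall A, measurable A -> mu (theta @^-1` A) = 0%E <-> mu A = 0%E].

Definition full_group mu Rel : set (X -> X) :=
  [set theta | nonsingular_automorphism mu theta /\
               {ae mu, forall x, Rel (x, theta x)}].

Definition strongly_ergodic mu Rel : Prop :=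
  forall A : nat -> set X, (forall n, measurable (A n)) ->
    (forall theta, full_group mu Rel theta ->
       (fun n => mu (A n `+` theta @` A n)) @ \oo --> 0%E) ->
    (fun n => (mu (A n) * (1 - mu (A n)))%E) @ \oo --> 0%E.

Definition equivalent_measures mu : set {sigma_finite_measure set X -> \bar R} :=
  [set nu | nu `<< mu /\ mu `<< nu].

(* Only meaningful on the measurable subsets W of a countable Borel equivalence
   relation. *)
Definition nu_l (nu : set X -> \bar R) (W : set (X * X)) : \bar R :=
  (\int[nu]_x counting (xsection W x))%E.

Definition nu_r (nu : set X -> \bar R) (W : set (X * X)) : \bar R :=
  (\int[nu]_y counting (ysection W y))%E.

(* delta is a version of d(nu_l)/d(nu_r) on Rel; the library's Radon-Nikodym
   derivative does not apply because nu_l is not a finite measure. *)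
Definition is_delta Rel (nu : set X -> \bar R) (delta : X * X -> R) : Prop :=
  [/\ measurable_fun Rel delta,
      forall w, Rel w -> 0 < delta w
    & forall W, measurable W -> W `<=` Rel ->
        nu_l nu W = (\int[nu_r nu]_(w in W) (delta w)%:E)%E].

Definition almost_periodic_measure Rel (nu : set X -> \bar R) : Prop :=
  exists2 delta, is_delta Rel nu delta &
    exists2 C : set R, countable C &
      nu_r nu (Rel `\` delta @^-1` C) = 0%E.

Definition delta_range Rel (nu : set X -> \bar R) : set R :=
  [set t | exists2 delta, is_delta Rel nu delta &
             nu_r nu (Rel `&` delta @^-1` [set t]) <> 0%E].

Definition almost_periodic mu Rel : Prop :=
  exists2 nu, equivalent_measures mu nu & almost_periodic_measure Rel nu.

Definition Sd mu Rel : set R :=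
  \bigcap_(nu in [set nu | equivalent_measures mu nu /\
                           almost_periodic_measure Rel nu])
    delta_range Rel nu.

End measured_relation.

(* The point j of the copy of {0,1} with index n.+1 is (n, j): enumerations
   start at 0 here, hence the weights 2 ^- n.+1. *)
Section base_space.
Context {R : realType} (gamma : nat -> {posnum R}).

Definition eta_copy (n : nat) : {measure set (nat * bool) -> \bar R} :=
  mscale (2 ^- n.+1 * (1 + (gamma n)%:num)^-1)%:nng
    (measure_add \d_(n, false) (mscale (gamma n)%:num%:nng \d_(n, true))).

Definition eta : set (nat * bool) -> \bar R := mseries eta_copy 0.

HB.instance Definition _ := Measure.on eta.

Let eta_setT : eta setT = 1%E.
Proof.
rewrite /eta /mseries.
have eta_copyT n : eta_copy n setT = (1 / (2 ^ (n + 1))%:R)%:E.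
  have mass1 : (2 ^- n.+1 * (1 + (gamma n)%:num)^-1 * (1 + (gamma n)%:num)
                = 1 / (2 ^ (n + 1))%:R)%R.
    by rewrite -mulrA mulVf ?gt_eqF// mulr1 div1r addn1 natrX.
  rewrite -mass1 EFinM EFinD; congr (_ * _)%E.
  rewrite [LHS]measure_addE; congr (_ + _)%E; first by rewrite /= diracT.
  by rewrite /= /mscale /= diracT mule1.
under eq_eseriesr do rewrite eta_copyT.
have /cvg_lim := @cvg_geometric_eseries_half R 1 0%N.
by rewrite expr0 divr1; apply.
Qed.

HB.instance Definition _ := Measure_isProbability.Build _ _ _ eta eta_setT.

End base_space.

Definition base_rel (y z : nat * bool) : Prop := y.1 = z.1.

(* Main.v *)
(* Strong ergodicity comes from a spectral gap. If [1_A - mu A] were almost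
   invariant under finitely many group elements, relative to its norm, then the
   squared norms of its Efron-Stein components, which are indexed by the finite
   nonempty subsets [F] of [I], would give an almost invariant probability on
   these [F]; averaging the uniform measures on the [F] would give an almost
   invariant mean on [I].

   The Radon-Nikodym cocycle of [mu] has values in [Gamma], because flipping a
   coordinate in the [n]-th copy scales [mu] by [gamma n] or its inverse. For
   the lower bound on [Sd], let [nu] be almost periodic and [f = dmu/dnu]. The
   increments of [ln f] along the group action lie in a countable set, and the
   spectral gap then forces the law of [ln f] to have an atom (compare with
   sets of the form [ln f \in Phi + small interval], [Phi] a Folner set of
   reals). So [nu] is proportional to [mu] on some non-null set [Z]. As [Z] is
   almost a cylinder, the flip of a suitable coordinate maps a non-null subset
   of [Z \cap {x i = (n, b)}] into [Z], and there the cocycle of [nu] is the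
   one of [mu]. *)

Require Import Defs.
From Stdlib Require Import Relation_Operators.
From mathcomp Require Import all_boot all_order all_algebra finmap.
From mathcomp Require Import all_classical all_reals all_analysis.
From mathcomp Require Import measurable_realfun ring lra zify.

Set Implicit Arguments.
Unset Strict Implicit.
Unset Printing Implicit Defensive.

Import Order.TTheory GRing.Theory Num.Theory.
Import numFieldNormedType.Exports.
Local Open Scope classical_set_scope.
Local Open Scope ring_scope.

(** * Efron-Stein decomposition over a finite alphabet *)

(** Integrals enter the spectral argument only for cylinders over a finite alphabet, where they are
    finite sums; the Efron-Stein calculus is then algebra with commuting averages, and no Hilbert
    space appears. The price, an approximation of measurable sets by cylinders, is absorbed by the
    constants. The gap bounds [pr mu A * (1 - pr mu A)] by a sum of escaped masses because both uses
    want this form: strong ergodicity by squeezing, the atom by summing over a family of sets.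

    For the relation, the obstacle is that [nu_l] and [nu_r] integrate a counting measure and
    [delta] is only a version of a derivative. The classes of [base_rel] have two points, so a
    finite change of coordinates is a flip, and the relation is a countable union of graphs of
    bijections [flip F \o shift g]. On such a graph both measures are images of [nu], and facts on
    [delta] become scaling identities of [nu] under one bijection. The absence of an invariant mean
    also makes [I] infinite, which provides a coordinate outside any given cylinder. *)

Section resampling.
Context (R : realFieldType) (I : choiceType) (Z : finType) (p : Z -> R).
Hypothesis p_ge0 : forall z, 0 <= p z.
Hypothesis p_sum1 : \sum_z p z = 1.
Implicit Types (f u v : (I -> Z) -> R) (x : I -> Z) (i j : I) (s J K : seq I).

Definition upd x i z : I -> Z := fun j => if j == i then z else x j.

(** Conditional expectation given the coordinates other than [i]. These averages are commuting
    orthogonal projections, the building blocks of the decomposition. *)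
Definition avg i f : (I -> Z) -> R := fun x => \sum_z p z * f (upd x i z).

Definition mean K f : (I -> Z) -> R := foldr avg f K.

Definition depends J (T : Type) (f : (I -> Z) -> T) : Prop :=
  forall x y, {in J, x =1 y} -> f x = f y.

Lemma upd_id x i z z' : upd (upd x i z) i z' = upd x i z'.
Proof. by apply/funext => j; rewrite /upd; case: eqP. Qed.

Lemma updC x i j z z' : i != j ->
  upd (upd x i z) j z' = upd (upd x j z') i z.
Proof.
move=> ij; apply/funext => k; rewrite /upd.
by case: (eqVneq k j) => [->|//]; rewrite eq_sym (negbTE ij).
Qed.

Lemma avgD a b i u v : avg i (fun x => a * u x + b * v x) =
  fun x => a * avg i u x + b * avg i v x.
Proof.
apply/funext => x; rewrite /avg !mulr_sumr -big_split/=.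
by apply: eq_bigr => z _; ring.
Qed.

Lemma avgB i u v : avg i (fun x => u x - v x) = fun x => avg i u x - avg i v x.
Proof.
have := avgD 1 (-1) i u v.
under eq_fun do rewrite mul1r mulN1r.
by move=> ->; apply/funext => x; rewrite mul1r mulN1r.
Qed.

Lemma avg_cst i (c : R) : avg i (fun=> c) = fun=> c.
Proof. by apply/funext => x; rewrite /avg -mulr_suml p_sum1 mul1r. Qed.

Lemma avg_ge0 i u : (forall x, 0 <= u x) -> forall x, 0 <= avg i u x.
Proof. by move=> u0 x; apply: sumr_ge0 => z _; rewrite mulr_ge0. Qed.

Lemma avgC i j f : avg i (avg j f) = avg j (avg i f).
Proof.
have [->//|ij] := eqVneq i j.
apply/funext => x; rewrite /avg.
under eq_bigr do rewrite mulr_sumr.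
rewrite exchange_big/=; apply: eq_bigr => z _.
rewrite mulr_sumr; apply: eq_bigr => z' _.
by rewrite mulrCA (updC _ _ _ ij).
Qed.

Lemma avg_upd i f x z : avg i f (upd x i z) = avg i f x.
Proof. by apply: eq_bigr => z' _; rewrite upd_id. Qed.

(** [avg i u] no longer depends on the coordinate [i], so it leaves the sum over that coordinate.
    This gives the orthogonality behind [pythagoras]. *)
Lemma avgM i u v : avg i (fun x => avg i u x * v x) =
  fun x => avg i u x * avg i v x.
Proof.
apply/funext => x; rewrite [RHS]mulr_sumr; apply: eq_bigr => z _.
by rewrite avg_upd mulrCA.
Qed.

Lemma avg_idem i f : avg i (avg i f) = avg i f.
Proof.
apply/funext => x; rewrite /avg -[RHS]mul1r -p_sum1 mulr_suml.
by apply: eq_bigr => z _; rewrite -/(avg i f _) -/(avg i f _) avg_upd.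
Qed.

Lemma depends_sub J K T (f : _ -> T) : {subset J <= K} -> depends J f -> depends K f.
Proof. by move=> JK Jf x y xy; apply: Jf => i /JK; exact: xy. Qed.

Lemma depends_avg i J f : depends (i :: J) f -> depends J (avg i f).
Proof.
move=> fJ x y xy; apply: eq_bigr => z _; congr (_ * _); apply: fJ => j.
rewrite inE /upd; case: eqP => //= _; exact: xy.
Qed.

Lemma depends_avg_id i J f : depends J f -> i \notin J -> avg i f = f.
Proof.
move=> fJ iJ; apply/funext => x; rewrite -[RHS]mul1r -p_sum1 mulr_suml.
apply: eq_bigr => z _; congr (_ * _); apply: fJ => j jJ.
by rewrite /upd; case: eqP jJ iJ => // -> ->.
Qed.

Lemma depends_mean J L f : depends (J ++ L) f -> depends L (mean J f).
Proof.
elim: J L => [|i J IH] L fJ //=.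
apply: depends_avg; apply: IH; apply: depends_sub fJ => j.
by rewrite inE !mem_cat inE orbCA.
Qed.

Lemma meanD K a b u v : mean K (fun x => a * u x + b * v x) =
  fun x => a * mean K u x + b * mean K v x.
Proof. by elim: K => [//|i K /= ->]; rewrite avgD. Qed.

Lemma mean_cst K (c : R) : mean K (fun=> c) = fun=> c.
Proof. by elim: K => [//|i K /= ->]; rewrite avg_cst. Qed.

Lemma mean_ge0 K u : (forall x, 0 <= u x) -> forall x, 0 <= mean K u x.
Proof. by move=> u0; elim: K => [//|i K IH] x; exact: avg_ge0. Qed.

Lemma avg_mean i K f : avg i (mean K f) = mean K (avg i f).
Proof. by elim: K => [//|j K IH] /=; rewrite avgC IH. Qed.

Lemma mean_avg i K f : i \in K -> mean K (avg i f) = mean K f.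
Proof.
elim: K => [//|j K IH] /=; rewrite inE; case: eqP => [<- _|_ /= /IH -> //].
by rewrite -avg_mean avg_idem.
Qed.

Lemma mean_mean J K f : {subset J <= K} -> mean K (mean J f) = mean K f.
Proof.
elim: J => [//|i J IH] JK /=; rewrite mean_avg; last by apply: JK; rewrite mem_head.
by apply: IH => j jJ; apply: JK; rewrite inE jJ orbT.
Qed.

(** Once all the coordinates in [J] are averaged out, nothing is left to vary: the result is a
    constant, and further averages keep it. *)
Lemma mean_depends J K f x : depends J f -> {subset J <= K} ->
  mean J f = fun=> mean K f x.
Proof.
move=> fJ JK; have c : mean J f = fun=> mean J f x.
  by apply/funext => z; apply: (@depends_mean J [::]) => //; rewrite cats0.
by rewrite -(mean_mean f JK) c mean_cst.
Qed.

Variables (x0 : I -> Z) (K : seq I).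

(** For functions that depend only on coordinates in [K] this is the integral, and the base point
    [x0] is irrelevant by [mean_depends]. *)
Let E f := mean K f x0.

Let ED a b u v : E (fun x => a * u x + b * v x) = a * E u + b * E v.
Proof. by rewrite /E meanD. Qed.

Let E_ge0 u : (forall x, 0 <= u x) -> 0 <= E u.
Proof. by move=> u0; exact: mean_ge0. Qed.

Let E_avg i u : i \in K -> E (avg i u) = E u.
Proof. by move=> iK; rewrite /E mean_avg. Qed.

Let le_E u v : (forall x, u x <= v x) -> E u <= E v.
Proof.
move=> uv; have := @E_ge0 (fun x => 1 * v x + (-1) * u x).
by rewrite ED mul1r mulN1r subr_ge0; apply => x; rewrite mul1r mulN1r subr_ge0.
Qed.

(* [energy s f phi] is the sum over the subsets [F] of [s] of
   [phi F * ||f_F||^2], where [f_F] is the Efron-Stein component of [f], i.e.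
   the composition of the [1 - avg i], [i \in F], and [avg i], [i \notin F]. *)
Fixpoint energy s f (phi : {fset I} -> R) : R :=
  if s is i :: s' then
    energy s' (avg i f) phi +
    energy s' (fun x => f x - avg i f x) (fun F => phi (i |` F)%fset)
  else E (fun x => f x ^+ 2) * phi fset0.

Lemma pythagoras i u : i \in K ->
  E (fun x => avg i u x ^+ 2) + E (fun x => (u x - avg i u x) ^+ 2) =
  E (fun x => u x ^+ 2).
Proof.
move=> iK.
have -> : E (fun x => u x ^+ 2) = E (fun x => 1 * (u x - avg i u x) ^+ 2 +
    1 * (2 * (avg i u x * u x) + (-1) * (avg i u x * avg i u x))).
  by congr E; apply/funext => x; ring.
have Emul : E (fun x => avg i u x * u x) = E (fun x => avg i u x * avg i u x).
  by rewrite -(E_avg _ iK) avgM.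
under eq_fun do rewrite expr2.
by rewrite !ED Emul; ring.
Qed.

Lemma energy1 s f : {subset s <= K} ->
  energy s f (fun=> 1) = E (fun x => f x ^+ 2).
Proof.
elim: s f => [|i s IH] f sK /=; first by rewrite mulr1.
rewrite !IH ?pythagoras ?sK ?mem_head// => j js; apply: sK; by rewrite inE js orbT.
Qed.

Lemma energy_linear s f a b phi psi :
  energy s f (fun F => a * phi F + b * psi F) =
  a * energy s f phi + b * energy s f psi.
Proof.
elim: s f phi psi => [|i s IH] f phi psi /=; first by ring.
by rewrite !IH; ring.
Qed.

Lemma energy_ge0 s f phi : (forall F, 0 <= phi F) -> 0 <= energy s f phi.
Proof.
elim: s f phi => [|i s IH] f phi phi0 /=; last by rewrite addr_ge0// IH.
by rewrite mulr_ge0// E_ge0// => x; exact: sqr_ge0.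
Qed.

Lemma energy0 s phi : energy s (fun=> 0) phi = 0.
Proof.
elim: s phi => [|i s IH] phi /=.
  by rewrite expr0n/= /E mean_cst mul0r.
by rewrite avg_cst subrr !IH addr0.
Qed.

Lemma energy_swap i j s f phi :
  energy [:: i, j & s] f phi = energy [:: j, i & s] f phi.
Proof.
rewrite /= !avgB (avgC i j) -!addrA; congr (_ + _); rewrite addrCA.
congr (_ + (_ + _)); congr (energy s _ _).
  by apply/funext => x; ring.
by apply/funext => F; rewrite fsetUCA.
Qed.

Lemma energy_perm s t f phi : perm_eq s t -> energy s f phi = energy t f phi.
Proof.
elim: s t f phi => [|i s IH] t f phi; first by rewrite perm_sym => /perm_nilP ->.
move=> /[dup]/perm_mem/(_ i); rewrite mem_head => /esym it.
have [t1 t2] := splitPr it; rewrite perm_sym -cat1s perm_catCA/= perm_cons => st.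
have -> : energy (t1 ++ i :: t2) f phi = energy (i :: t1 ++ t2) f phi.
  elim: t1 f phi {it st} => [//|j t1 IHt] f phi.
  by rewrite cat_cons energy_swap /= !IHt.
by rewrite /= !(IH (t1 ++ t2)) // perm_sym.
Qed.

Lemma avg_diff_id i j f : avg i f = f ->
  avg i (fun x => f x - avg j f x) = (fun x => f x - avg j f x).
Proof. by move=> fi; rewrite avgB avgC fi. Qed.

(** A coordinate [i] outside [J] satisfies [avg i f = f], so every component whose index set
    contains [i] vanishes. Energies computed over different coordinate lists thus become
    comparable. *)
Lemma energy_pad s J f phi : uniq s -> depends J f ->
  energy s f phi = energy [seq i <- s | i \in J] f phi.
Proof.
move=> us fJ; have {fJ} : forall i, i \notin J -> avg i f = f.
  by move=> i; exact: depends_avg_id.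
elim: s f phi us => [//|i s IH] f phi /= /andP[_ us] fJ.
case: ifPn => [iJ|iJ] /=.
  rewrite (IH (avg i f))//; last by move=> j jJ; rewrite avgC fJ.
  by rewrite (IH (fun x => _))// => j jJ; rewrite avg_diff_id// fJ.
rewrite (fJ _ iJ) (IH f)//.
have -> : (fun x => f x - f x) = fun=> 0 by apply/funext => x; rewrite subrr.
by rewrite energy0 addr0.
Qed.

Lemma energy_sub s J f phi : uniq s -> uniq J -> {subset J <= s} ->
  depends J f -> energy s f phi = energy J f phi.
Proof.
move=> us uJ Js fJ; rewrite (energy_pad _ us fJ); apply: energy_perm.
apply: uniq_perm; rewrite ?filter_uniq// => i; rewrite mem_filter.
by case: (boolP (i \in J)) => //= /Js.
Qed.

(** On a single component this is [u^2 - v^2 = (u - v) * (u + v)] followed by a weighted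
    arithmetic-geometric inequality; the free weight [t] replaces the square roots of
    Cauchy-Schwarz. The right-hand side is additive over components by [pythagoras], so the bound
    passes to any bounded [phi] by induction. *)
Lemma energy_lipschitz s u v (phi : {fset I} -> R) (t : R) :
  {subset s <= K} -> (forall F, `|phi F| <= 1) -> 0 < t ->
  `|energy s u phi - energy s v phi| <=
  (t * E (fun x => (u x - v x) ^+ 2) + t^-1 * E (fun x => (u x + v x) ^+ 2)) / 2.
Proof.
move=> + + t0; elim: s u v phi => [|i s IH] u v phi sK phi1 /=.
  rewrite -mulrBl normrM; apply: (@le_trans _ _ (`|E (fun x => u x ^+ 2)
    - E (fun x => v x ^+ 2)| * 1)); first by rewrite ler_wpM2l.
  rewrite mulr1.
  have -> : E (fun x => u x ^+ 2) - E (fun x => v x ^+ 2) =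
    E (fun x => 1 * u x ^+ 2 + (-1) * v x ^+ 2) by rewrite ED; ring.
  have -> : (t * E (fun x => (u x - v x) ^+ 2) +
    t^-1 * E (fun x => (u x + v x) ^+ 2)) / 2 =
    E (fun x => (t / 2) * (u x - v x) ^+ 2 + (t^-1 / 2) * (u x + v x) ^+ 2).
    by rewrite ED; ring.
  have key a b : a * b <= t / 2 * a ^+ 2 + t^-1 / 2 * b ^+ 2.
    rewrite -subr_ge0.
    have -> : t / 2 * a ^+ 2 + t^-1 / 2 * b ^+ 2 - a * b =
      t^-1 / 2 * (t * a - b) ^+ 2 by field; rewrite ?gt_eqF.
    by rewrite mulr_ge0 ?sqr_ge0// divr_ge0// invr_ge0 ltW.
  rewrite ler_norml -mulN1r; apply/andP; split.
    rewrite -lerN2 mulN1r opprK.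
    have -> : - E (fun x => 1 * u x ^+ 2 + (-1) * v x ^+ 2) =
      E (fun x => (-1) * u x ^+ 2 + 1 * v x ^+ 2) by rewrite !ED; ring.
    apply: le_E => x; have := key (u x - v x) (- (u x + v x)).
    rewrite sqrrN; lra.
  apply: le_E => x; have := key (u x - v x) (u x + v x); lra.
have sK' : {subset s <= K} by move=> j js; apply: sK; rewrite inE js orbT.
have iK : i \in K by apply: sK; rewrite mem_head.
have H1 := IH (avg i u) (avg i v) phi sK' phi1.
have H2 := IH (fun x => u x - avg i u x) (fun x => v x - avg i v x)
  (fun F => phi (i |` F)%fset) sK' (fun F => phi1 _).
have := pythagoras (fun x => u x - v x) iK.
have := pythagoras (fun x => u x + v x) iK.
have avgDi : avg i (fun x => u x + v x) = fun x => avg i u x + avg i v x.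
  have := avgD 1 1 i u v; under eq_fun do rewrite !mul1r.
  by move=> ->; apply/funext => x; rewrite !mul1r.
rewrite avgB avgDi.
have -> : (fun x => (u x + v x - (avg i u x + avg i v x)) ^+ 2) =
  fun x => (u x - avg i u x + (v x - avg i v x)) ^+ 2.
  by apply/funext => x; ring.
have -> : (fun x => (u x - v x - (avg i u x - avg i v x)) ^+ 2) =
  fun x => (u x - avg i u x - (v x - avg i v x)) ^+ 2.
  by apply/funext => x; ring.
move=> <- <-; rewrite opprD addrACA.
apply: le_trans (ler_normD _ _) _; apply: le_trans (lerD H1 H2) _.
by rewrite !mulrDr; lra.
Qed.

(** Only the component with index set [fset0] counts, and it is the full average. The list is
    reversed because [energy] averages its head first while [foldr] applies its head last. *)
Lemma energy_fset0 s f : energy s f (fun F => (F == fset0)%:R) =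
  E (fun x => mean (rev s) f x ^+ 2).
Proof.
elim: s f => [|i s IH] f /=; first by rewrite [X in _ * X](_ : _ = 1) ?mulr1.
rewrite IH rev_cons /mean -cats1 foldr_cat/=.
set e := energy _ _ _; suff -> : e = 0 by rewrite addr0.
have phi0 : (fun F => ((i |` F)%fset == fset0)%:R) = fun F : {fset I} => 0 * 0 + 0 * 0 :> R.
  apply/funext => F; rewrite !mul0r addr0.
  suff /negbTE -> : (i |` F)%fset != fset0 by [].
  by apply/eqP => /fsetP/(_ i); rewrite !inE eqxx.
by rewrite /e phi0 (energy_linear s _ 0 0 (fun=> 0) (fun=> 0)) !mul0r addr0.
Qed.

Section equivariance.
Variables (sigma tau : I -> I) (sigmaK : cancel sigma tau).

Definition translate f : (I -> Z) -> R := fun x => f (x \o sigma).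

Lemma avg_translate i f : avg (sigma i) (translate f) = translate (avg i f).
Proof.
apply/funext => x; apply: eq_bigr => z _; congr (_ * f _).
by apply/funext => j; rewrite /upd/= (can_eq sigmaK).
Qed.

Lemma depends_translate J f : depends J f -> depends (map sigma J) (translate f).
Proof.
by move=> fJ x y xy; apply: fJ => i iJ; apply: xy; exact: map_f.
Qed.

Lemma mean_translate J f : mean (map sigma J) (translate f) = translate (mean J f).
Proof. by elim: J => [//|i J /= ->]; rewrite avg_translate. Qed.

Lemma E_translate J f : depends J f -> {subset J <= K} ->
  {subset map sigma J <= K} -> E (translate f) = E f.
Proof.
move=> fJ JK sJK.
have := mean_depends x0 (depends_translate fJ) sJK.
rewrite mean_translate (mean_depends x0 fJ JK) => /(congr1 (fun h => h x0)).
by rewrite /translate /E => ->.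
Qed.

(** Translation carries the component indexed by [F] to the one indexed by the image of [F]. *)
Lemma energy_translate J s f phi : depends J f -> {subset s <= J} ->
  {subset J <= K} -> {subset map sigma J <= K} ->
  energy (map sigma s) (translate f) phi =
  energy s f (fun F => phi (sigma @` F)%fset).
Proof.
move=> + + JK sJK; elim: s f phi => [|i s IH] f phi fJ sJ /=.
  rewrite imfset0; congr (_ * _); apply: (@E_translate J (fun x => f x ^+ 2)) => //.
  by move=> x y /fJ ->.
have aJ : depends J (avg i f).
  apply: depends_avg; apply: depends_sub fJ => j jJ; by rewrite inE jJ orbT.
have sJ' : {subset s <= J} by move=> j js; apply: sJ; rewrite inE js orbT.
rewrite avg_translate IH//; congr (_ + _).
have -> : (fun x => translate f x - translate (avg i f) x) =
  translate (fun x => f x - avg i f x) by [].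
rewrite IH//; last by move=> x y xy; rewrite (fJ x y)// (aJ x y).
by congr energy; apply/funext => F; rewrite imfsetU1.
Qed.

End equivariance.

(** The uniform probability on [F]. For empty [F] the division by zero makes it vanish identically,
    hence the correction in [densityT]. *)
Definition density (A : set I) (F : {fset I}) : R :=
  (\sum_(i <- F) (`[< A i >])%:R) / #|` F|%:R.

Lemma density_ge0 A F : 0 <= density A F.
Proof. by rewrite divr_ge0// sumr_ge0. Qed.

Lemma densityT F : density setT F = 1 - (F == fset0)%:R.
Proof.
rewrite /density; have [->|F0] := eqVneq F fset0.
  by rewrite big_seq_fset0 mul0r subrr.
rewrite (eq_bigr (fun=> 1)) => [|i _]; last by rewrite asboolT.
rewrite big_const_seq count_predT iter_addr_0 subr0 divff//.
by rewrite pnatr_eq0 cardfs_eq0.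
Qed.

Lemma densityU A B F : (A `&` B = set0)%classic ->
  density (A `|` B)%classic F = density A F + density B F.
Proof.
move=> AB; rewrite /density -mulrDl -big_split/=; congr (_ / _).
apply: eq_bigr => i _; case: (asboolP (A i)) => Ai.
  rewrite asboolT; last by left.
  by rewrite asboolF ?addr0// => Bi; have : (A `&` B)%classic i by []; rewrite AB.
case: (asboolP (B i)) => Bi; first by rewrite asboolT ?add0r//; right.
by rewrite asboolF ?addr0// => -[].
Qed.

Lemma density_le1 A F : `|density A F| <= 1.
Proof.
rewrite ger0_norm ?density_ge0// -[leRHS]subr0.
apply: (@le_trans _ _ (1 - (F == fset0)%:R)); last by rewrite lerB// ler01.
rewrite -densityT /density; apply: ler_wpM2r; first by rewrite invr_ge0.
apply: ler_sum => i _; rewrite ler_nat.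
by rewrite (_ : `[< [set: I]%classic i >] = true) ?leq_b1//; exact/asboolT.
Qed.

Lemma density_image (sigma tau : I -> I) A F : cancel sigma tau ->
  density [set sigma i | i in A]%classic (sigma @` F)%fset = density A F.
Proof.
move=> sK; rewrite /density card_imfset/=; last exact: can_inj sK.
congr (_ / _); rewrite big_imfset/=; last by move=> i j _ _; exact: can_inj sK i j.
apply: eq_bigr => i _; congr ((_ : bool)%:R); apply/asboolP/asboolP.
  by move=> [j Aj /(can_inj sK) <-].
by exists i.
Qed.

Variables (f : (I -> Z) -> R) (J : seq I).
Hypotheses (uJ : uniq J) (JK : {subset J <= K}) (uK : uniq K)
  (fJ : depends J f) (f0 : E f = 0) (f2 : 0 < E (fun x => f x ^+ 2)).

Definition spectral_mean (A : set I) : R :=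
  energy J f (density A) / E (fun x => f x ^+ 2).

Lemma spectral_mean_ge0 A : 0 <= spectral_mean A.
Proof.
apply: divr_ge0; last exact: ltW.
by apply: energy_ge0 => F; exact: density_ge0.
Qed.

(** The total energy is the squared norm of [f], and the part missing because [density] vanishes on
    the empty set is the square of the integral of [f], which is [0]. *)
Lemma spectral_meanT : spectral_mean setT = 1.
Proof.
rewrite /spectral_mean; have -> : density setT =
    fun F => 1 * 1 + (-1) * (F == fset0)%:R.
  by apply/funext => F; rewrite densityT mul1r mulN1r.
rewrite energy_linear energy1// energy_fset0.
have -> : mean (rev J) f = fun=> 0.
  rewrite -f0; apply: (mean_depends x0); last first.
    by move=> i; rewrite mem_rev; exact: JK.
  by apply: depends_sub fJ => i; rewrite mem_rev.
by rewrite expr0n /= {2}/E mean_cst mulr0 addr0 mul1r divff// gt_eqF.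
Qed.

Lemma spectral_meanU A B : (A `&` B = set0)%classic ->
  spectral_mean (A `|` B)%classic = spectral_mean A + spectral_mean B.
Proof.
move=> AB; rewrite /spectral_mean -mulrDl; congr (_ / _).
rewrite -[RHS]/(_ + _) -[X in X + _]mul1r -[X in _ + X]mul1r -energy_linear.
by congr energy; apply/funext => F; rewrite !mul1r densityU.
Qed.

(** After reindexing by [sigma], the two values come from the energies of [f] and of
    [translate sigma f] for the same weight [density B], so only the distance from [f] to its
    translate matters. *)
Lemma spectral_mean_almost_invariant (sigma tau : I -> I) (eps : R) A :
  cancel sigma tau -> {subset map sigma J <= K} -> 0 < eps ->
  E (fun x => (f x - translate sigma f x) ^+ 2) <=
    (eps ^+ 2 / 4) * E (fun x => f x ^+ 2) ->
  `|spectral_mean [set sigma i | i in A]%classic - spectral_mean A| <= eps.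
Proof.
move=> sK sJK eps0 small.
have usJ : uniq (map sigma J) by rewrite map_inj_uniq//; exact: can_inj sK.
rewrite /spectral_mean; set B := image _ _.
have -> : density A = fun F => density B (sigma @` F)%fset.
  by apply/funext => F; rewrite (density_image _ _ sK).
rewrite -(energy_translate sK _ fJ)// -(energy_sub _ uK uJ JK fJ).
rewrite -(energy_sub _ uK usJ sJK (depends_translate fJ)).
rewrite -mulrBl normrM [X in _ * X]ger0_norm; last by rewrite invr_ge0 ltW.
rewrite ler_pdivrMr//.
(* The two integrals in [energy_lipschitz] are at most [eps ^+ 2 / 4] and [4] times the squared norm
   of [f]; with this weight each contributes [eps] times that norm. *)
have t0 : 0 < 4 / eps by rewrite divr_gt0.
have := @energy_lipschitz K f (translate sigma f) (density B) _
  (fun _ h => h) (density_le1 B) t0.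
move=> /le_trans; apply.
have sq : E (fun x => (f x + translate sigma f x) ^+ 2) <=
    4 * E (fun x => f x ^+ 2).
  have : E (fun x => (f x + translate sigma f x) ^+ 2) <=
     E (fun x => 2 * f x ^+ 2 + 2 * translate sigma f x ^+ 2).
    apply: le_E => x; rewrite -subr_ge0.
    have -> : 2 * f x ^+ 2 + 2 * translate sigma f x ^+ 2 -
      (f x + translate sigma f x) ^+ 2 = (f x - translate sigma f x) ^+ 2 by ring.
    exact: sqr_ge0.
  rewrite ED -[X in _ + 2 * X]/(E (translate sigma (fun x => f x ^+ 2))).
  rewrite (E_translate sK (J := J))//; first by lra.
  by move=> x y /fJ ->.
set a := E _ in small *; set b := E _ in sq *; set c := E _ in small sq *.
have -> : (4 / eps)^-1 = eps / 4 by rewrite invf_div.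
have h1 : 4 / eps * a <= eps * c.
  rewrite (@le_trans _ _ (4 / eps * (eps ^+ 2 / 4 * c)))//.
    by rewrite ler_wpM2l// ltW.
  by rewrite le_eqVlt; apply/orP; left; apply/eqP; field; rewrite gt_eqF.
have h2 : eps / 4 * b <= eps * c.
  rewrite (@le_trans _ _ (eps / 4 * (4 * c)))//.
    by rewrite ler_wpM2l// divr_ge0// ltW.
  by rewrite le_eqVlt; apply/orP; left; apply/eqP; field.
lra.
Qed.

End resampling.

(** * Product spaces and cylinders *)

Section product_space_measurability.
Context d (Y : measurableType d) (I : countType).
Local Notation X := (prod_space Y I).

Lemma measurable_coord (i : I) (B : set Y) : measurable B ->
  measurable ([set x | B (x i)] : set X).
Proof. by move=> mB; apply: sub_sigma_algebra; exists i, B. Qed.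

Lemma measurable_box (F : {fset I}) (B : I -> set Y) :
  (forall i, measurable (B i)) ->
  measurable ([set x | forall i, i \in F -> B i (x i)] : set X).
Proof.
move=> mB.
rewrite (_ : [set x | _] = \bigcap_(i in [set` F]) [set x | B i (x i)]) //.
apply: fin_bigcap_measurable; first exact: finite_fset.
by move=> i _; exact: measurable_coord.
Qed.

Lemma measurable_to_prod d' (T : measurableType d') (f : T -> X) :
  (forall i (B : set Y), measurable B -> measurable [set t | B (f t i)]) ->
  measurable_fun setT f.
Proof.
move=> mf; apply: (@measurability _ _ T X setT f (@coordinate_cylinders _ Y I)) => //.
by move=> _ [_ [i [B mB ->]] <-]; rewrite setTI; exact: mf.
Qed.

Definition box_system : set (set X) :=
  [set A | exists F : {fset I}, exists2 B : I -> set Y,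
    (forall i, measurable (B i)) & A = [set x | forall i, i \in F -> B i (x i)]].

Lemma box_systemI : setI_closed box_system.
Proof.
move=> _ _ [F [B mB ->]] [F' [B' mB' ->]].
exists (F `|` F')%fset.
exists (fun i => (if i \in F then B i else setT) `&`
                 (if i \in F' then B' i else setT)).
  by move=> i; apply: measurableI; case: ifP.
apply/seteqP; split => x /=.
  move=> [xF xF'] i _; split; case: ifP => //; [exact: xF|exact: xF'].
by move=> xFF; split => i iF; have := xFF i; rewrite in_fsetU iF ?orbT => /(_ isT) [].
Qed.

Lemma box_system_generates : @measurable _ X = <<s box_system >>.
Proof.
apply/seteqP; split; apply: smallest_sub.
- exact: smallest_sigma_algebra.
- move=> _ [i [B mB ->]]; apply: sub_sigma_algebra.
  exists [fset i]%fset, (fun=> B) => //; apply/seteqP; split => x /=.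
    by move=> ? j; rewrite in_fset1 => /eqP ->.
  by apply; rewrite in_fset1.
- exact: sigma_algebra_measurable.
- by move=> _ [F [B mB ->]]; exact: measurable_box.
Qed.

Lemma box_measure_unique (R : realType) (m1 m2 : {measure set X -> \bar R}) :
  (m1 setT < +oo)%E ->
  (forall (F : {fset I}) (B : I -> set Y), (forall i, measurable (B i)) ->
    m1 [set x | forall i, i \in F -> B i (x i)] =
    m2 [set x | forall i, i \in F -> B i (x i)]) ->
  forall A, measurable A -> m1 A = m2 A.
Proof.
move=> m1T m12; apply: (measure_unique box_system (fun=> setT)) => //.
- exact: box_system_generates.
- exact: box_systemI.
- move=> _; exists fset0, (fun=> setT) => //.
  by apply/seteqP; split => x.
- by rewrite bigcup_const//; exists 0%N.
- by move=> _ [F [B mB ->]]; exact: m12.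
Qed.

End product_space_measurability.

(** * Invariance of the product measure under permutations of the coordinates *)

Section reindexing.
Context d (Y : measurableType d) (I : countType) (R : realType).
Context (eta : probability Y R) (mu : probability (prod_space Y I) R).
Hypothesis mu_eta : is_product_measure eta mu.
Variables (sigma tau : I -> I).
Local Notation X := (prod_space Y I).

Definition reindex (f : I -> I) (x : X) : X := fun i => x (f i).

Lemma measurable_reindex (f : I -> I) : measurable_fun setT (reindex f).
Proof. by apply: measurable_to_prod => i B mB /=; exact: measurable_coord. Qed.

Lemma product_measure_reindex : cancel sigma tau -> cancel tau sigma ->
  forall A : set X, measurable A -> mu (reindex sigma @^-1` A) = mu A.
Proof.
move=> sK tK A mA.
pose f : {mfun X >-> X} := mfun_Sub (mem_set (measurable_reindex sigma)).
apply: (box_measure_unique (m1 := pushforward mu f)) => //.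
  by suff : (mu setT < +oo)%E by []; rewrite probability_setT ltry.
move=> F B mB; rewrite [RHS]mu_eta//.
transitivity (mu [set x | forall i, i \in (sigma @` F)%fset -> B (tau i) (x i)]).
  congr (mu _); apply/seteqP; split => x /= xB i.
    by move=> /imfsetP[j /= jF ->]; rewrite sK; exact: xB.
  by move=> iF; have := xB (sigma i); rewrite sK; apply; exact: in_imfset.
rewrite (@mu_eta (sigma @` F)%fset (B \o tau))//; last by move=> i; exact: mB.
rewrite big_imfset/=; last by move=> i j _ _; exact: can_inj sK i j.
by under eq_bigr do rewrite sK.
Qed.

End reindexing.

(** * Probabilities as real numbers *)

Section real_probability.
Context d (T : measurableType d) (R : realType) (P : probability T R).
Implicit Types A B C : set T.

Definition pr A : R := fine (P A).

Lemma prE A : measurable A -> P A = (pr A)%:E.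
Proof. by move=> mA; rewrite fineK// fin_num_measure. Qed.

Lemma pr_ge0 A : 0 <= pr A.
Proof. by rewrite fine_ge0. Qed.

Lemma le_pr A B : measurable A -> measurable B -> A `<=` B -> pr A <= pr B.
Proof. by move=> mA mB AB; rewrite -lee_fin -!prE// le_measure// inE. Qed.

Lemma prT : pr setT = 1.
Proof. by rewrite /pr probability_setT. Qed.

Lemma pr0 : pr set0 = 0.
Proof. by rewrite /pr measure0. Qed.

Lemma pr_le1 A : measurable A -> pr A <= 1.
Proof. by move=> mA; rewrite -prT le_pr. Qed.

Lemma prU A B : measurable A -> measurable B -> A `&` B = set0 ->
  pr (A `|` B) = pr A + pr B.
Proof.
move=> mA mB AB; apply: EFin_inj.
by rewrite EFinD -!prE ?measureU//; exact: measurableU.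
Qed.

Lemma prC A : measurable A -> pr (~` A) = 1 - pr A.
Proof.
move=> mA; rewrite -prT -(setUv A) prU ?setICr//; last exact: measurableC.
by rewrite addrC addKr.
Qed.

Lemma prID A B : measurable A -> measurable B ->
  pr A = pr (A `&` B) + pr (A `\` B).
Proof.
move=> mA mB; rewrite -prU; [|exact: measurableI|exact: measurableD|].
  by rewrite setUIDK.
by rewrite setDE setIACA setICr setI0.
Qed.

Lemma le_prU A B : measurable A -> measurable B -> pr (A `|` B) <= pr A + pr B.
Proof.
move=> mA mB; rewrite -lee_fin EFinD -!prE ?measureU2//; exact: measurableU.
Qed.

Lemma measurableY A B : measurable A -> measurable B -> measurable (A `+` B).
Proof. by move=> mA mB; apply: measurableU; exact: measurableD. Qed.

Lemma prY_triangle A B C : measurable A -> measurable B -> measurable C ->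
  pr (A `+` C) <= pr (A `+` B) + pr (B `+` C).
Proof.
move=> mA mB mC; apply: le_trans (le_prU _ _); try exact: measurableY.
apply: le_pr; [exact: measurableY|by apply: measurableU; exact: measurableY|].
by move=> x; rewrite /setY/= => -[[]|[]]; case: (pselect (B x)); tauto.
Qed.

Lemma prYU A B A' B' : measurable A -> measurable B ->
  measurable A' -> measurable B' ->
  pr ((A `|` B) `+` (A' `|` B')) <= pr (A `+` A') + pr (B `+` B').
Proof.
move=> mA mB mA' mB'; apply: le_trans (le_prU _ _); try exact: measurableY.
apply: le_pr; last by move=> x; rewrite /setY/=; tauto.
  by apply: measurableY; exact: measurableU.
by apply: measurableU; exact: measurableY.
Qed.

Lemma pr_near A B : measurable A -> measurable B ->
  `|pr A - pr B| <= pr (A `+` B).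
Proof.
have H A1 B1 : measurable A1 -> measurable B1 -> pr A1 - pr B1 <= pr (A1 `+` B1).
  move=> mA mB; rewrite lerBlDl; apply: le_trans (le_prU _ _) => //.
    apply: le_pr => //; first by apply: measurableU => //; exact: measurableY.
    by move=> x; rewrite /setY/=; case: (pselect (B1 x)); tauto.
  exact: measurableY.
move=> mA mB; rewrite ler_norml lerNl opprB H// setYC H//.
Qed.

Lemma pr_fin_bigcup (Z : finType) (F : Z -> set T) :
  (forall z, measurable (F z)) -> trivIset setT F ->
  P (\bigcup_z F z) = (\sum_z pr (F z))%:E.
Proof.
move=> mF tF; rewrite measure_fin_bigcup//.
  rewrite (_ : [set: Z] = [set` index_enum Z]); last first.
    by apply/seteqP; split => z //= _; exact: mem_index_enum.
  rewrite -fsbig_seq ?index_enum_uniq// -sumEFin.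
  by apply: eq_bigr => z _; exact: prE.
exact: finite_finset.
Qed.

Lemma pr_bigcup_approx (F : nat -> set T) (e : R) :
  (forall n, measurable (F n)) -> 0 < e ->
  exists N, pr (\bigcup_n F n `\` \bigcup_(n < N) F n) < e.
Proof.
move=> mF e0; pose G N := \bigcup_(n < N) F n.
have mG N : measurable (G N) by apply: bigcup_measurable => n _; exact: mF.
have GF : \bigcup_N G N = \bigcup_n F n.
  apply/seteqP; split => x; first by move=> [N _ [n _ Fn]]; exists n.
  by move=> [n _ Fn]; exists n.+1 => //; exists n => //=.
have mU : measurable (\bigcup_n F n) by exact: bigcupT_measurable.
have : P \o G @ \oo --> P (\bigcup_N G N).
  apply: nondecreasing_cvg_mu => //; first by rewrite GF.
  move=> m n mn; apply/subsetPset => x [k km Fk]; exists k => //=.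
  exact: leq_trans km mn.
rewrite GF (prE mU).
have -> : P \o G = EFin \o (pr \o G) by apply/funext => N /=; rewrite prE.
move=> /fine_cvgP[_] /cvgrPdist_lt /(_ _ e0) [N _ /(_ N (leqnn N))] /= dN.
exists N; apply: le_lt_trans dN; rewrite -/(G N).
have := prID mU (mG N); rewrite setIidr => [->|x [k km Fk]]; last by exists k.
by rewrite addrAC subrr add0r ler_norm.
Qed.

End real_probability.

(** * Cylinder sets and their density in the measure algebra *)

Section cylinders.
Context d (Y : measurableType d) (I : countType) (R : realType).
Context (eta : probability Y R) (mu : probability (prod_space Y I) R).
Hypothesis mu_eta : is_product_measure eta mu.
Local Notation X := (prod_space Y I).

Definition weight (Z : finType) (q : Y -> Z) (z : Z) : R :=
  pr eta (q @^-1` [set z]).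

Definition discretize (Z : Type) (q : Y -> Z) (x : X) : I -> Z :=
  fun i => q (x i).

Definition cyl (Z : Type) (q : Y -> Z) (b : (I -> Z) -> bool) : set X :=
  [set x | b (discretize q x)].

Definition quantizer (Z : finType) (q : Y -> Z) : Prop :=
  forall z, measurable (q @^-1` [set z]).

Lemma weight_ge0 (Z : finType) (q : Y -> Z) z : 0 <= weight q z.
Proof. exact: pr_ge0. Qed.

(** The coordinates in [F] are frozen at [z], those in [K] are still free. Freezing one more
    coordinate and summing over its values is the recursion that defines [mean]; this identifies the
    algebraic averages with [mu]. *)
Lemma cyl_box (Z : finType) (q : Y -> Z) (b : (I -> Z) -> bool) (K : seq I)
    (F : {fset I}) (z : I -> Z) : quantizer q -> uniq K ->
  {in K, forall i, i \notin F} -> depends (K ++ F) b ->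
  let A : set X := [set x | (forall i, i \in F -> q (x i) = z i)] `&` cyl q b in
  measurable A /\
  mu A = ((\prod_(i <- F) weight q (z i)) *
          mean (weight q) K (fun y => (b y)%:R) z)%:E.
Proof.
move=> mq.
have mbox (G : {fset I}) (y : I -> Z) :
    measurable ([set x | forall i, i \in G -> q (x i) = y i] : set X).
  by apply: (@measurable_box _ _ _ G (fun i => q @^-1` [set y i])) => i; exact: mq.
elim: K F z => [|i K IH] F z.
  move=> _ _ bF A; rewrite /A {A}; case: (boolP (b z)) => bz.
    rewrite setIidl => [|x xF]; last first.
      by rewrite /cyl/= (bF _ z)// => i iF; exact: xF.
    split => //; rewrite /mean/= bz mulr1 -prodEFin.
    rewrite (@mu_eta F (fun i => q @^-1` [set z i]))//.
    by apply: eq_bigr => i _; rewrite -prE.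
  rewrite /mean/= (negbTE bz) mulr0; set A := _ `&` _; suff -> : A = set0 by rewrite measure0.
  apply/seteqP; split => // x [xF]; rewrite /cyl/= (bF _ z) ?(negbTE bz)//.
rewrite cons_uniq => /andP[iK uK] KF bKF A.
have iF : i \notin F by rewrite KF// mem_head.
have {}IH c := IH (i |` F)%fset (upd z i c) uK.
pose B c : set X := [set x | (forall j, j \in (i |` F)%fset -> q (x j) = upd z i c j)]
  `&` cyl q b.
have AB : A = \bigcup_c B c.
  apply/seteqP; split => x.
    move=> [xF bx]; exists (q (x i)) => //; split => // j.
    rewrite in_fset1U /upd; case: eqP => [->//|_ /=]; exact: xF.
  move=> [c _ [xF bx]]; split => // j jF.
  have := xF j; rewrite in_fset1U jF orbT => ->//.
  by rewrite /upd; case: eqP => // ji; move: iF; rewrite -ji jF.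
have {}IH c : measurable (B c) /\ mu (B c) =
   ((weight q c * \prod_(j <- F) weight q (z j)) *
    mean (weight q) K (fun y => (b y)%:R) (upd z i c))%:E.
  have [||mB ->] := IH c.
  - move=> j jK; rewrite in_fset1U negb_or KF ?inE ?jK ?orbT// andbT.
    by apply/eqP => ji; move: iK; rewrite -ji jK.
  - apply: depends_sub bKF => j; rewrite !inE !mem_cat.
    by rewrite in_fset1U orbCA.
  split => //; congr (_ * _)%:E.
  rewrite big_fsetU1//=; congr (weight q _ * _); first by rewrite /upd eqxx.
  rewrite big_seq [RHS]big_seq; apply: eq_bigr => j jF.
  by rewrite /upd; case: eqP => // ji; move: iF; rewrite -ji jF.
split.
  by rewrite AB; apply: fin_bigcup_measurable => // c _; have [] := IH c.
rewrite AB pr_fin_bigcup.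
- congr EFin; rewrite [mean _ _ _ z](_ : _ = \sum_c weight q c *
    mean (weight q) K (fun y => (b y)%:R) (upd z i c))// mulr_sumr.
  apply: eq_bigr => c _; rewrite /pr (IH c).2/=.
  by rewrite mulrCA mulrA.
- by move=> c; have [] := IH c.
- move=> c c' _ _ [x [[xc _] [xc' _]]].
  have := xc i; rewrite in_fset1U eqxx /upd eqxx => /(_ isT) <-.
  by have := xc' i; rewrite in_fset1U eqxx /upd eqxx => /(_ isT) <-.
Qed.

Lemma weight_sum1 (Z : finType) (q : Y -> Z) : quantizer q ->
  \sum_z weight q z = 1.
Proof.
move=> mq; apply: EFin_inj; rewrite -pr_fin_bigcup//.
  rewrite -(@probability_setT _ _ _ eta); congr (eta _).
  by apply/seteqP; split => // y _; exists (q y).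
by move=> z z' _ _ [y [<- <-]].
Qed.

Lemma cyl_mean (Z : finType) (q : Y -> Z) (b : (I -> Z) -> bool) (K : seq I) z :
  quantizer q -> uniq K -> depends K b ->
  measurable (cyl q b) /\
  pr mu (cyl q b) = mean (weight q) K (fun y => (b y)%:R) z.
Proof.
move=> mq uK bK.
have [||mb mub] := @cyl_box Z q b K fset0 z mq uK _ _.
- by [].
- by rewrite cats0.
move: mb mub; rewrite big_seq_fset0 mul1r.
have -> : [set x : X | forall i, i \in fset0 -> q (x i) = z i] = setT.
  by apply/seteqP; split => x.
by rewrite setTI => mb mub; split => //; rewrite /pr mub.
Qed.

(** One finite partition [q] of [Y] serves for all the coordinates, so that the calculus over a
    finite alphabet applies to an arbitrary [Y]. *)
Definition cylinder (A : set X) : Prop :=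
  exists (Z : finType) (q : Y -> Z) (J : seq I) (b : (I -> Z) -> bool),
    [/\ quantizer q, uniq J, depends J b & A = cyl q b].

Lemma cylinder_measurable A : cylinder A -> measurable A.
Proof.
move=> [Z [q [J [b [mq uJ bJ ->]]]]].
by have [] := cyl_mean (fun=> q point) mq uJ bJ.
Qed.

Lemma cylinderC A : cylinder A -> cylinder (~` A).
Proof.
move=> [Z [q [J [b [mq uJ bJ ->]]]]]; exists Z, q, J, (fun y => ~~ b y).
split => //; first by move=> x y /bJ ->.
by apply/seteqP; split => x /negP.
Qed.

Lemma cylinderU A B : cylinder A -> cylinder B -> cylinder (A `|` B).
Proof.
move=> [Z [q [J [b [mq uJ bJ ->]]]]] [Z' [q' [J' [b' [mq' uJ' bJ' ->]]]]].
exists (Z * Z')%type, (fun y => (q y, q' y)), (undup (J ++ J')).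
exists (fun y => b (fst \o y) || b' (snd \o y)); split.
- move=> [z z']; rewrite (_ : _ @^-1` _ = q @^-1` [set z] `&` q' @^-1` [set z']).
    exact: measurableI.
  by apply/seteqP; split => y /=; [case=> -> ->|case=> -> ->].
- exact: undup_uniq.
- move=> x y xy; congr (_ || _).
    by apply: bJ => i iJ /=; rewrite xy// mem_undup mem_cat iJ.
  by apply: bJ' => i iJ /=; rewrite xy// mem_undup mem_cat iJ orbT.
- by apply/seteqP; split => x /orP.
Qed.

Lemma cylinder_coord i (B : set Y) : measurable B -> cylinder [set x | B (x i)].
Proof.
move=> mB; exists bool, (fun y => `[< B y >]), [:: i], (fun y => y i).
split => //.
- case.
    rewrite (_ : _ @^-1` _ = B)//; apply/seteqP; split => y /=.
      by move/asboolP. by move/asboolP.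
  rewrite (_ : _ @^-1` _ = ~` B); first exact: measurableC.
  by apply/seteqP; split => y /=; [move/asboolPn|move=> yB; apply/asboolPn].
- by move=> x y; apply; rewrite mem_head.
- by apply/seteqP; split => x /= /asboolP.
Qed.

Lemma cylinder0 : cylinder set0.
Proof.
exists unit, (fun=> tt), [::], (fun=> false); split => //; last by apply/seteqP; split.
by move=> []; rewrite (_ : _ @^-1` _ = setT)//; apply/seteqP; split.
Qed.

(** The approximable sets form a sigma-algebra that contains the generating cylinders; a countable
    union is cut to a finite one at cost [e / 2]. *)
Lemma cylinder_approx (A : set X) (e : R) : measurable A -> 0 < e ->
  exists2 B, cylinder B & pr mu (A `+` B) < e.
Proof.
move=> mA; move: e.
pose D : set (set X) := [set A | measurable A /\ forall e, 0 < e ->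
  exists2 B, cylinder B & pr mu (A `+` B) < e].
suff /(_ A mA)[] : @measurable _ X `<=` D by [].
have cm := cylinder_measurable.
have cylD B : cylinder B -> D B.
  move=> cB; split; first exact: cm.
  by move=> e e0; exists B => //; rewrite setYK pr0.
have DU A1 A2 : D A1 -> D A2 -> D (A1 `|` A2).
  move=> [m1 d1] [m2 d2]; split; first exact: measurableU.
  move=> e e0; have e20 : 0 < e / 2 by rewrite divr_gt0.
  have [B1 c1 AB1] := d1 _ e20; have [B2 c2 AB2] := d2 _ e20.
  exists (B1 `|` B2); first exact: cylinderU.
  apply: le_lt_trans (prYU _ _ _ _ _) _ => //; try exact: cm.
  by rewrite [ltRHS]splitr ltrD.
apply: smallest_sub; last first.
  by move=> _ [i [B mB ->]]; apply: cylD; exact: cylinder_coord.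
split.
- by apply: cylD; exact: cylinder0.
- move=> B [mB dB]; rewrite setTD; split; first exact: measurableC.
  move=> e /dB[C cC BC]; exists (~` C); first exact: cylinderC.
  rewrite (_ : _ `+` _ = B `+` C)//.
  by apply/seteqP; split => x; rewrite /setY/=;
    case: (pselect (B x)); case: (pselect (C x)); tauto.
- move=> F DF; have mF n : measurable (F n : set X) by have [] := DF n.
  split; first exact: bigcupT_measurable.
  move=> e e0; have e20 : 0 < e / 2 by rewrite divr_gt0.
  have [N HN] := pr_bigcup_approx mu mF e20.
  have [mG /(_ _ e20)[B cB GB]] : D (\bigcup_(n < N) F n).
    elim: N {HN} => [|N IH]; first by rewrite bigcup_mkord big_ord0; exact/cylD/cylinder0.
    by rewrite bigcup_mkord big_ord_recr/= -bigcup_mkord; exact: DU.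
  exists B => //; apply: le_lt_trans (prY_triangle _ _ mG _) _ => //.
  + exact: bigcupT_measurable.
  + exact: cm.
  rewrite [ltRHS]splitr ltrD// setY_def [X in _ `|` X](_ : _ = set0) ?setU0//.
  by apply/seteqP; split => // x [[n _ Fn] []]; exists n.
Qed.

End cylinders.

(** * Spectral gap of generalized Bernoulli actions *)

(** Only an inclusion, since [C] may be empty; indices that code no element of [C] are sent to
    [t0]. *)
Lemma countable_range (T : choiceType) (t0 : T) (C : set T) : countable C ->
  exists c : nat -> T, C `<=` range c.
Proof.
move=> /countable_injP[f finj].
exists (fun n => xget t0 [set u | C u /\ f u = n]) => t Ct; exists (f t) => //.
case: xgetP => [u _ [Cu fu]|/(_ t) []//].
by apply: finj; rewrite ?inE.
Qed.

Lemma countable_enumeration (T : choiceType) (t0 : T) : countable [set: T] ->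
  exists e : nat -> T, forall t, exists n, e n = t.
Proof.
move=> /(countable_range t0)[e eT]; exists e => t.
by have [n _ <-] := eT t Logic.I; exists n.
Qed.

Section mean_limit.
Context (R : realType) (T : Type).

(** The segment from [0] to [1] is compact, and a cluster point of an ultrafilter is a limit. *)
Lemma ultrafilter_bounded_cvg (U : set_system nat) (u : nat -> R) :
  UltraFilter U -> (forall n, 0 <= u n <= 1) ->
  exists l : R, u n @[n --> U] --> l.
Proof.
move=> UU u01.
have FU : ProperFilter (u n @[n --> U]) by apply: fmap_proper_filter.
have := @segment_compact R 0 1 _ FU.
case=> [|l [_ lU]].
  apply: (@filterE _ U) => n; rewrite /= in_itv/=; exact: u01.
exists l => V Vl; have [//|nV] := in_ultra_setVsetC (u @^-1` V) UU.
have [] := lU (~` V) V; [exact: nV|exact: Vl|].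
by move=> x [].
Qed.

(* Finitely additive probabilities that are approximately invariant under more
   and more maps have an ultrafilter limit, which is invariant. *)
Lemma invariant_mean_of_approx (L : Type) (act : L -> T -> T) (e : nat -> L)
    (m_ : nat -> set T -> R) :
  (forall g, exists n, e n = g) ->
  (forall n A, 0 <= m_ n A) -> (forall n, m_ n setT = 1) ->
  (forall n A B, A `&` B = set0 -> m_ n (A `|` B) = m_ n A + m_ n B) ->
  (forall n k A, (k < n)%N -> `|m_ n (act (e k) @` A) - m_ n A| <= n.+1%:R^-1) ->
  exists m : set T -> R, invariant_mean act m.
Proof.
move=> esurj m0 mT mU minv.
have m1 n A : m_ n A <= 1.
  rewrite -(mT n) -(setUv A) mU ?setICr//.
  by rewrite lerDl m0.
(* Finer than convergence at infinity, so that genuine limits are also limits along [U]. *)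
have [U [UU subU]] := @ultraFilterLemma nat \oo _.
have /choice[m mP] A : exists l : R, m_ n A @[n --> U] --> l.
  by apply: ultrafilter_bounded_cvg => // n; rewrite m0 m1.
have lim_uniq (u : nat -> R) (a b : R) : u n @[n --> U] --> a ->
    u n @[n --> U] --> b -> a = b.
  by move=> ua ub; exact: (cvg_unique (@Rhausdorff R) ua ub).
exists m; split.
- move=> A; apply: (@closed_cvg _ _ U _ (m_ ^~ A) [set x : R | 0 <= x]).
  + exact: closed_ge.
  + by apply: filterE => n /=; exact: m0.
  + exact: mP.
- apply: lim_uniq (mP setT) _.
  by under eq_fun do rewrite mT; exact: cvg_cst.
- move=> A B AB; apply: lim_uniq (mP _) _.
  by under eq_fun do rewrite (mU _ _ _ AB); apply: cvgD; exact: mP.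
- move=> g A; have [k <-] := esurj g; apply/eqP; rewrite -subr_eq0; apply/eqP.
  apply: (lim_uniq (fun n => m_ n (act (e k) @` A) - m_ n A)).
    by apply: cvgB; exact: mP.
  have : (fun n => m_ n (act (e k) @` A) - m_ n A) @ \oo --> (0 : R).
    apply/cvgr0Pnorm_le => eps eps0; near=> n.
    apply: le_trans (minv n k A _) _; first by near: n; exact: nbhs_infty_gt.
    by apply/ltW; near: n; exact: (near_infty_natSinv_lt (PosNum eps0)).
  by move=> c V /c; exact: subU.
Unshelve. all: by end_near. Qed.

End mean_limit.

Section spectral_gap.
Context d (Y : measurableType d) (I : countType) (R : realType).
Context (eta : probability Y R) (mu : probability (prod_space Y I) R).
Hypothesis mu_eta : is_product_measure eta mu.
Context (L : groupType) (act : L -> I -> I).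
Hypothesis act_action : is_action act.
Local Notation X := (prod_space Y I).
Local Notation shift := Defs.shift.
Implicit Types (A B : set X) (g : L).

Lemma actK g : cancel (act g) (act g^-1%g).
Proof. by case: act_action => a1 aM i; rewrite -aM mulVg a1. Qed.

Lemma actVK g : cancel (act g^-1%g) (act g).
Proof. by case: act_action => a1 aM i; rewrite -aM mulgV a1. Qed.

Lemma shiftK g : cancel (shift act g : X -> X) (shift act g^-1%g).
Proof. by move=> x; apply/funext => i; rewrite /shift invgK actK. Qed.

Lemma shiftVK g : cancel (shift act g^-1%g : X -> X) (shift act g).
Proof. by move=> x; apply/funext => i; rewrite /shift invgK actVK. Qed.

Lemma measurable_shift g : measurable_fun setT (shift act g : X -> X).
Proof. exact: measurable_reindex. Qed.

Lemma measurable_shift_preimage g A : measurable A ->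
  measurable ((shift act g : X -> X) @^-1` A).
Proof. by move=> mA; rewrite -[X in measurable X]setTI; exact: measurable_shift. Qed.

Lemma shift_measure g A : measurable A ->
  mu ((shift act g : X -> X) @^-1` A) = mu A.
Proof.
exact: (product_measure_reindex mu_eta (sigma := act g^-1%g) (tau := act g)
  (actVK g) (actK g)).
Qed.

Lemma pr_shift g A : measurable A -> pr mu ((shift act g : X -> X) @^-1` A) = pr mu A.
Proof. by move=> mA; rewrite /pr shift_measure. Qed.

Definition escape g A : R := pr mu (A `\` (shift act g : X -> X) @^-1` A).

(** A measure-preserving bijection moves as much mass out of [A] as into it, so both halves of the
    symmetric difference have mass [escape g A]. *)
Lemma escape_symm g A : measurable A ->
  pr mu (A `+` (shift act g^-1%g : X -> X) @^-1` A) = 2 * escape g A.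
Proof.
move=> mA; set B := _ @^-1` A.
have mB : measurable B by exact: measurable_shift_preimage.
have mgA : measurable ((shift act g : X -> X) @^-1` A).
  exact: measurable_shift_preimage.
have AB : pr mu (A `\` B) = escape g A.
  rewrite -(pr_shift g); last exact: measurableD.
  rewrite (_ : _ @^-1` (A `\` B) = (shift act g : X -> X) @^-1` A `\` A); last first.
    by apply/seteqP; split => x; rewrite /B/= shiftK.
  have := prID mu mgA mA; rewrite pr_shift// (prID mu mA mgA) setIC.
  by move/addrI => <-.
have BA : pr mu (B `\` A) = pr mu (A `\` B).
  have := prID mu mB mA; rewrite pr_shift// (prID mu mA mB) setIC.
  by move/addrI => <-.
rewrite prU ?BA ?AB; [ring|exact: measurableD|exact: measurableD|].
by apply/seteqP; split => // x [[? ?] [? ?]].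
Qed.

(** For the centred indicator [f] of [B], the squared norm is the variance [pr mu B * (1 - pr mu B)]
    and the squared distance from [f] to its translate is the mass of a symmetric difference, that
    is [2 * escape g B]. The smallness assumption is then the one of
    [spectral_mean_almost_invariant]. *)
Lemma cylinder_approx_mean (S : seq L) (eps : R) (B : set X) :
  0 < eps -> cylinder B -> 0 < pr mu B * (1 - pr mu B) ->
  {in S, forall g, 2 * escape g B <= eps ^+ 2 / 4 * (pr mu B * (1 - pr mu B))} ->
  exists m : set I -> R, [/\ forall A : set I, 0 <= m A, m setT = 1,
    forall A A' : set I, A `&` A' = set0 -> m (A `|` A') = m A + m A' &
    {in S, forall g (A : set I), `|m (act g @` A) - m A| <= eps}].
Proof.
move=> eps0 cB; have [Z [q [J [b [mq uJ bJ BE]]]]] := cB.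
set v := _ * _ => v0 small.
pose p := weight eta q.
have p0 z : 0 <= p z by exact: weight_ge0.
have p1 : \sum_z p z = 1 by exact: weight_sum1.
pose x0 : I -> Z := fun=> q point.
(* Contains [J] and its images under [S], so that [f] and all its translates are integrated over the
   same coordinates. *)
pose K := undup (J ++ flatten [seq map (act g) J | g <- S]).
have uK : uniq K by exact: undup_uniq.
have JK : {subset J <= K} by move=> i iJ; rewrite mem_undup mem_cat iJ.
have sJK g : g \in S -> {subset map (act g) J <= K}.
  move=> gS i iJ; rewrite mem_undup mem_cat; apply/orP; right.
  by apply/flattenP; exists (map (act g) J) => //; exact: map_f.
pose E u := mean p K u x0.
have Ecyl (b' : (I -> Z) -> bool) : depends K b' ->
    E (fun y => (b' y)%:R) = pr mu (cyl q b').
  by move=> b'K; have [_ ->] := cyl_mean mu_eta x0 mq uK b'K.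
have EB : E (fun y => (b y)%:R) = pr mu B.
  by rewrite BE; apply: Ecyl; exact: depends_sub bJ.
pose c := pr mu B.
pose f y : R := (b y)%:R - c.
have fJ : depends J f by move=> x y /bJ bxy; rewrite /f bxy.
have E1 : E (fun=> 1) = 1 by rewrite /E mean_cst.
have f0 : E f = 0.
  have -> : f = fun y => 1 * (b y)%:R + (- c) * 1.
    by apply/funext => y; rewrite /f; ring.
  by rewrite /E meanD -/(E _) -/(E _) EB E1 /c; ring.
have f2 : E (fun y => f y ^+ 2) = v.
  have -> : (fun y => f y ^+ 2) = fun y => (1 - 2 * c) * (b y)%:R + c ^+ 2 * 1.
    by apply/funext => y; rewrite /f; case: (b y); rewrite /=; ring.
  by rewrite /E meanD -/(E _) -/(E _) EB E1 /v /c; ring.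
have f2p : 0 < mean p K (fun y => f y ^+ 2) x0 by rewrite -/(E _) f2.
exists (spectral_mean p x0 K f J); split.
- by move=> A; exact: spectral_mean_ge0.
- exact: spectral_meanT.
- by move=> A A'; exact: spectral_meanU.
move=> g gS A.
have H := @spectral_mean_almost_invariant _ _ _ _ p0 p1 x0 K f J uJ JK uK fJ f2p _ _ eps A (actK g).
apply: H => //.
  exact: sJK.
rewrite -/(E _) -/(E (fun y => f y ^+ 2)) f2; apply: le_trans (small _ gS).
have -> : (fun x => (f x - translate (act g) f x) ^+ 2) =
    fun x => (b x (+) b (x \o act g))%:R.
  apply/funext => x; rewrite /f /translate/=.
  by case: (b x); case: (b _); rewrite /=; ring.
rewrite Ecyl; last first.
  move=> x y xy; congr (_ (+) _); apply: bJ => i iJ /=.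
    by apply: xy; exact: JK.
  by apply: xy; apply: (sJK _ gS); exact: map_f.
rewrite -escape_symm; last exact: (cylinder_measurable mu_eta).
rewrite le_eqVlt; apply/orP; left; apply/eqP; congr (pr mu _).
rewrite BE; apply/seteqP; split => x; rewrite /cyl /setY /= /shift invgK.
  rewrite -/(discretize q x).
  have -> : discretize q (fun i => x (act g i)) = discretize q x \o act g by [].
  by case: (b _); case: (b _) => //= _; [left|right].
rewrite -/(discretize q x).
have -> : discretize q (fun i => x (act g i)) = discretize q x \o act g by [].
by case: (b _); case: (b _) => //= -[[]|[]].
Qed.

(** A point that leaves [B] leaves [A], or lies in the symmetric difference, or is moved into it. *)
Lemma escape_near g A B : measurable A -> measurable B ->
  escape g B <= escape g A + 2 * pr mu (A `+` B).
Proof.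
move=> mA mB.
have mgA := measurable_shift_preimage g mA.
have mgB := measurable_shift_preimage g mB.
have mAB := measurableY mA mB.
have mgAB := measurable_shift_preimage g mAB.
rewrite mulr2n mulrDl mul1r -{2}(pr_shift g)// addrA.
apply: (@le_trans _ _ (pr mu ((A `\` (shift act g : X -> X) @^-1` A `|` (A `+` B))
    `|` (shift act g : X -> X) @^-1` (A `+` B)))).
  apply: le_pr.
  - exact: measurableD.
  - apply: measurableU => //; apply: measurableU => //; exact: measurableD.
  - move=> x [Bx nB]; rewrite /setY/=; move: nB => /=.
    case: (pselect (A x)); case: (pselect (A (shift act g x))); tauto.
apply: le_trans (le_prU _ _ _) _ => //.
  by apply: measurableU => //; exact: measurableD.
by rewrite lerD2r; apply: le_prU => //; exact: measurableD.
Qed.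

Definition has_spectral_gap : Prop :=
  exists (S : seq L), exists2 kappa : R, 0 < kappa &
    forall A, measurable A ->
      kappa * (pr mu A * (1 - pr mu A)) <= \sum_(g <- S) escape g A.

Lemma spectral_gap : countable [set: L] ->
  ~ (exists m : set I -> R, invariant_mean act m) -> has_spectral_gap.
Proof.
move=> cL nomean; apply: contrapT => nogap; apply: nomean.
have [e esurj] : exists e : nat -> L, forall g, exists n, e n = g.
  exact: countable_enumeration 1%g cL.
have approx n : exists m : set I -> R, [/\ forall A : set I, 0 <= m A, m setT = 1,
    forall A A' : set I, A `&` A' = set0 -> m (A `|` A') = m A + m A' &
    {in [seq e k | k <- iota 0 n], forall g (A : set I),
      `|m (act g @` A) - m A| <= n.+1%:R^-1}].
  set S := [seq _ | _ <- _]; set eps : R := _^-1.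
  have eps0 : 0 < eps by rewrite invr_gt0.
  (* A cylinder [B] within [kappa * v] of [A] has variance at least [v / 2] and
     [escape g B <= 3 * kappa * v]. Then [2 * escape g B] is at most [6 * kappa * v], below the
     [20 * kappa * (v / 2)] that [cylinder_approx_mean] allows, as [eps ^+ 2 / 4 = 20 * kappa]. *)
  pose kappa := eps ^+ 2 / 80.
  have kappa0 : 0 < kappa by rewrite divr_gt0// exprn_gt0.
  have kappa1 : kappa <= 1 / 80.
    rewrite /kappa ler_wpM2r//.
    by rewrite exprn_ile1//; [exact: ltW|rewrite invf_le1// ler1n].
  have [A mA small] : exists2 A, measurable A &
      \sum_(g <- S) escape g A < kappa * (pr mu A * (1 - pr mu A)).
    apply: contrapT => H; apply: nogap; exists S, kappa => // A mA.
    by rewrite leNgt; apply/negP => sm; apply: H; exists A.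
  set v := pr mu A * _ in small.
  have v0 : 0 < v.
    rewrite -(pmulr_rgt0 _ kappa0); apply: le_lt_trans small.
    by apply: sumr_ge0 => g _; exact: pr_ge0.
  have [B cB AB] := cylinder_approx mu_eta mA (mulr_gt0 kappa0 v0).
  have mB := cylinder_measurable mu_eta cB.
  have := pr_near mu mA mB; rewrite ler_norml => /andP[AB1 AB2].
  have A0 := pr_ge0 mu A; have A1 := pr_le1 mu mA.
  have B0 := pr_ge0 mu B; have B1 := pr_le1 mu mB.
  have vB : v / 2 <= pr mu B * (1 - pr mu B).
    have h1 : kappa * v <= v / 80.
      by rewrite mulrC ler_wpM2l ?(ltW v0)//; move: kappa1; rewrite div1r.
    have -> : pr mu B * (1 - pr mu B) =
      v - (pr mu A - pr mu B) * (1 - pr mu A - pr mu B) by rewrite /v; ring.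
    have h2 : (pr mu A - pr mu B) * (1 - pr mu A - pr mu B) <= v / 80.
      apply: le_trans (ler_norm _) _; rewrite normrM -[leRHS]mulr1.
      apply: ler_pM => //.
        by apply: le_trans (pr_near mu mA mB) _; apply: le_trans (ltW AB) _.
      by rewrite ler_norml; apply/andP; split; lra.
    by lra.
  apply: (@cylinder_approx_mean S eps B) => //.
    by apply: lt_le_trans vB; rewrite divr_gt0.
  move=> g gS.
  have eg : escape g A <= kappa * v.
    apply: le_trans (ltW small); rewrite (big_rem g)//= lerDl.
    by apply: sumr_ge0 => h _; exact: pr_ge0.
  have := escape_near g mA mB.
  set a := escape g B => h.
  have : 2 * a <= 6 * (kappa * v) by lra.
  move=> /le_trans; apply.
  have -> : eps ^+ 2 / 4 = 20 * kappa by rewrite /kappa; field.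
  rewrite -mulrA; have : kappa * (v / 2) <= kappa * (pr mu B * (1 - pr mu B)).
    by rewrite ler_wpM2l// ltW.
  have kv := mulr_gt0 kappa0 v0.
  by rewrite (mulrA kappa v); move: kv; set w := kappa * v; set w' := kappa * (_ * _); lra.
have [m mP] := choice approx.
apply: (invariant_mean_of_approx (e := e) (m_ := m)) => //.
- by move=> n A; have [] := mP n.
- by move=> n; have [] := mP n.
- by move=> n A B; have [_ _ H _] := mP n; exact: H.
- move=> n k A kn; have [_ _ _ H] := mP n; apply: H.
  by apply: map_f; rewrite mem_iota.
Qed.

End spectral_gap.

(** * Atoms of functions with countably many increments *)

Section folner.
Context (R : realType).
Implicit Types (E : seq R) (N : nat).

(** Sums of entries of [E] with coefficients from [0] to [N]. Their number is at most polynomial in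
    [N], of degree [size E]; additive relations between the entries only produce repetitions, which
    [undup] removes. *)
Definition lattice_box E N : seq R :=
  undup [seq \sum_(j < size E) (c j : nat)%:R * E`_j
    | c : {ffun 'I_(size E) -> 'I_N.+1}].

Lemma lattice_boxP E N x : reflect
  (exists c : {ffun 'I_(size E) -> 'I_N.+1}, x = \sum_(j < size E) (c j : nat)%:R * E`_j)
  (x \in lattice_box E N).
Proof.
rewrite mem_undup; apply: (iffP mapP) => [[c _ ->]|[c ->]]; first by exists c.
by exists c => //; rewrite mem_enum.
Qed.

Lemma lattice_box_size E N : (size (lattice_box E N) <= N.+1 ^ size E)%N.
Proof.
apply: leq_trans (size_undup _) _.
by rewrite size_image card_ffun !card_ord.
Qed.

Lemma lattice_box_sub E N : {subset lattice_box E N <= lattice_box E N.+1}.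
Proof.
move=> x /lattice_boxP[c ->]; apply/lattice_boxP.
exists [ffun j => widen_ord (leqnSn _) (c j)].
by apply: eq_bigr => j _; rewrite ffunE.
Qed.

Lemma lattice_box_add E N e x : e \in E -> x \in lattice_box E N ->
  x + e \in lattice_box E N.+1.
Proof.
move=> eE /lattice_boxP[c ->]; apply/lattice_boxP.
have kE : (index e E < size E)%N by rewrite index_mem.
pose k := Ordinal kE.
have cB j : (c j + (j == k) < N.+2)%N.
  by have := ltn_ord (c j); case: (j == k); lia.
exists [ffun j => Ordinal (cB j)].
rewrite (bigD1 k)//= [RHS](bigD1 k)//= ffunE /= eqxx natrD mulrDl mul1r.
rewrite (nth_index _ eE) addrAC; congr (_ + _).
by apply: eq_bigr => j jk; rewrite ffunE /= (negbTE jk) addn0.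
Qed.

Lemma lattice_box_gt0 E N : (0 < size (lattice_box E N))%N.
Proof.
have : \sum_(j < size E) ([ffun=> ord0] j : 'I_N.+1)%:R * E`_j \in lattice_box E N.
  by apply/lattice_boxP; eexists.
by case: (lattice_box E N).
Qed.

Lemma exp_beats_poly (q : R) (m : nat) (a : nat -> R) : 0 < q ->
  1 <= a 0%N -> (forall N, (1 + q) * a N <= a N.+1) ->
  (forall N, a N <= N.+1%:R ^+ m) -> False.
Proof.
move=> q0 a0 agrow apoly.
have age n : 1 + n%:R * q <= (1 + q) ^+ n.
  elim: n => [|n IH]; first by rewrite mul0r addr0 expr0.
  rewrite exprS (le_trans _ (ler_wpM2l _ IH))//; last by rewrite addr_ge0 ?(ltW q0).
  rewrite -natr1; have : 0 <= n%:R * (q * q) by rewrite !mulr_ge0 ?(ltW q0).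
  lra.
have aexp n : (1 + q) ^+ n <= a n.
  elim: n => [|n IH]; first by rewrite expr0.
  rewrite exprS (le_trans _ (agrow n))// ler_wpM2l ?addr_ge0 ?(ltW q0)//.
(* The comparison takes place at index [n * m.+1]: growth gives at least [(n * q) ^+ m.+1], the
   polynomial bound at most [(n * m.+2) ^+ m], and these are incompatible once
   [n * q ^+ m.+1 > m.+2 ^+ m]. The successor keeps [n] positive. *)
pose n := (Num.bound (m.+2%:R ^+ m / q ^+ m.+1 : R)).+1.
have nbig : m.+2%:R ^+ m / q ^+ m.+1 < n%:R :> R.
  have M0 : 0 <= m.+2%:R ^+ m / q ^+ m.+1 :> R.
    by rewrite divr_ge0// exprn_ge0// ltW.
  by apply: lt_le_trans (archi_boundP M0) _; rewrite ler_nat.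
have h1 : (n%:R * q) ^+ m.+1 <= (1 + q) ^+ (n * m.+1).
  rewrite exprM; apply: lerXn2r.
  - by rewrite nnegrE mulr_ge0 ?(ltW q0).
  - by rewrite nnegrE exprn_ge0 ?addr_ge0 ?(ltW q0).
  - by apply: le_trans (age n); rewrite lerDr.
have h2 : (1 + q) ^+ (n * m.+1) <= (n * m.+2)%:R ^+ m.
  apply: le_trans (aexp _) _; apply: le_trans (apoly _) _.
  apply: lerXn2r; rewrite ?nnegrE// ler_nat !mulnS; lia.
have := le_trans h1 h2.
rewrite exprMn natrM exprMn exprS -mulrA mulrCA ler_pM2l ?exprn_gt0 ?ltr0n//.
by rewrite leNgt -ltr_pdivrMr ?exprn_gt0// nbig.
Qed.

(** Polynomial growth forces [size (lattice_box E N.+1) < (1 + q) * size (lattice_box E N)] for some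
    [N]. For [d] in the larger box, [d - e] can leave it only when [d] is not in the smaller box
    translated by [e], and this translate fills most of the larger box. *)
Lemma folner E (q : R) : 0 < q -> exists Phi : seq R, [/\ uniq Phi,
  (0 < size Phi)%N & {in E, forall e,
    (count (fun d => d - e \notin Phi) Phi)%:R <= q * (size Phi)%:R}].
Proof.
move=> q0.
have [N grow] : exists N, (size (lattice_box E N.+1))%:R <
    (1 + q) * (size (lattice_box E N))%:R.
  apply: contrapT => nogrow.
  apply: (@exp_beats_poly q (size E) (fun N => (size (lattice_box E N))%:R)) => //.
  - by rewrite ler1n lattice_box_gt0.
  - by move=> N; rewrite leNgt; apply/negP => h; apply: nogrow; exists N.
  - by move=> N; rewrite -natrX ler_nat lattice_box_size.
exists (lattice_box E N.+1); split; first exact: undup_uniq.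
  exact: lattice_box_gt0.
move=> e eE; set Phi := lattice_box E N.+1.
have sz : (count (fun d => (d - e)%R \notin Phi) Phi + size (lattice_box E N)
    <= size Phi)%N.
  rewrite -size_filter -(size_map (+%R^~ e) (lattice_box E N)) -size_cat.
  apply: uniq_leq_size.
    rewrite cat_uniq filter_uniq ?undup_uniq//=.
    rewrite map_inj_uniq ?undup_uniq ?andbT; last exact: addIr.
    apply/hasPn => _ /mapP[x xB ->]; rewrite mem_filter addrK.
    by rewrite (lattice_box_sub xB).
  move=> x; rewrite mem_cat mem_filter => /orP[/andP[]//|/mapP[y yB ->]].
  exact: lattice_box_add.
have : (count (fun d => d - e \notin Phi) Phi)%:R + (size (lattice_box E N))%:R
    <= (size Phi)%:R :> R by rewrite -natrD ler_nat.
have : (size (lattice_box E N))%:R <= (size Phi)%:R :> R.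
  rewrite ler_nat; apply: uniq_leq_size; [exact: undup_uniq|exact: lattice_box_sub].
rewrite -(ler_pM2l q0); lra.
Qed.

End folner.

Section finite_counts.
Context d (T : measurableType d) (R : realType) (P : probability T R).

Lemma integral_weighted_sum (K : choiceType) (r : seq K) (c : K -> R) (D : K -> set T) :
  (forall k, 0 <= c k) -> (forall k, measurable (D k)) ->
  (\int[P]_x (\sum_(k <- r) (c k * \1_(D k) x)%:E) =
    (\sum_(k <- r) c k * pr P (D k))%:E)%E.
Proof.
move=> c0 mD; rewrite ge0_integral_sum//.
- rewrite -sumEFin; apply: eq_bigr => k _.
  under eq_integral do rewrite EFinM.
  rewrite ge0_integralZl//.
  + by rewrite integral_indic// setIT EFinM; congr (_ * _)%E; exact: prE.
  + by apply/measurable_EFinP; exact: measurable_indic.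
  + by rewrite lee_fin.
- move=> k; apply/measurable_EFinP; apply: measurable_funM => //.
- by move=> k x _; rewrite lee_fin mulr_ge0.
Qed.

(** Integration of a pointwise inequality between simple functions; it turns counts of the sets
    through a point into bounds on sums of probabilities. *)
Lemma le_weighted_sum (K K' : choiceType) (r : seq K) (r' : seq K')
    (c : K -> R) (c' : K' -> R) (D : K -> set T) (D' : K' -> set T) :
  (forall k, 0 <= c k) -> (forall k, measurable (D k)) ->
  (forall k, 0 <= c' k) -> (forall k, measurable (D' k)) ->
  (forall x, \sum_(k <- r) c k * \1_(D k) x <= \sum_(k <- r') c' k * \1_(D' k) x) ->
  \sum_(k <- r) c k * pr P (D k) <= \sum_(k <- r') c' k * pr P (D' k).
Proof.
move=> c0 mD c'0 mD' le; rewrite -lee_fin -!integral_weighted_sum//.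
apply: ge0_le_integral => //.
- by move=> x _; apply: sume_ge0 => k _; rewrite lee_fin mulr_ge0.
- apply: emeasurable_sum => k; apply/measurable_EFinP.
  exact: measurable_funM.
- apply: emeasurable_sum => k; apply/measurable_EFinP.
  exact: measurable_funM.
- by move=> x _; rewrite !sumEFin lee_fin.
Qed.

Lemma sum_indic_count (K : choiceType) (r : seq K) (D : K -> set T) x :
  \sum_(k <- r) 1 * \1_(D k) x = (count (fun k => `[< D k x >]) r)%:R :> R.
Proof.
elim: r => [|k r IH]; first by rewrite big_nil.
by rewrite big_cons IH /= natrD mul1r.
Qed.

Lemma sum_pr_le (K : choiceType) (r : seq K) (D : K -> set T) (G : set T) (a b : R) :
  0 <= a -> 0 <= b -> (forall k, measurable (D k)) -> measurable G ->
  (forall x, G x -> (count (fun k => `[< D k x >]) r)%:R <= a) ->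
  (forall x, (count (fun k => `[< D k x >]) r)%:R <= b) ->
  \sum_(k <- r) pr P (D k) <= a + b * pr P (~` G).
Proof.
move=> a0 b0 mD mG Ga Gb.
(* The two indices encode the simple function with value [a] on [G] and [a + b] off [G]. *)
have := @le_weighted_sum _ bool r [:: true; false] (fun=> 1)
  (fun t => if t then a else b) D (fun t => if t then setT else ~` G).
rewrite !big_cons big_nil prT addr0 mulr1.
under eq_bigr do rewrite mul1r.
apply => //.
- by case.
- by case=> //; exact: measurableC.
- move=> x; rewrite sum_indic_count !big_cons big_nil addr0 indicT mulr1.
  case: (pselect (G x)) => Gx; first by rewrite (le_trans (Ga _ Gx))// lerDl mulr_ge0.
  rewrite (le_trans (Gb x))// indicE mem_set//= mulr1.
  by rewrite lerDr.
Qed.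

Lemma sum_pr_ge (K : choiceType) (r : seq K) (D : K -> set T) (G : set T) (a : R) :
  0 <= a -> (forall k, measurable (D k)) -> measurable G ->
  (forall x, G x -> a <= (count (fun k => `[< D k x >]) r)%:R) ->
  a * pr P G <= \sum_(k <- r) pr P (D k).
Proof.
move=> a0 mD mG Ga.
have := @le_weighted_sum unit _ [:: tt] r (fun=> a) (fun=> 1) (fun=> G) D.
rewrite !big_cons big_nil addr0; under eq_bigr do rewrite mul1r.
apply => // x; rewrite sum_indic_count !big_cons big_nil addr0 indicE.
case: (pselect (G x)) => Gx; first by rewrite mem_set// mulr1 Ga.
by rewrite memNset// mulr0.
Qed.

Lemma pr_has_le (K : choiceType) (r : seq K) (D : K -> set T) (b : R) :
  0 <= b -> (forall k, measurable (D k)) -> (forall k, k \in r -> pr P (D k) <= b) ->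
  measurable (\bigcup_(k in [set` r]) D k) /\
  pr P (\bigcup_(k in [set` r]) D k) <= (size r)%:R * b.
Proof.
move=> b0 mD; elim: r => [|k r IH] Db.
  rewrite (_ : [set` [::]] = set0) ?bigcup_set0 ?pr0 ?mul0r//.
  by apply/seteqP; split.
have {}IH := IH (fun k' kr => Db k' (@mem_behead _ (k :: r) k' kr)).
rewrite (_ : [set` k :: r] = k |` [set` r]); last first.
  by apply/seteqP; split => x /=; rewrite inE => /predU1P.
rewrite bigcup_setU1; split; first by apply: measurableU => //; case: IH.
apply: le_trans (le_prU _ _ _) _ => //; first by case: IH.
by rewrite /= -natr1 mulrDl mul1r addrC lerD ?IH.2// Db// mem_head.
Qed.

End finite_counts.

Section small_cells.
Context d (T : measurableType d) (R : realType) (P : probability T R).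

Lemma pr_bigcap_gt0 (V : nat -> set T) (c : R) : (forall n, measurable (V n)) ->
  (forall n, V n.+1 `<=` V n) -> 0 < c -> (forall n, c <= pr P (V n)) ->
  0 < pr P (\bigcap_n V n).
Proof.
move=> mV Vdec c0 cV.
have mF n : measurable (~` V n) by exact: measurableC.
have mU : measurable (\bigcup_n ~` V n) by exact: bigcupT_measurable.
have mI : measurable (\bigcap_n V n) by exact: bigcapT_measurable.
have Vle m n : (m <= n)%N -> V n `<=` V m.
  elim: n => [|n IH]; first by rewrite leqn0 => /eqP ->.
  by rewrite leq_eqVlt ltnS => /predU1P[->//|/IH mn]; exact: subset_trans (Vdec n) mn.
have [N HN] := pr_bigcup_approx P mF c0.
have mB : measurable (\bigcup_n ~` V n `\` \bigcup_(n < N) ~` V n).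
  by apply: measurableD => //; exact: bigcup_measurable.
rewrite -(ltrD2r c) add0r; apply: le_lt_trans (cV N) _.
apply: le_lt_trans (_ : _ <= pr P (\bigcap_n V n) + pr P _) _; last first.
  by rewrite ltrD2l; exact: HN.
apply: le_trans (le_prU _ _ _) => //.
apply: le_pr => //; first exact: measurableU.
move=> x VNx; case: (pselect ((\bigcap_n V n) x)); first by left.
move=> nV; right; split.
  by apply: contrapT => nF; apply: nV => n _; apply: contrapT => nVn; apply: nF; exists n.
by move=> [n /= nN]; apply; exact: Vle (ltnW nN) _ VNx.
Qed.

Definition dyadic (n : nat) (y : R) : int := Num.floor (y * 2 ^+ n).

Lemma dyadicE n y k : (dyadic n y = k) <-> k%:~R <= y * 2 ^+ n < (k + 1)%:~R.
Proof. by rewrite -floor_eq; split => /eqP. Qed.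

Lemma dyadicS n y y' : dyadic n.+1 y = dyadic n.+1 y' -> dyadic n y = dyadic n y'.
Proof.
set k := dyadic n.+1 y => ky'; apply/esym/dyadicE.
have /dyadicE /andP[] := erefl (dyadic n y); set m := dyadic n y => m1 m2.
have two (z : R) : z * 2 ^+ n.+1 = 2 * (z * 2 ^+ n) by rewrite exprS; ring.
have k1 : (2 * m <= k)%R.
  by rewrite /k /dyadic floor_ge_int two intrM ler_pM2l.
have k2 : (k < 2 * (m + 1))%R.
  by rewrite /k /dyadic floor_lt_int two intrM ltr_pM2l.
move: k1 k2; rewrite ky' /dyadic floor_ge_int floor_lt_int two !intrM.
by rewrite ler_pM2l// ltr_pM2l// => -> ->.
Qed.

Lemma dyadic_le m n y y' : (m <= n)%N -> dyadic n y = dyadic n y' ->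
  dyadic m y = dyadic m y'.
Proof.
elim: n => [|n IH]; first by rewrite leqn0 => /eqP ->.
by rewrite leq_eqVlt ltnS => /predU1P[->//|/IH mn] /dyadicS.
Qed.

Lemma pow2_archi (e : R) : 0 < e -> exists N, forall n, (N <= n)%N -> 1 <= e * 2 ^+ n.
Proof.
move=> e0; exists (Num.bound e^-1) => n Nn.
have e10 : 0 <= e^-1 by rewrite invr_ge0 ltW.
rewrite mulrC -ler_pdivrMr// div1r; apply: le_trans (ltW (archi_boundP e10)) _.
rewrite -natrX ler_nat; apply: leq_trans Nn _; exact: ltnW (ltn_expl _ _).
Qed.

Lemma lt_floor_diff (a b c : R) : a <= b -> c < a + 1 -> c - b < 1.
Proof. by lra. Qed.

Lemma dyadic_inj y y' : (forall n, dyadic n y = dyadic n y') -> y = y'.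
Proof.
wlog yy' : y y' / y < y'.
  move=> H yy; have [lt|lt|//] := ltgtP y y'; first exact: H.
  by apply/esym/H => // n.
move=> H; have e0 : 0 < y' - y by rewrite subr_gt0.
have [N /(_ N (leqnn _))] := pow2_archi e0.
have /dyadicE/andP[h1 _] := erefl (dyadic N y).
have /dyadicE/andP[_] := erefl (dyadic N y'); rewrite -H intrD mulr1z => h2.
by rewrite mulrBl leNgt (lt_floor_diff h1 h2).
Qed.

Lemma dyadic_separated n y y' : 1 <= `|y - y'| * 2 ^+ n -> dyadic n y != dyadic n y'.
Proof.
move=> h; apply/eqP => yy; move: h; apply/negP; rewrite -ltNge.
have /dyadicE/andP[h1] := erefl (dyadic n y).
have /dyadicE/andP[h2] := erefl (dyadic n y').
rewrite -yy intrD mulr1z in h1 h2 * => h3 h4.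
rewrite -[X in _ * X]gtr0_norm ?exprn_gt0// -normrM mulrBl ltr_norml.
by rewrite ltrNl opprB (lt_floor_diff h1 h3) (lt_floor_diff h2 h4).
Qed.

Variables (H : T -> R) (mH : measurable_fun setT H).

Lemma measurable_dyadic n e k : measurable [set x | dyadic n (H x + e) = k].
Proof.
rewrite (_ : [set x | _] = H @^-1`
    [set` `[k%:~R / 2 ^+ n - e, (k + 1)%:~R / 2 ^+ n - e[]).
  by rewrite -[X in measurable X]setTI; apply: mH => //; exact: measurable_itv.
apply/seteqP; split => x /=; rewrite dyadicE in_itv/= lerBlDr ltrBrDr.
  by rewrite ler_pdivrMr ?exprn_gt0// ltr_pdivlMr ?exprn_gt0.
by rewrite ler_pdivrMr ?exprn_gt0// ltr_pdivlMr ?exprn_gt0.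
Qed.

Definition hcell n k := [set x | dyadic n (H x) = k].

Lemma measurable_hcell n k : measurable (hcell n k).
Proof. by have := measurable_dyadic n 0 k; under eq_set do rewrite addr0. Qed.

(** Otherwise the unions [V n] of the cells of mass above [c] decrease and keep mass at least [c],
    so some [x] lies in all of them. The cells around [x] shrink to the level set of [H x], which
    would then be an atom. *)
Lemma small_cells (c : R) : (forall r, pr P [set x | H x = r] = 0) -> 0 < c ->
  exists N, forall n k, (N <= n)%N -> pr P (hcell n k) <= c.
Proof.
move=> noatom c0; apply: contrapT => nosmall.
have bad N : exists k, c < pr P (hcell N k).
  apply: contrapT => nobad; apply: nosmall; exists N => n k Nn.
  have [[x xk]|nox] := pselect (exists x, hcell n k x); last first.
    rewrite (_ : hcell n k = set0) ?pr0 ?ltW//.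
    by apply/seteqP; split => // x xk; apply: nox; exists x.
  apply: (@le_trans _ _ (pr P (hcell N (dyadic N (H x))))).
    apply: le_pr; try exact: measurable_hcell.
    by move=> y yk; apply: dyadic_le Nn _; rewrite yk xk.
  by rewrite leNgt; apply/negP => h; apply: nobad; exists (dyadic N (H x)).
pose V n := \bigcup_k (if c < pr P (hcell n k) then hcell n k else set0).
have VE n x : V n x <-> c < pr P (hcell n (dyadic n (H x))).
  split; first by move=> [k _]; case: ifPn => // ck xk; rewrite (xk : _ = k).
  by move=> ck; exists (dyadic n (H x)) => //; rewrite ck.
have mV n : measurable (V n).
  apply: countable_bigcupT_measurable => // k.
  by case: ifP => // _; exact: measurable_hcell.
have Vdec n : V n.+1 `<=` V n.
  move=> x /VE cx; apply/VE; apply: lt_le_trans cx _.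
  apply: le_pr; try exact: measurable_hcell.
  by move=> y yk; apply: dyadicS.
have cV n : c <= pr P (V n).
  have [k ck] := bad n; apply: le_trans (ltW ck) _.
  apply: le_pr => //; first exact: measurable_hcell.
  by move=> y yk; exists k => //; rewrite ck.
have := pr_bigcap_gt0 mV Vdec c0 cV.
have [[x xV] _|noV] := pselect (exists x, (\bigcap_n V n) x); last first.
  rewrite (_ : \bigcap_n V n = set0) ?pr0 ?ltxx//.
  by apply/seteqP; split => // x xV; apply: noV; exists x.
have := @pr_bigcap_gt0 (fun n => hcell n (dyadic n (H x))) c
  (fun n => measurable_hcell n _) _ c0 _.
have -> : \bigcap_n hcell n (dyadic n (H x)) = [set y | H y = H x].
  apply/seteqP; split => y /=; last by move=> yx n _; rewrite /hcell/= yx.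
  by move=> yx; apply: dyadic_inj => n; exact: yx n I.
rewrite noatom ltxx => F; suff: false by []; apply: F => n.
  by move=> y /dyadicS.
by apply/ltW/VE; exact: xV.
Qed.

End small_cells.

Section atom.
Context d (T : measurableType d) (R : realType) (P : probability T R).
Variables (H : T -> R) (mH : measurable_fun setT H).

(** Countably many values carry all the mass, hence finitely many of them carry all but less than
    [q]. *)
Lemma finitely_many_increments (phi : T -> T) (C : set R) (q : R) :
  measurable_fun setT phi -> countable C ->
  {ae P, forall x, C (H (phi x) - H x)} -> 0 < q ->
  exists E : seq R, let G := [set x | H (phi x) - H x \in E] in
    measurable G /\ pr P (~` G) < q.
Proof.
move=> mphi cC [N [mN N0 NC]] q0.
have mD : measurable_fun setT (fun x => H (phi x) - H x).
  by apply: measurable_funB => //; exact: measurableT_comp.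
have mlev c : measurable [set x | H (phi x) - H x = c].
  rewrite (_ : [set x | _] = (fun x => H (phi x) - H x) @^-1` [set c])//.
  by rewrite -[X in measurable X]setTI; exact: mD.
have [c Cc] := countable_range 0 cC.
have [n Hn] := pr_bigcup_approx P (fun k => mlev (c k)) q0.
exists [seq c k | k <- iota 0 n] => G.
have GE : G = \bigcup_(k < n) [set x | H (phi x) - H x = c k].
  apply/seteqP; split => x.
    by move=> /mapP[k]; rewrite mem_iota /= => kn xk; exists k.
  by move=> [k /= kn xk]; apply/mapP; exists k; rewrite ?mem_iota.
have mG : measurable G by rewrite GE; apply: bigcup_measurable => k _; exact: mlev.
split => //.
have mU : measurable (\bigcup_k [set x | H (phi x) - H x = c k]).
  by apply: bigcupT_measurable => k; exact: mlev.
apply: le_lt_trans Hn; rewrite -GE -[leRHS]add0r.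
have <- : pr P N = 0 by rewrite /pr N0.
apply: le_trans (le_prU _ mN _); last exact: measurableD.
apply: le_pr; [exact: measurableC|by apply: measurableU => //; exact: measurableD|].
move=> x nG; have [Nx|nN] := pselect (N x); [by left|right; split => //].
have Cx : C (H (phi x) - H x) by apply: contrapT => nC; apply: nN; exact: NC.
by have [k _ ck] := Cc _ Cx; exists k.
Qed.

Lemma separation_bound (s : seq R) :
  exists2 e : R, 0 < e & {in s, forall t, 0 < t -> e <= t}.
Proof.
elim: s => [|t s [e e0 IH]]; first by exists 1.
have [t0|t0] := ltP 0 t.
  exists (Num.min e t); first by rewrite lt_min e0.
  move=> u; rewrite inE ge_min => /predU1P[->|us u0]; first by rewrite lexx orbT.
  by rewrite IH.
exists e => // u; rewrite inE => /predU1P[-> /lt_le_trans/(_ t0)|us]; last exact: IH.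
by rewrite ltxx.
Qed.

Definition int_range (M : nat) : seq int := [seq (i : nat)%:Z - M%:Z | i <- iota 0 (2 * M).+1].

Lemma int_range_uniq M : uniq (int_range M).
Proof.
rewrite map_inj_uniq ?iota_uniq// => i j; lia.
Qed.

Lemma mem_int_range M (k : int) : - M%:Z <= k <= M%:Z -> k \in int_range M.
Proof.
move=> kM; apply/mapP; exists `|(k + M%:Z)%R|%N; first by rewrite mem_iota; lia.
by lia.
Qed.

(* If [H] had no atom, then for a Folner set [Phi] of its increments and a
   fine dyadic scale, the sets [A k = {x | k \in dyadic (H x + Phi)}] would
   have small measure but be almost invariant for most [k], since a point [x]
   lies in exactly [size Phi] of them. *)
Lemma gap_atom (L : eqType) (S : seq L) (phi : L -> T -> T) (kappa : R) :
  (forall g, g \in S -> measurable_fun setT (phi g)) -> 0 < kappa ->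
  (forall A, measurable A -> kappa * (pr P A * (1 - pr P A)) <=
     \sum_(g <- S) pr P (A `\` phi g @^-1` A)) ->
  (forall g, g \in S -> exists2 C : set R, countable C &
     {ae P, forall x, C (H (phi g x) - H x)}) ->
  exists r, 0 < pr P [set x | H x = r].
Proof.
move=> mphi kappa0 gap incr; apply: contrapT => noatom.
have {}noatom r : pr P [set x | H x = r] = 0.
  apply/eqP; rewrite eq_le pr_ge0 andbT leNgt; apply/negP => h.
  by apply: noatom; exists r.
pose s := (size S)%:R : R.
have s0 : 0 <= s by rewrite /s.
(* Chosen for the final comparison: [s * (2 * q * n) <= kappa * n / 8], below the lower bound
   [kappa * n / 4]. Adding [1] to [s] covers an empty [S]. *)
pose q := kappa / (16 * (s + 1)).
have q0 : 0 < q by rewrite divr_gt0// mulr_gt0// ltr_wpDl.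
have /choice[E EP] : forall g, exists E : seq R, g \in S ->
    let G := [set x | H (phi g x) - H x \in E] in
    measurable G /\ pr P (~` G) < q.
  move=> g; have [gS|gS] := boolP (g \in S); last by exists [::].
  have [C cC aeC] := incr g gS.
  have [E HE] := finitely_many_increments (mphi g gS) cC aeC q0.
  by exists E.
have [Phi [uPhi Phi0 PhiE]] := folner (flatten [seq E g | g <- S]) q0.
pose n := (size Phi)%:R : R.
have n0 : 0 < n by rewrite ltr0n.
(* A translate of a dyadic cell meets at most two cells, so it has mass at most [(2 * n)^-1], and
   [A k], a union of [n] such sets, has mass at most [1 / 2]. *)
have c0 : 0 < (4 * n)^-1 by rewrite invr_gt0 mulr_gt0.
have [N1 cells] := small_cells mH noatom c0.
have [e e0 sep] := separation_bound [seq `|a - b| | a <- Phi, b <- Phi].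
have [N2 HN2] := pow2_archi e0.
(* Fine enough for the cells to be small and for distinct points of [Phi] to give distinct cells, so
   that [Q x] lists exactly [n] indices. *)
pose l := maxn N1 N2.
have {}cells k : pr P (hcell H l k) <= (4 * n)^-1.
  by apply: cells; exact: leq_maxl.
have {e e0 sep HN2}sep x a b : a \in Phi -> b \in Phi -> a != b ->
    dyadic l (H x + a) != dyadic l (H x + b).
  move=> aP bP ab; apply: dyadic_separated.
  rewrite opprD addrACA subrr add0r.
  apply: le_trans (HN2 l (leq_maxr _ _)) _; apply: ler_wpM2r; first by rewrite exprn_ge0.
  by apply: sep; [exact: allpairs_f|rewrite normr_gt0 subr_eq0].
pose Q x := [seq dyadic l (H x + a) | a <- Phi].
have uQ x : uniq (Q x).
  rewrite map_inj_in_uniq// => a b aP bP ab; apply/eqP.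
  by apply: contraT => /(sep x _ _ aP bP); rewrite ab eqxx.
pose A k := [set x | k \in Q x].
have AE k : A k = \bigcup_(a in [set` Phi]) [set x | dyadic l (H x + a) = k].
  apply/seteqP; split => x /=.
    by move=> /mapP[a aP ->]; exists a.
  by move=> [a aP <-]; exact: map_f.
have Asmall k : measurable (A k) /\ pr P (A k) <= 1 / 2.
  have cell2 a : pr P [set x | dyadic l (H x + a) = k] <= (2 * n)^-1.
    pose j := Num.floor (k%:~R - a * 2 ^+ l).
    apply: (@le_trans _ _ (pr P (hcell H l j `|` hcell H l (j + 1)))).
      apply: le_pr; first exact: measurable_dyadic.
        by apply: measurableU; exact: measurable_hcell.
      move=> x /dyadicE /andP[]; rewrite mulrDl intrD mulr1z => h1 h2.
      have := floor_le (k%:~R - a * 2 ^+ l : R); rewrite -/j => j1.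
      have := floorD1_gt (k%:~R - a * 2 ^+ l : R); rewrite -/j intrD mulr1z => j2.
      have [xj|xj] := ltP (H x * 2 ^+ l) (j%:~R + 1); [left|right]; apply/dyadicE.
        rewrite intrD mulr1z xj andbT; apply: le_trans j1 _.
        by rewrite lerBlDr.
      rewrite !intrD mulr1z xj /=; apply: (@lt_le_trans _ _ (k%:~R + 1 - a * 2 ^+ l)).
        by rewrite ltrBrDr.
      by rewrite addrAC lerD2r ltW.
    apply: le_trans (le_prU _ (measurable_hcell mH _ _) (measurable_hcell mH _ _)) _.
    apply: le_trans (lerD (cells _) (cells _)) _.
    by rewrite le_eqVlt; apply/orP; left; apply/eqP; field; rewrite gt_eqF.
  have b0 : 0 <= (2 * n)^-1 by rewrite invr_ge0 mulr_ge0// ltW.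
  have [m1 m2] := pr_has_le (r := Phi) b0 (fun a => measurable_dyadic mH l a k)
    (fun a _ => cell2 a).
  rewrite AE; split => //; apply: le_trans m2 _.
  by rewrite le_eqVlt; apply/orP; left; apply/eqP; rewrite -/n; field; rewrite gt_eqF.
have mA k : measurable (A k) by have [] := Asmall k.
have mD g k : g \in S -> measurable (A k `\` phi g @^-1` A k).
  move=> gS; apply: measurableD => //.
  by rewrite -[X in measurable X]setTI; exact: mphi.
(* On [G] the increment [e] of [H] is in the finite list: if the index of [H x + a] escapes, then
   [a - e] is not in [Phi], and there are at most [q * n] such [a]. Off [G], which leaves a mass
   below [q], at most [n] indices escape. *)
have upper g r : g \in S -> uniq r ->
    \sum_(k <- r) pr P (A k `\` phi g @^-1` A k) <= 2 * q * n.
  move=> gS ur; have [mG Gq] := EP g gS.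
  have count_bound := @sum_pr_le _ _ _ P _ r (fun k => A k `\` phi g @^-1` A k) _
    (q * n) n _ _ (fun k => mD g k gS) mG.
  apply: le_trans (count_bound _ _ _ _) _.
  - by rewrite mulr_ge0 ?ltW.
  - exact: ltW.
  - move=> x Gx.
    have eE : H (phi g x) - H x \in flatten [seq E g | g <- S].
      by apply/flattenP; exists (E g) => //; exact: map_f.
    apply: le_trans (PhiE _ eE); rewrite ler_nat -!size_filter.
    rewrite -(size_map (fun a => dyadic l (H x + a))).
    apply: uniq_leq_size; first exact: filter_uniq.
    move=> k; rewrite mem_filter => /andP[/asboolP[/mapP[a aP ->] nk] _].
    apply/mapP; exists a => //; rewrite mem_filter aP andbT.
    apply/negP => aP'; apply: nk; apply/mapP; exists (a - (H (phi g x) - H x)) => //.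
    by congr dyadic; ring.
  - move=> x; rewrite ler_nat -size_filter -(size_map (fun a => dyadic l (H x + a)) Phi).
    apply: uniq_leq_size; first exact: filter_uniq.
    by move=> k; rewrite mem_filter => /andP[/asboolP[]].
  have : n * pr P (~` [set x | H (phi g x) - H x \in E g]) <= n * q.
    by rewrite ler_wpM2l// ltW.
  by rewrite mulrC; lra.
(* Where [H] is bounded by [K], an event of mass at least [1 / 2], all the [n] indices in [Q x] lie
   in one finite range. *)
have lower : exists2 r, uniq r & n / 2 <= \sum_(k <- r) pr P (A k).
  pose V (K : nat) := [set x | `|H x| <= K%:R].
  have mV K : measurable (V K).
    rewrite (_ : V K = H @^-1` [set` `[- K%:R, K%:R]]).
      by rewrite -[X in measurable X]setTI; apply: mH => //; exact: measurable_itv.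
    by apply/seteqP; split => x; rewrite /V/= in_itv/= ler_norml.
  have half0 : (0 : R) < 1 / 2 by rewrite divr_gt0.
  have [K HK] := pr_bigcup_approx P mV half0.
  have VT : \bigcup_K V K = setT.
    apply/seteqP; split => // x _; exists (Num.bound `|H x|) => //=.
    by rewrite /V/= ltW// archi_boundP.
  have VK : \bigcup_(k < K) V k `<=` V K.
    move=> x [k /= kK]; rewrite /V/= => /le_trans; apply.
    by rewrite ler_nat ltnW.
  have VK2 : 1 / 2 <= pr P (V K).
    have mW : measurable (\bigcup_(k < K) V k) by apply: bigcup_measurable.
    move: HK; rewrite VT setTD prC// => HK.
    have := le_pr P mW (mV K) VK; lra.
  pose D := \sum_(a <- Phi) `|a|.
  have aD a : a \in Phi -> `|a| <= D.
    by move=> aP; rewrite /D (big_rem a)//= lerDl sumr_ge0.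
  pose M := Num.bound ((K%:R + D) * 2 ^+ l + 1 : R).
  have M1 : (K%:R + D) * 2 ^+ l + 1 < M%:R.
    have D0 : 0 <= D by exact: sumr_ge0.
    have l0 : 0 <= (2 : R) ^+ l by exact: exprn_ge0.
    apply: archi_boundP; apply: addr_ge0 => //.
    by apply: mulr_ge0 => //; exact: addr_ge0.
  exists (int_range M); first exact: int_range_uniq.
  apply: (@le_trans _ _ (n * pr P (V K))).
    by rewrite ler_wpM2l ?(ltW n0)//; move: VK2; rewrite div1r.
  apply: sum_pr_ge => //.
  move=> x xV; rewrite /n ler_nat -(size_map (fun a => dyadic l (H x + a)) Phi).
  rewrite -size_filter; apply: uniq_leq_size; first exact: uQ.
  move=> k kQ; rewrite mem_filter; apply/andP; split; first exact/asboolP.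
  move/mapP : kQ => [a aP ->].
  have yM : `|(H x + a) * 2 ^+ l| <= (K%:R + D) * 2 ^+ l.
    rewrite normrM (@gtr0_norm _ (2 ^+ l)) ?exprn_gt0// ler_wpM2r ?exprn_ge0//.
    by apply: le_trans (ler_normD _ _) _; apply: lerD => //; exact: aD.
  have {}yM : `|(H x + a) * 2 ^+ l| + 1 < M%:R.
    by apply: le_lt_trans M1; rewrite lerD2r.
  set y := (H x + a) * 2 ^+ l in yM.
  apply: mem_int_range; apply/andP; split.
    rewrite /dyadic floor_ge_int intrN -pmulrn.
    by rewrite lerNl; apply: le_trans (ltW yM); rewrite -normrN -/y; have := ler_norm (- y); lra.
  rewrite -ltzD1 /dyadic floor_lt_int intrD -pmulrn mulr1z -/y.
  by have := ler_norm y; lra.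
have [r ur lr] := lower.
(* The factor [1 - pr P (A k)] of the gap is at least [1 / 2], which leaves half of [kappa]. *)
have : kappa / 2 * \sum_(k <- r) pr P (A k) <= s * (2 * q * n).
  rewrite mulr_sumr.
  apply: (@le_trans _ _ (\sum_(k <- r) \sum_(g <- S) pr P (A k `\` phi g @^-1` A k))).
    apply: ler_sum => k _; apply: le_trans (gap _ (mA k)).
    rewrite -mulrA ler_pM2l// mulrC ler_wpM2l ?pr_ge0//.
    by have [_] := Asmall k; lra.
  rewrite exchange_big/= big_seq.
  apply: le_trans (_ : _ <= \sum_(g <- S | g \in S) (2 * q * n)) _.
    by apply: ler_sum => g gS; exact: upper.
  by rewrite -big_seq big_const_seq count_predT iter_addr_0 [leRHS]mulr_natl lexx.
set sum := \sum_(k <- r) _ in lr *; move=> /le_lt_trans absurd.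
suff /absurd : s * (2 * q * n) < kappa / 2 * sum by rewrite ltxx.
apply: (@lt_le_trans _ _ (kappa / 2 * (n / 2))); last first.
  by rewrite ler_wpM2l// divr_ge0// ltW.
rewrite /q.
have -> : s * (2 * (kappa / (16 * (s + 1))) * n) = (s / (s + 1)) * (kappa * n / 8).
  by field; rewrite gt_eqF// ltr_wpDl.
have -> : kappa / 2 * (n / 2) = kappa * n / 4 by field.
have kn : 0 < kappa * n by rewrite mulr_gt0.
apply: (@le_lt_trans _ _ (1 * (kappa * n / 8))); last by lra.
rewrite ler_wpM2r ?divr_ge0 ?(ltW kn)// ler_pdivrMr ?ltr_wpDl// mul1r.
by rewrite lerDl.
Qed.

End atom.

(** * Countable relations and the cocycle of a measure *)

Section measure_cover.
Context d (T : measurableType d) (R : realType).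

Lemma measure_eq_cover (m1 m2 : {measure set T -> \bar R}) (B : nat -> set T) (A : set T) :
  (forall k, measurable (B k)) -> measurable A -> A `<=` \bigcup_k B k ->
  (forall k C, measurable C -> C `<=` A -> C `<=` B k -> m1 C = m2 C) -> m1 A = m2 A.
Proof.
move=> mB mA AB H.
pose F k := A `&` seqDU B k.
have mS k : measurable (seqDU B k).
  by apply: measurableD => //; exact: bigsetU_measurable.
have mF k : measurable (F k) by exact: measurableI.
have tF : trivIset setT F by apply: trivIset_setIl; exact: trivIset_seqDU.
have AF : A = \bigcup_k F k.
  by rewrite -setI_bigcupr -seqDU_bigcup_eq setIidl.
rewrite AF !measure_semi_bigcup//; try exact: bigcupT_measurable.
apply: eq_eseriesr => k _; apply: (H k) => //; first by move=> x [].
by move=> x [_ xB]; exact: subset_seqDU xB.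
Qed.

Import HBNNSimple.

(** The integral over [D] is defined through simple functions below a function that vanishes off
    [D], so only the values on measurable subsets of [D] enter. This allows [nu_r nu], a mere set
    function, to be replaced by a measure that agrees with it inside [Rel]. *)
Lemma eq_integral_on (m1 m2 : set T -> \bar R) (D : set T) (f : T -> \bar R) :
  (forall A, measurable A -> A `<=` D -> m1 A = m2 A) ->
  (\int[m1]_(x in D) f x = \int[m2]_(x in D) f x)%E.
Proof.
move=> m12.
suff H (g : T -> \bar R) : (forall x, ~ D x -> g x = 0%E) ->
    [set sintegral m1 h | h in [set h : {nnsfun T >-> R} | forall x, ((h x)%:E <= g x)%E]] =
    [set sintegral m2 h | h in [set h : {nnsfun T >-> R} | forall x, ((h x)%:E <= g x)%E]].
  rewrite /integral; congr (ereal_sup _ - ereal_sup _)%E; apply: H => x nD;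
    by rewrite ?funeposE ?funenegE patchE memNset// ?oppe0 maxxx.
move=> gD; apply: eq_imagel => h hg; rewrite /sintegral.
apply: eq_fsbigr => r _.
(* Only the level set for [0] can leave [D], and its term vanishes. *)
have [->|r0] := eqVneq r 0; first by rewrite !mul0e.
congr (_ * _)%E; apply: m12; first exact: measurable_sfunP.
move=> x hx; apply: contrapT => nD; move: (hg x); rewrite (gD _ nD) lee_fin.
rewrite (_ : h x = r) => [rle|//]; move: r0; rewrite eq_le rle /=.
have : 0 <= h x by []; by rewrite (_ : h x = r)// => ->.
Qed.

End measure_cover.

Section counting_lemmas.
Context d (X : measurableType d) (R : realType).

Lemma counting_subsingleton (A : set X) (x : X) : A `<=` [set x] ->
  counting A = (\1_A x)%:E :> \bar R.
Proof.
move=> Ax; rewrite /counting indicE; have [xA|xA] := boolP (x \in A).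
  have -> : A = [set x] by apply/seteqP; split => // y ->; exact: set_mem.
  by rewrite asboolT// fset_set1 cardfs1.
have -> : A = set0.
  apply/seteqP; split => // y Ay; have := Ax _ Ay => yx; rewrite yx in Ay.
  by move/negP : xA; apply; exact: mem_set.
by rewrite asboolT// fset_set0 cardfs0.
Qed.

End counting_lemmas.

Lemma pushforward_restr d d' (T : measurableType d) (T' : measurableType d')
    (R : realType) (nu : {measure set T -> \bar R}) (f : T -> T') (D : set T') :
  measurable_fun setT f -> measurable D ->
  exists m : {measure set T' -> \bar R}, forall A, m A = nu (f @^-1` (A `&` D)).
Proof. by move=> mf mD; unshelve eexists (mrestr (pushforward nu f) mD). Qed.

Section countable_relation.
Context (R : realType) d (X : measurableType d).
Hypothesis measurable_diag : measurable [set w : X * X | w.1 = w.2].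
Variables (Rel : set (X * X)) (psi psi' : nat -> X -> X).
Hypothesis mpsi : forall k, measurable_fun setT (psi k).
Hypothesis mpsi' : forall k, measurable_fun setT (psi' k).
Hypothesis psiK : forall k, cancel (psi k) (psi' k).
Hypothesis psi'K : forall k, cancel (psi' k) (psi k).
Hypothesis RelE : forall w, Rel w <-> exists k, w.2 = psi k w.1.
Implicit Types (nu : {measure set X -> \bar R}) (W : set (X * X)).

Definition graph k : set (X * X) := [set w | w.2 = psi k w.1].

Definition lsec k (x : X) : X * X := (x, psi k x).

Definition rsec k (y : X) : X * X := (psi' k y, y).

Lemma measurable_lsec k : measurable_fun setT (lsec k).
Proof. exact: measurable_fun_pair. Qed.

Lemma measurable_rsec k : measurable_fun setT (rsec k).
Proof. exact: measurable_fun_pair. Qed.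

Lemma measurable_preimage_psi k A : measurable A -> measurable (psi k @^-1` A).
Proof. by move=> mA; rewrite -[X in measurable X]setTI; exact: mpsi. Qed.

Lemma measurable_preimage_psi' k A : measurable A -> measurable (psi' k @^-1` A).
Proof. by move=> mA; rewrite -[X in measurable X]setTI; exact: mpsi'. Qed.

Lemma measurable_preimage_lsec k W : measurable W -> measurable (lsec k @^-1` W).
Proof. by move=> mW; rewrite -[X in measurable X]setTI; exact: measurable_lsec. Qed.

Lemma measurable_preimage_rsec k W : measurable W -> measurable (rsec k @^-1` W).
Proof. by move=> mW; rewrite -[X in measurable X]setTI; exact: measurable_rsec. Qed.

Lemma measurable_graph k : measurable (graph k).
Proof.
have mf : measurable_fun setT (fun w : X * X => (psi k w.1, w.2)).
  by apply: measurable_fun_pair => //; exact: measurableT_comp.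
have := mf measurableT _ measurable_diag; rewrite setTI.
rewrite (_ : _ @^-1` _ = graph k)//.
by apply/seteqP; split => w /=; rewrite /graph /= => ->.
Qed.

Lemma Rel_bigcup : Rel = \bigcup_k graph k.
Proof.
apply/seteqP; split => w; first by move=> /RelE[k wk]; exists k.
by move=> [k _ wk]; apply/RelE; exists k.
Qed.

Lemma measurable_Rel : measurable Rel.
Proof. by rewrite Rel_bigcup; apply: bigcupT_measurable; exact: measurable_graph. Qed.

Lemma graph_Rel k : graph k `<=` Rel.
Proof. by move=> w wk; apply/RelE; exists k. Qed.

(** Each section of a subset of a graph has at most one point, so the counting measure reduces to an
    indicator. *)
Lemma nu_l_graph nu k W : measurable W -> W `<=` graph k ->
  nu_l nu W = nu (lsec k @^-1` W).
Proof.
move=> mW Wk; rewrite /nu_l.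
rewrite (_ : (fun x => _) = fun x => (\1_(lsec k @^-1` W) x)%:E).
  by rewrite integral_indic ?setIT//; exact: measurable_preimage_lsec.
apply/funext => x; rewrite (@counting_subsingleton _ _ _ _ (psi k x)).
  by rewrite !indicE mem_xsection.
by move=> y /xsectionP /Wk.
Qed.

Lemma nu_r_graph nu k W : measurable W -> W `<=` graph k ->
  nu_r nu W = nu (rsec k @^-1` W).
Proof.
move=> mW Wk; rewrite /nu_r.
rewrite (_ : (fun x => _) = fun x => (\1_(rsec k @^-1` W) x)%:E).
  by rewrite integral_indic ?setIT//; exact: measurable_preimage_rsec.
apply/funext => x; rewrite (@counting_subsingleton _ _ _ _ (psi' k x)).
  by rewrite !indicE mem_ysection.
by move=> y /ysectionP /Wk; rewrite /graph /= => ->; rewrite psiK.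
Qed.

(** A pair may lie on several graphs; the disjoint pieces count it once. *)
Let piece k : set (X * X) := seqDU graph k.

Let measurable_piece k : measurable (piece k).
Proof.
apply: measurableD; first exact: measurable_graph.
by apply: bigsetU_measurable => j _; exact: measurable_graph.
Qed.

Let W_pieces W : W `<=` Rel -> W = \bigcup_k (W `&` piece k).
Proof.
by move=> WR; rewrite -setI_bigcupr -seqDU_bigcup_eq -Rel_bigcup setIidl.
Qed.

Let trivIset_W W : trivIset setT (fun k => W `&` piece k).
Proof. by apply: trivIset_setIl; exact: trivIset_seqDU. Qed.

Let Wpiece_graph W k : W `&` piece k `<=` graph k.
Proof. by move=> w [_ kw]; exact: subset_seqDU kw. Qed.

Lemma nu_l_series nu W : measurable W -> W `<=` Rel ->
  nu_l nu W = (\sum_(k <oo) nu (lsec k @^-1` (W `&` piece k)))%E.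
Proof.
move=> mW WR.
have mWk k : measurable (W `&` piece k) by exact: measurableI.
under eq_eseriesr do rewrite -nu_l_graph//.
rewrite /nu_l -integral_nneseries//.
- apply: eq_integral => x _; rewrite [in LHS](W_pieces WR) xsection_bigcup.
  rewrite measure_semi_bigcup//.
  + by move=> k; exact: measurable_xsection.
  + exact: trivIset_xsection.
  + by apply: bigcupT_measurable => k; exact: measurable_xsection.
- move=> k; rewrite (_ : (fun x => _) = fun x => (\1_(lsec k @^-1` (W `&` piece k)) x)%:E).
    by apply/measurable_EFinP; apply: measurable_indic; exact: measurable_preimage_lsec.
  apply/funext => x; rewrite (@counting_subsingleton _ _ _ _ (psi k x)).
    by rewrite !indicE mem_xsection.
  by move=> y /xsectionP /Wpiece_graph.
Qed.

Lemma nu_r_series nu W : measurable W -> W `<=` Rel ->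
  nu_r nu W = (\sum_(k <oo) nu (rsec k @^-1` (W `&` piece k)))%E.
Proof.
move=> mW WR.
have mWk k : measurable (W `&` piece k) by exact: measurableI.
under eq_eseriesr do rewrite -nu_r_graph//.
rewrite /nu_r -integral_nneseries//.
- apply: eq_integral => x _; rewrite [in LHS](W_pieces WR) ysection_bigcup.
  rewrite measure_semi_bigcup//.
  + by move=> k; exact: measurable_ysection.
  + exact: trivIset_ysection.
  + by apply: bigcupT_measurable => k; exact: measurable_ysection.
- move=> k; rewrite (_ : (fun x => _) = fun x => (\1_(rsec k @^-1` (W `&` piece k)) x)%:E).
    by apply/measurable_EFinP; apply: measurable_indic; exact: measurable_preimage_rsec.
  apply/funext => x; rewrite (@counting_subsingleton _ _ _ _ (psi' k x)).
    by rewrite !indicE mem_ysection.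
  by move=> y /ysectionP /Wpiece_graph; rewrite /graph /= => ->; rewrite psiK.
Qed.

Lemma nu_l_measure nu : exists m : {measure set (X * X) -> \bar R},
  forall W, measurable W -> W `<=` Rel -> nu_l nu W = m W.
Proof.
have /choice[m_ mE] := fun k =>
  pushforward_restr nu (measurable_lsec k) (measurable_piece k).
exists (mseries m_ 0) => W mW WR; rewrite nu_l_series//.
by apply: eq_eseriesr => k _; rewrite mE.
Qed.

Lemma nu_r_measure nu : exists m : {measure set (X * X) -> \bar R},
  forall W, measurable W -> W `<=` Rel -> nu_r nu W = m W.
Proof.
have /choice[m_ mE] := fun k =>
  pushforward_restr nu (measurable_rsec k) (measurable_piece k).
exists (mseries m_ 0) => W mW WR; rewrite nu_r_series//.
by apply: eq_eseriesr => k _; rewrite mE.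
Qed.

Lemma integral_nu_r_cst nu W (delta : X * X -> R) c : measurable W -> W `<=` Rel ->
  (forall w, W w -> delta w = c) ->
  (\int[nu_r nu]_(w in W) (delta w)%:E = c%:E * nu_r nu W)%E.
Proof.
move=> mW WR dc; have [m mE] := nu_r_measure nu.
rewrite (@eq_integral_on _ _ _ _ m) => [|A mA AW]; last first.
  by apply: mE => //; exact: subset_trans AW WR.
rewrite (eq_integral (fun=> c%:E)) => [|w /set_mem/dc ->//].
by rewrite integral_cst// mE.
Qed.

(** The pieces may overlap; once made disjoint, they split the integral into a series whose terms
    are constants times measures. *)
Lemma is_delta_of_pieces nu (delta : X * X -> R) (D : nat -> set (X * X)) (s : nat -> R) :
  (forall j, measurable (D j)) -> (forall j, D j `<=` Rel) -> Rel `<=` \bigcup_j D j ->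
  (forall j, 0 < s j) -> (forall j w, D j w -> delta w = s j) ->
  (forall j W, measurable W -> W `<=` D j -> nu_l nu W = ((s j)%:E * nu_r nu W)%E) ->
  is_delta Rel nu delta.
Proof.
move=> mD DR RD s0 deltaE H; split.
- move=> mR B mB.
  have -> : Rel `&` delta @^-1` B = \bigcup_j (if s j \in B then D j else set0).
    apply/seteqP; split => w.
      move=> [/RD[j _ Dw] Bw]; exists j => //.
      by rewrite mem_set// -(deltaE _ _ Dw).
    move=> [j _]; case: ifPn => // /set_mem Bs Dw; split; first exact: DR Dw.
    by rewrite /= (deltaE _ _ Dw).
  by apply: bigcupT_measurable => j; case: ifP.
- by move=> w /RD[j _ /deltaE ->].
move=> W mW WR.
have [l lE] := nu_l_measure nu; have [m mE] := nu_r_measure nu.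
rewrite (@eq_integral_on _ _ _ _ m) => [|A mA AW]; last first.
  by apply: mE => //; exact: subset_trans AW WR.
pose F k := W `&` seqDU D k.
have mS k : measurable (seqDU D k).
  by apply: measurableD => //; exact: bigsetU_measurable.
have mF k : measurable (F k) by exact: measurableI.
have tF : trivIset setT F by apply: trivIset_setIl; exact: trivIset_seqDU.
have WF : W = \bigcup_k F k.
  by rewrite -setI_bigcupr -seqDU_bigcup_eq setIidl//; exact: subset_trans WR RD.
have FW k : F k `<=` W by move=> w [].
have FD k : F k `<=` D k by move=> w [_ kw]; exact: subset_seqDU kw.
have FR k : F k `<=` Rel by exact: subset_trans (FW k) WR.
rewrite [RHS](_ : _ = \sum_(k <oo) \int[m]_(w in F k) (delta w)%:E)%E; last first.
  rewrite [in LHS]WF ge0_integral_bigcup//.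
  - rewrite -WF; apply/measurable_EFinP => _ B mB.
    rewrite (_ : W `&` delta @^-1` B = \bigcup_k (if s k \in B then F k else set0)).
      by apply: bigcupT_measurable => j; case: ifP.
    apply/seteqP; split => w.
      rewrite {1}WF => -[[k _ Fw] Bw]; exists k => //.
      by rewrite mem_set// -(deltaE _ _ (FD _ _ Fw)).
    move=> [k _]; case: ifPn => // /set_mem Bs Fw; split; first exact: FW Fw.
    by rewrite /= (deltaE _ _ (FD _ _ Fw)).
  - by move=> w [k _ Fw]; rewrite (deltaE _ _ (FD _ _ Fw)) lee_fin ltW.
rewrite lE// [in LHS]WF measure_semi_bigcup//; last by rewrite -WF.
apply: eq_eseriesr => k _; rewrite -(lE _ (mF k) (FR k)) (H k _ (mF k) (FD k)).
rewrite (eq_integral (fun=> (s k)%:E)) => [|w /set_mem /FD/deltaE ->//].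
by rewrite integral_cst//; congr (_ * _)%E; exact: mE.
Qed.

Section almost_periodic.
Variables (nu : {measure set X -> \bar R}) (delta : X * X -> R).
Hypothesis dE : is_delta Rel nu delta.

Lemma measurable_delta_preimage (B : set R) : measurable B ->
  measurable (Rel `&` delta @^-1` B).
Proof. by case: dE => md _ _ mB; apply: md => //; exact: measurable_Rel. Qed.

Lemma measurable_delta_slice k (B : set R) : measurable B ->
  measurable [set x | B (delta (lsec k x))].
Proof.
move=> mB; rewrite (_ : [set x | _] = lsec k @^-1` (Rel `&` delta @^-1` B)).
  by apply: measurable_preimage_lsec; exact: measurable_delta_preimage.
by apply/seteqP; split => x //=; [split => //; apply/RelE; exists k|case].
Qed.

(** The preimage under [psi' k] is the image under [psi k]. The defining identity of [delta],
    applied to the part of the graph above [A], has [nu A] on the left and [c] times the mass of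
    this image on the right. *)
Lemma delta_cst_scaling k c A : measurable A ->
  (forall x, A x -> delta (lsec k x) = c) ->
  nu A = (c%:E * nu (psi' k @^-1` A))%E.
Proof.
move=> mA Ac; pose W : set (X * X) := graph k `&` (fst @^-1` A).
have mW : measurable W.
  apply: measurableI; first exact: measurable_graph.
  by rewrite -[X in measurable X]setTI; exact: measurable_fst.
have Wg : W `<=` graph k by move=> w [].
have WR : W `<=` Rel := subset_trans Wg (graph_Rel (k := k)).
have := dE; case=> _ _ /(_ W mW WR).
rewrite (integral_nu_r_cst nu (c := c))//; last first.
  by move=> [x y] [xy Ax]; rewrite -(Ac x Ax) /lsec -[y]/((x, y).2) xy.
rewrite (nu_l_graph _ mW Wg) (nu_r_graph _ mW Wg).
rewrite (_ : lsec k @^-1` W = A); last first.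
  by apply/seteqP; split => x //= []//.
rewrite (_ : rsec k @^-1` W = psi' k @^-1` A)//.
by apply/seteqP; split => y //= => [[]//|Ay]; split => //; rewrite /graph/= psi'K.
Qed.

Lemma delta_countable_slice (C : set R) k : countable C ->
  nu_r nu (Rel `\` delta @^-1` C) = 0%E ->
  nu (psi' k @^-1` [set x | ~ C (delta (lsec k x))]) = 0%E.
Proof.
move=> cC C0.
have mC : measurable C by apply: countable_measurable.
have mRC : measurable (Rel `\` delta @^-1` C).
  rewrite (_ : _ `\` _ = Rel `&` delta @^-1` (~` C)); last by rewrite setDE.
  by apply: measurable_delta_preimage; exact: measurableC.
pose W := graph k `&` (Rel `\` delta @^-1` C).
have mW : measurable W by apply: measurableI => //; exact: measurable_graph.
have Wg : W `<=` graph k by move=> w [].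
have : nu_r nu W = 0%E.
  have [m mE] := nu_r_measure nu.
  rewrite mE//; last exact: subset_trans Wg (graph_Rel (k := k)).
  apply: (subset_measure0 (B := Rel `\` delta @^-1` C)) => //.
    by move=> w [].
  exact: etrans (esym (mE _ mRC (@subDsetl _ _ _))) C0.
rewrite (nu_r_graph _ mW Wg) => <-; congr (nu _).
apply/seteqP; split => y /=; rewrite /lsec psi'K.
  by move=> nC; split; [rewrite /graph/= psi'K|split => //; apply/RelE; exists k; rewrite /= psi'K].
by move=> [_ []].
Qed.

(* [delta] is determined on the graph of [psi k] over [D] by the scaling
   factor [t]: the level sets of [delta] for the other values in [C] are null. *)
Lemma delta_range_of_scaling (C : set R) k t (D : set X) : countable C ->
  nu_r nu (Rel `\` delta @^-1` C) = 0%E ->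
  measurable D -> nu D <> 0%E -> (nu (psi' k @^-1` D) < +oo)%E ->
  (forall A, measurable A -> A `<=` D -> nu A = (t%:E * nu (psi' k @^-1` A))%E) ->
  delta_range Rel nu t.
Proof.
move=> cC C0 mD D0 Dfin scal; exists delta => // range0; apply: D0.
rewrite scal//; suff -> : nu (psi' k @^-1` D) = 0%E by rewrite mule0.
have mD' := measurable_preimage_psi' k mD.
apply/(negligibleP nu mD').
have [c Cc] := countable_range 0 cC.
pose N n := psi' k @^-1` (D `&` [set x | delta (lsec k x) = c n /\ c n <> t]).
pose M := psi' k @^-1` [set x | ~ C (delta (lsec k x))].
pose M' := psi' k @^-1` (D `&` [set x | delta (lsec k x) = t]).
have mslice r : measurable [set x | delta (lsec k x) = r].
  by apply: (measurable_delta_slice k (B := [set r])).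
have NM : psi' k @^-1` D `<=` (\bigcup_n N n) `|` (M `|` M').
  move=> y Dy; have [Cy|nCy] := pselect (C (delta (lsec k (psi' k y)))); last first.
    by right; left.
  have [dt|dt] := eqVneq (delta (lsec k (psi' k y))) t; first by right; right; split.
  have [n _ cn] := Cc _ Cy; left; exists n => //; split => //=.
  by rewrite cn; split => //; exact/eqP.
apply: negligibleS NM _; apply: negligibleU; last apply: negligibleU.
- apply: negligible_bigcup => n; have [ct|ct] := pselect (c n = t).
    rewrite /N (_ : D `&` _ = set0) ?preimage_set0; first exact: negligible_set0.
    by apply/seteqP; split => // x [_ []].
  pose An := D `&` [set x | delta (lsec k x) = c n].
  have mAn : measurable An by exact: measurableI.
  have -> : N n = psi' k @^-1` An.
    by apply/seteqP; split => y [Dy] => [[dc _]|dc]; split.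
  apply/negligibleP; first exact: measurable_preimage_psi'.
  have h1 := delta_cst_scaling mAn (fun x (Ax : An x) => Ax.2).
  have h2 := scal _ mAn (fun x (Ax : An x) => Ax.1).
  (* Where [delta] is the constant [c n], the two scalings give [t * m = c n * m] for one mass [m];
     its finiteness allows the conclusion [m = 0]. *)
  have fin : nu (psi' k @^-1` An) \is a fin_num.
    rewrite ge0_fin_numE//; apply: le_lt_trans Dfin.
    by apply: le_measure; rewrite ?inE//; [exact: measurable_preimage_psi'|move=> y []].
  move: h1; rewrite h2 -(fineK fin) -!EFinM => -[] /eqP.
  rewrite -subr_eq0 -mulrBl mulf_eq0 subr_eq0 => /orP[/eqP tc|/eqP f0].
    by case: ct.
  exact: etrans (esym (fineK fin)) (congr1 EFin f0).
- apply/negligibleP; last exact: delta_countable_slice.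
  apply: measurable_preimage_psi'; apply: (measurable_delta_slice k (B := ~` C)).
  by apply: measurableC; exact: countable_measurable.
- pose W := graph k `&` (Rel `&` delta @^-1` [set t]).
  have mRt : measurable (Rel `&` delta @^-1` [set t]) by exact: measurable_delta_preimage.
  have mW : measurable W by apply: measurableI => //; exact: measurable_graph.
  have Wg : W `<=` graph k by move=> w [].
  have W0 : nu (rsec k @^-1` W) = 0%E.
    rewrite -(nu_r_graph _ mW Wg).
    have [m mE] := nu_r_measure nu.
    rewrite mE//; last exact: subset_trans Wg (graph_Rel (k := k)).
    apply: (subset_measure0 (B := Rel `&` delta @^-1` [set t])) => //.
      by move=> w [].
    exact: etrans (esym (mE _ mRt (@subIsetl _ _ _))) range0.
  exists (rsec k @^-1` W); split => //; first exact: measurable_preimage_rsec.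
  move=> y [_ /=]; rewrite /lsec psi'K => dt; split; first by rewrite /graph/= psi'K.
  by split => //; apply/RelE; exists k; rewrite /= psi'K.
Qed.

End almost_periodic.

(* [c k] is the Radon-Nikodym derivative of [mu \o psi k] with respect to [mu]. *)
Section scaling.
Variables (mu : probability X R) (Gamma : set R) (c : nat -> X -> R).
Hypothesis Gamma_countable : countable Gamma.
Hypothesis Gamma_gt0 : forall t, Gamma t -> 0 < t.
Hypothesis GammaV : forall t, Gamma t -> Gamma t^-1.
Hypothesis mc : forall k s, measurable [set x | c k x = s].
Hypothesis c_Gamma : forall k x, Gamma (c k x).
Hypothesis scaling : forall k s A, measurable A -> (forall x, A x -> c k x = s) ->
  mu (psi' k @^-1` A) = (s%:E * mu A)%E.

(** Unlike in [countable_range], all the values stay in [Gamma], so that they are positive; a value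
    of [c] serves as the default element. *)
Let values : exists g : nat -> R, (forall n, Gamma (g n)) /\ Gamma `<=` range g.
Proof.
move/countable_injP : Gamma_countable => [f finj].
have G0 := c_Gamma 0%N point.
exists (fun n => xget (c 0%N point) [set u | Gamma u /\ f u = n]); split.
  by move=> n; case: xgetP => [u _ []|].
move=> u Gu; exists (f u) => //.
case: xgetP => [v _ [Gv fv]|/(_ u) []//].
by apply: finj; rewrite ?inE.
Qed.

Let level k s := graph k `&` [set w | c k w.1 = s].

Let measurable_level k s : measurable (level k s).
Proof.
apply: measurableI; first exact: measurable_graph.
have := @measurable_fst _ _ X X measurableT _ (mc k s); rewrite setTI; exact.
Qed.

(** On [level k s] the map [psi k] multiplies [mu] by [s], so the cocycle of [mu] is [s^-1]
    there. *)
Lemma nu_lr_level k s W : 0 < s -> measurable W -> W `<=` level k s ->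
  nu_l mu W = (s^-1%:E * nu_r mu W)%E.
Proof.
move=> s0 mW Ws; have Wg : W `<=` graph k by move=> w /Ws[].
rewrite (nu_l_graph _ mW Wg) (nu_r_graph _ mW Wg).
have -> : rsec k @^-1` W = psi' k @^-1` (lsec k @^-1` W).
  by apply/seteqP; split => y /=; rewrite /lsec /rsec psi'K.
have mA := measurable_preimage_lsec k mW.
have cA x : (lsec k @^-1` W) x -> c k x = s by move=> /Ws[].
transitivity (s^-1%:E * (s%:E * mu (lsec k @^-1` W)))%E.
  by rewrite muleA -EFinM mulVf ?gt_eqF// mul1e.
by congr (_ * _)%E; exact/esym/scaling.
Qed.

Lemma scaling_almost_periodic : almost_periodic_measure Rel mu.
Proof.
have [g [gG Gg]] := values.
(* Different graphs through the same pair need not give the same value of [c], so [delta] reads it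
   off the first graph that contains the pair. *)
pose first (w : X * X) : nat := xget 0%N [set k | seqDU graph k w].
pose delta (w : X * X) : R := (c (first w) w.1)^-1.
exists delta; last first.
  exists Gamma => //.
  rewrite (_ : _ `\` _ = set0).
    by have [m mE] := nu_r_measure mu; rewrite mE.
  apply/seteqP; split => // w [_]; apply; apply: GammaV; exact: c_Gamma.
(* Indices code pairs [(k, n)]; numbers that code none get the empty piece and the positive factor
   [1]. *)
pose D (j : nat) : set (X * X) := if (choice.unpickle j : option (nat * nat)) is Some (k, n) then
  seqDU graph k `&` level k (g n) else set0.
pose s (j : nat) : R := if (choice.unpickle j : option (nat * nat)) is Some (k, n) then (g n)^-1 else 1.
have firstE k w : seqDU graph k w -> first w = k.
  move=> kw; rewrite /first; case: xgetP => [k' _ k'w|/(_ k)//].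
  by apply: (@trivIset_seqDU _ graph k' k) => //; exists w.
apply: (is_delta_of_pieces (D := D) (s := s)).
- move=> j; rewrite /D; case: choice.unpickle => // -[k n].
  by apply: measurableI; [exact: measurable_piece|exact: measurable_level].
- move=> j w; rewrite /D; case: choice.unpickle => // -[k n] [_ [kw _]].
  exact: graph_Rel kw.
- move=> w; rewrite Rel_bigcup seqDU_bigcup_eq => -[k _ kw].
  have [n _ gn] := Gg _ (c_Gamma k w.1).
  exists (choice.pickle (k, n)) => //; rewrite /D choice.pickleK; split => //; split => //.
  exact: subset_seqDU kw.
- by move=> j; rewrite /s; case: choice.unpickle => // -[k n]; rewrite invr_gt0; exact: Gamma_gt0.
- move=> j w; rewrite /D /s; case: choice.unpickle => // -[k n] [kw [_ /= cw]].
  by rewrite /delta (firstE _ _ kw) cw.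
- move=> j W mW; rewrite /D /s; case: choice.unpickle => [[k n] WD|W0].
    by apply: (@nu_lr_level k) => //; [exact: Gamma_gt0|move=> w /WD[]].
  have -> : W = set0 by apply/seteqP; split.
  have [m mE] := nu_r_measure mu; have [l lE] := nu_l_measure mu.
  by rewrite mE// lE// !measure0 mule0.
Qed.

(** Any version of the derivative agrees with the inverse of [c] almost everywhere: where it equals
    [t] and [c k] equals [g n], two scalings hold for one finite mass, which is [0] unless [t] is
    the inverse of [g n]. *)
Lemma scaling_delta_range : delta_range Rel mu `<=` Gamma.
Proof.
move=> t [delta [md d0 dE] tW]; apply: contrapT => tG; apply: tW.
have [g [gG Gg]] := values.
set W := Rel `&` _.
have mW : measurable W by apply: md => //; exact: measurable_Rel.
have WR : W `<=` Rel by move=> w [].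
have [m mE] := nu_r_measure mu.
rewrite mE//; apply/(negligibleP m mW).
pose L (j : nat) : set (X * X) := if (choice.unpickle j : option (nat * nat)) is Some (k, n) then
  W `&` level k (g n) else set0.
apply: (@negligibleS _ _ _ _ (\bigcup_j L j)).
  move=> w Ww; have [k wk] := (RelE w).1 (WR _ Ww).
  have [n _ gn] := Gg _ (c_Gamma k w.1).
  by exists (choice.pickle (k, n)) => //; rewrite /L choice.pickleK.
apply: negligible_bigcup => j; rewrite /L; case: choice.unpickle => [[k n]|]; last first.
  exact: negligible_set0.
set V := W `&` _; have mV : measurable V by exact: measurableI.
have VR : V `<=` Rel by move=> w [/WR].
apply/(negligibleP m mV); suff : nu_r mu V = 0%E by rewrite mE.
have Vl : V `<=` level k (g n) by move=> w [].
have Vg : V `<=` graph k by move=> w /Vl[].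
have g0 : 0 < g n by exact: Gamma_gt0.
have := dE V mV VR; rewrite (integral_nu_r_cst mu (c := t))//; last by move=> w [[]].
rewrite (nu_lr_level g0 mV Vl).
have fin : nu_r mu V \is a fin_num.
  rewrite (nu_r_graph _ mV Vg); apply: fin_num_measure.
  exact: measurable_preimage_rsec.
rewrite -(fineK fin) -!EFinM => -[] /eqP.
rewrite -subr_eq0 -mulrBl mulf_eq0 subr_eq0 => /orP[/eqP tc|/eqP f0].
  by case: tG; rewrite -tc; exact: GammaV.
by rewrite f0.
Qed.

End scaling.

End countable_relation.

(** * Coordinate flips *)

Section base_space_facts.
Context (R : realType) (gamma : nat -> {posnum R}).
Implicit Types (y : nat * bool).

Lemma measurable_base (B : set (nat * bool)) : measurable B.
Proof.
apply: countable_measurable => [[n b]|]; last exact: countableP.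
rewrite (_ : [set (n, b)] = [set n] `*` [set b]); first exact: measurableX.
by apply/seteqP; split => -[m c] /=; [case=> -> ->|case=> -> ->].
Qed.

Definition toggle y : nat * bool := (y.1, ~~ y.2).

Lemma toggleK : involutive toggle.
Proof. by case=> n b; rewrite /toggle/= negbK. Qed.

Definition eta_mass y : R := pr (eta gamma) [set y].

Lemma eta_massE n b : eta_mass (n, b) =
  2 ^- n.+1 * (1 + (gamma n)%:num)^-1 * (if b then (gamma n)%:num else 1).
Proof.
set v := RHS; suff E : eta gamma [set (n, b)] = v%:E by rewrite /eta_mass /pr -[RHS]/(fine v%:E) -E.
have copyE m A : eta_copy gamma m A =
    ((2 ^- m.+1 * (1 + (gamma m)%:num)^-1)%:E *
     (\d_(m, false) A + (gamma m)%:num%:E * \d_(m, true) A))%E.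
  by congr (_ * _)%E; exact: measure_addE.
have memE m c : ((m, c) \in [set (n, b)]) = ((m == n) && (c == b)).
  by apply/idP/idP => [/set_mem[-> ->]|/andP[/eqP -> /eqP ->]]; rewrite ?eqxx ?inE.
have -> : eta gamma [set (n, b)] = eta_copy gamma n [set (n, b)].
  rewrite /eta /mseries (@nneseriesD1 _ _ n)// eseries0 ?adde0// => m _ mn.
  by rewrite copyE !diracE !memE (negbTE mn) mule0 adde0 mule0.
rewrite copyE !diracE !memE eqxx /v.
by case: b {memE v}; rewrite /= ?mule0 ?mule1 ?add0e ?adde0 -EFinM.
Qed.

Lemma eta_mass_gt0 y : 0 < eta_mass y.
Proof.
case: y => n b; rewrite eta_massE; apply: mulr_gt0; last by case: b.
by apply: mulr_gt0; rewrite invr_gt0 ?exprn_gt0.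
Qed.

Definition flip_ratio y : R := eta_mass (toggle y) / eta_mass y.

Lemma flip_ratioE n b : flip_ratio (n, b) =
  if b then (gamma n)%:num^-1 else (gamma n)%:num.
Proof.
have g0 : 0 < (gamma n)%:num by [].
have h : 0 < (2 : R) ^+ n.+1 by rewrite exprn_gt0.
rewrite /flip_ratio !eta_massE /=; case: b => /=; field; rewrite ?gt_eqF ?addr_gt0//.
Qed.

Lemma flip_ratio_gt0 y : 0 < flip_ratio y.
Proof. by rewrite divr_gt0// eta_mass_gt0. Qed.

End base_space_facts.

Section resetting.
Context d (Y : measurableType d) (I : countType) (R : realType).
Context (eta : probability Y R) (mu : probability (prod_space Y I) R).
Hypothesis mu_eta : is_product_measure eta mu.
Local Notation X := (prod_space Y I).

(* Replacing the coordinate [i] by a constant maps both [mu] and its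
   restriction to [x i \in C] to multiples of the same measure. *)
Lemma coord_independence (i : I) (C : set Y) (B : set X) :
  measurable C -> measurable B ->
  (forall x y : X, (forall j, j != i -> x j = y j) -> B x -> B y) ->
  mu (B `&` [set x | C (x i)]) = (eta C * mu B)%E.
Proof.
move=> mC mB Bi.
pose r (x : X) : X := fun j => if j == i then point else x j.
have mr : measurable_fun setT r.
  apply: measurable_to_prod => j D mD; rewrite /r; case: eqP => _.
    have [Dp|nDp] := pselect (D point).
      by rewrite (_ : [set _ | _] = setT)//; apply/seteqP; split.
    by rewrite (_ : [set _ | _] = set0)//; apply/seteqP; split.
  exact: measurable_coord.
have rB : r @^-1` B = B.
  apply/seteqP; split => x; apply: Bi => j ji; by rewrite /r (negbTE ji).
have mCi := measurable_coord i mC.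
have [m1 m1E] := pushforward_restr (mrestr mu mCi) mr (@measurableT _ X).
have [m2 m2E] := pushforward_restr mu mr (@measurableT _ X).
have e0 : 0 <= pr eta C by exact: pr_ge0.
have etaC : eta C = (pr eta C)%:E by exact: prE.
suff H : forall A : set X, measurable A -> m1 A = mscale (NngNum e0) m2 A.
  have := H B mB; rewrite m1E /mscale m2E/= !setIT rB /mrestr => ->.
  by rewrite etaC.
apply: box_measure_unique.
  rewrite m1E setIT [X in (X < _)%E](_ : _ = mu [set x | C (x i)]).
    by apply: le_lt_trans (probability_le1 mu mCi) _; rewrite ltry.
  by rewrite /mrestr; congr (mu _); apply/seteqP; split => x //; case.
move=> F D mD; rewrite -[RHS]/(mscale (NngNum e0) m2 _) /mscale /= m1E m2E !setIT /mrestr.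
(* The preimage of a box under [r] is empty if [i] is constrained and its side there misses
   [point]. *)
have [[iF nDp]|Dp] := pselect (i \in F /\ ~ D i point).
  rewrite (_ : r @^-1` _ = set0) ?set0I ?measure0 ?mule0//.
  apply/seteqP; split => // x /= /(_ i iF); by rewrite /r eqxx.
pose D' (E : set Y) j := if j == i then E else D j.
have mD' E : measurable E -> forall j, measurable (D' E j).
  by move=> mE j; rewrite /D'; case: eqP.
have box E : measurable E ->
    mu [set x | forall j, j \in (i |` F `\ i)%fset -> D' E j (x j)] =
    (eta E * \prod_(j <- (F `\ i)%fset) eta (D j))%E.
  move=> mE; rewrite (mu_eta _ (mD' E mE)) big_fsetU1/= ?in_fsetD1 ?eqxx//.
  rewrite {1}/D' eqxx; congr (_ * _)%E.
  rewrite big_seq [RHS]big_seq; apply: eq_bigr => j.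
  by rewrite in_fsetD1 /D' => /andP[/negbTE ->].
have inF j : j \in (i |` F `\ i)%fset = (j == i) || (j \in F).
  by rewrite in_fset1U in_fsetD1; case: eqP.
have Dpi : i \in F -> D i point.
  by move=> iF; apply: contrapT => nD; apply: Dp.
have rbox E : r @^-1` [set x | forall j, j \in F -> D j (x j)] `&` [set x | E (x i)] =
    [set x | forall j, j \in (i |` F `\ i)%fset -> D' E j (x j)].
  apply/seteqP; split => x /=.
    move=> [xD xE] j; rewrite inF /D'; case: eqP => [-> //|ji /= jF].
    by have := xD j jF; rewrite /r; case: eqP.
  move=> xD; split; last by have := xD i; rewrite inF eqxx /D' eqxx; exact.
  move=> j jF; rewrite /r; case: eqP => [ji|/eqP ji]; first by rewrite ji in jF *; exact: Dpi.
  by have := xD j; rewrite inF jF orbT /D' (negbTE ji); exact.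
rewrite [LHS](_ : _ = mu [set x | forall j, j \in (i |` F `\ i)%fset -> D' C j (x j)]); last first.
  by congr (mu _); exact: rbox.
rewrite box//; congr (_ * _)%E; first exact: esym.
have := box setT measurableT; rewrite probability_setT mul1e => <-.
by rewrite -rbox (_ : [set x : X | setT (x i)] = setT) ?setIT.
Qed.

End resetting.

Section flips.
Context (I : countType) (R : realType) (gamma : nat -> {posnum R}).
Local Notation X := (prod_space (nat * bool)%type I).
Variable mu : probability X R.
Hypothesis mu_eta : is_product_measure (eta gamma) mu.
Implicit Types (F : {fset I}) (x : X).

Definition flip F x : X := fun i => if i \in F then toggle (x i) else x i.

Lemma flipK F : involutive (flip F).
Proof.
by move=> x; apply/funext => i; rewrite /flip; case: (i \in F); rewrite ?toggleK.
Qed.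

Lemma measurable_flip F : measurable_fun setT (flip F).
Proof.
apply: measurable_to_prod => i B mB; rewrite /flip; case: (i \in F).
  exact: (@measurable_coord _ _ _ i (toggle @^-1` B) (measurable_base _)).
exact: measurable_coord.
Qed.

Lemma measurable_flip_preimage F (A : set X) : measurable A -> measurable (flip F @^-1` A).
Proof. by move=> mA; rewrite -[X in measurable X]setTI; exact: measurable_flip. Qed.

Definition flip_jacobian F x : R := \prod_(i <- F) flip_ratio gamma (x i).

Lemma flip_jacobian_gt0 F x : 0 < flip_jacobian F x.
Proof. by apply: prodr_gt0 => i _; exact: flip_ratio_gt0. Qed.

Lemma eta_singleton y (B : set (nat * bool)) :
  eta gamma (toggle @^-1` ([set y] `&` B)) =
  ((flip_ratio gamma y)%:E * eta gamma ([set y] `&` B))%E.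
Proof.
have [By|nBy] := pselect (B y); last first.
  by rewrite (_ : _ `&` B = set0) ?preimage_set0 ?measure0 ?mule0//;
    apply/seteqP; split => // z [->].
rewrite setIidl; last by move=> _ ->.
rewrite (_ : toggle @^-1` [set y] = [set toggle y]); last first.
  by apply/seteqP; split => z /= => [<-|->]; rewrite toggleK.
rewrite (prE (eta gamma) (measurable_base [set toggle y])).
rewrite (prE (eta gamma) (measurable_base [set y])) -EFinM; congr EFin.
by rewrite /flip_ratio divfK// gt_eqF// eta_mass_gt0.
Qed.

(** With the coordinates in [F] frozen at [z] the Jacobian is a constant, so two finite measures are
    compared on boxes, where the flip acts factor by factor. *)
Lemma flip_box F (z : X) (A : set X) : measurable A ->
  (forall x, A x -> forall i, i \in F -> x i = z i) ->
  mu (flip F @^-1` A) = ((flip_jacobian F z)%:E * mu A)%E.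
Proof.
move=> mA Az.
pose S : set X := [set x | forall i, i \in F -> [set z i] (x i)].
have mS : measurable S.
  exact: (@measurable_box _ _ _ F (fun i => [set z i]) (fun i => measurable_base _)).
have J0 : 0 <= flip_jacobian F z by rewrite ltW// flip_jacobian_gt0.
have [m1 m1E] := pushforward_restr mu (measurable_flip F) mS.
suff H : forall B : set X, measurable B -> m1 B = mscale (NngNum J0) (mrestr mu mS) B.
  have AS : A `&` S = A by apply: setIidl => x Ax i iF; exact: Az.
  by have := H A mA; rewrite m1E /mscale /= /mrestr AS.
apply: box_measure_unique.
  rewrite m1E; apply: le_lt_trans (probability_le1 mu _) _; last exact: ltry.
  by apply: measurable_flip_preimage; exact: measurableI.
move=> G D mD; rewrite -[RHS]/(mscale (NngNum J0) (mrestr mu mS) _) /mscale /= /mrestr m1E.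
pose D' i := (if i \in F then [set z i] else setT) `&` (if i \in G then D i else setT).
have -> : [set x | forall i, i \in G -> D i (x i)] `&` S =
    [set x : X | forall i, i \in (F `|` G)%fset -> D' i (x i)].
  apply/seteqP; split => x /=.
    by move=> [xD xS] i _; split; case: ifP => //; [exact: xS|exact: xD].
  move=> xD; split => i iF; have := xD i; rewrite in_fsetU /D' iF ?orbT => /(_ isT)[] //.
rewrite (mu_eta (F `|` G)%fset (fun i => measurable_base (D' i))).
pose D'' i := if i \in F then toggle @^-1` (D' i) else D' i.
have -> : flip F @^-1` [set x : X | forall i, i \in (F `|` G)%fset -> D' i (x i)] =
    [set x : X | forall i, i \in (F `|` G)%fset -> D'' i (x i)].
  apply/seteqP; split => x /= xD i /xD; rewrite /D'' /flip; by case: ifP.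
apply: etrans (mu_eta (F `|` G)%fset (fun i => measurable_base (D'' i))) _.
rewrite (eq_bigr (fun i => (if i \in F then flip_ratio gamma (z i) else 1)%:E * eta gamma (D' i))%E).
  have etaE B : (eta gamma : probability _ R) B = (pr (eta gamma) B)%:E by exact: (prE (eta gamma) (measurable_base B)).
  under [in LHS]eq_bigr do rewrite etaE -EFinM.
  under [in RHS]eq_bigr do rewrite etaE.
  rewrite !prodEFin big_split/= EFinM; congr (_%:E * _)%E.
  rewrite /flip_jacobian (big_fsetID _ (mem F))/= [X in _ * X]big1_fset ?mulr1.
    rewrite (_ : [fset x in _ | _]%fset = F).
      by rewrite big_seq [RHS]big_seq; apply: eq_bigr => i ->.
    by apply/fsetP => i; rewrite !inE; case: (i \in F); rewrite ?orbT ?andbF.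
  by move=> i; rewrite !inE => /andP[_ /negbTE ->].
move=> i _; rewrite /D''; case: ifP => iF; last by rewrite mul1e.
by rewrite /D' iF; exact: eta_singleton.
Qed.

(** There are only countably many tuples of values, so [P] can be arbitrary. *)
Lemma measurable_values F (P : set (seq (nat * bool))) :
  measurable ([set x | P [seq x i | i <- F]] : set X).
Proof.
rewrite (_ : [set x | _] = \bigcup_(v : seq (nat * bool))
    (if `[< P v >] then [set x : X | [seq x i | i <- F] = v] else set0)); last first.
  apply/seteqP; split => x /=; last first.
    by move=> [v _]; case: asboolP => // Pv xv; rewrite (xv : _ = v).
  by move=> Px; exists [seq x i | i <- F] => //; rewrite asboolT.
apply: countable_bigcupT_measurable => // v; case: asboolP => // _.
have [[x xv]|nov] := pselect (exists x : X, [seq x i | i <- F] = v); last first.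
  rewrite (_ : [set x | _] = set0)//.
  by apply/seteqP; split => // x xv; apply: nov; exists x.
rewrite (_ : [set y | _] = [set y : X | forall i, i \in F -> [set x i] (y i)]).
  exact: (@measurable_box _ _ _ F (fun i => [set x i]) (fun i => measurable_base _)).
apply/seteqP; split => y /=; rewrite -xv => yx; last exact/eq_in_map.
by move=> i iF; move/eq_in_map : yx; exact.
Qed.

(** The values on [F] cut [A] into countably many parts, to each of which [flip_box] applies. *)
Lemma flip_scaling F s (A : set X) : measurable A ->
  (forall x, A x -> flip_jacobian F x = s) ->
  mu (flip F @^-1` A) = (s%:E * mu A)%E.
Proof.
move=> mA As.
have [[x0 Ax0]|noA] := pselect (exists x, A x); last first.
  rewrite (_ : A = set0) ?preimage_set0 ?measure0 ?mule0//.
  by apply/seteqP; split => // x Ax; apply: noA; exists x.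
have s0 : 0 <= s by rewrite -(As _ Ax0) ltW// flip_jacobian_gt0.
have [m1 m1E] := pushforward_restr mu (measurable_flip F) (@measurableT _ X).
suff : m1 A = mscale (NngNum s0) mu A by rewrite m1E setIT.
pose vals (x : X) : seq (nat * bool) := [seq x i | i <- F].
pose B (k : nat) : set X := [set x | vals x = odflt [::] (choice.unpickle k)].
have BE (x : X) k : B k x -> forall y, B k y -> forall i, i \in F -> y i = x i.
  by move=> xk y yk i iF; have /eq_in_map := etrans yk (esym xk); exact.
have mB k : measurable (B k).
  exact: (@measurable_values F [set v | v = odflt [::] (choice.unpickle k)]).
apply: (measure_eq_cover mB) => //.
  by move=> x _; exists (choice.pickle (vals x)) => //; exact: (congr1 (odflt [::]) (esym (choice.pickleK (vals x)))).
move=> k C mC CA CB; rewrite m1E setIT -[RHS]/(s%:E * mu C)%E.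
have [[x Cx]|noC] := pselect (exists x, C x); last first.
  rewrite (_ : C = set0) ?preimage_set0 ?measure0 ?mule0//.
  by apply/seteqP; split => // x Cx; apply: noC; exists x.
rewrite -(As x (CA _ Cx)); apply: flip_box => //.
by move=> y /CB yk; apply: BE yk; exact: CB.
Qed.

Lemma flip_jacobian_level F s : measurable [set x | flip_jacobian F x = s].
Proof.
have := @measurable_values F [set v | \prod_(y <- v) flip_ratio gamma y = s].
rewrite (_ : [set x : X | _] = [set x | flip_jacobian F x = s])//.
by apply/seteqP; split => x /=; rewrite /flip_jacobian big_map.
Qed.

End flips.

Lemma base_rel_toggle (y z : nat * bool) : base_rel y z -> y <> z -> z = toggle y.
Proof.
case: y z => n b [m c]; rewrite /base_rel /toggle /= => <- bc; congr (_, _).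
by case: b c bc => [] [].
Qed.

Section bernoulli_relation.
Context (I : countType) (L : groupType) (act : L -> I -> I).
Hypothesis act_action : is_action act.
Local Notation X := (prod_space (nat * bool)%type I).
Local Notation shift := Defs.shift.
Implicit Types (F : {fset I}) (x y z : X) (g h : L).

Lemma measurable_diag_prod : measurable [set w : X * X | w.1 = w.2].
Proof.
have mcoord i : measurable [set w : X * X | w.1 i = w.2 i].
  rewrite (_ : [set w | _] = \bigcup_(v : nat * bool)
      ((fst : X * X -> X) @^-1` [set x | [set v] (x i)] `&`
       (snd : X * X -> X) @^-1` [set x | [set v] (x i)])); last first.
    apply/seteqP; split => w /=; first by move=> wi; exists (w.2 i).
    by move=> [v _ [-> ->]].
  apply: countable_bigcupT_measurable => // v; apply: measurableI.
    by rewrite -[X in measurable X]setTI; apply: measurable_fst => //;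
      apply: measurable_coord; exact: measurable_base.
  by rewrite -[X in measurable X]setTI; apply: measurable_snd => //;
    apply: measurable_coord; exact: measurable_base.
rewrite (_ : [set w | _] = ~` (\bigcup_i ~` [set w : X * X | w.1 i = w.2 i])).
  apply: measurableC; apply: countable_bigcupT_measurable => // i.
  exact: measurableC.
apply/seteqP; split => w /=; first by move=> ww [i _]; apply; rewrite /= ww.
move=> H; apply/funext => i; apply: contrapT => wi; apply: H; exists i => //.
Qed.

Lemma shift1 x : shift act 1%g x = x.
Proof. by apply/funext => i; rewrite /shift invg1; case: act_action => ->. Qed.

Lemma shiftM g h x : shift act (g * h)%g x = shift act g (shift act h x).
Proof.
by apply/funext => i; rewrite /shift invgM; case: act_action => _ ->.
Qed.

Lemma tensor_rel_shift g x y : tensor_rel base_rel x y ->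
  tensor_rel base_rel (shift act g x) (shift act g y).
Proof.
move=> [F [finF xyF xyNF]]; exists (act g @` F); split.
- exact: finite_image.
- by move=> _ [i Fi <-]; rewrite /shift actK//; exact: xyF.
- move=> i nFi; apply: xyNF => Fi; apply: nFi.
  by exists (act g^-1%g i) => //; rewrite actVK.
Qed.

Lemma tensor_rel_sym x y : tensor_rel base_rel x y -> tensor_rel base_rel y x.
Proof. by move=> [F [finF xyF xyNF]]; exists F; split => // i Fi; rewrite /base_rel ?xyF// xyNF. Qed.

Lemma tensor_rel_trans y x z : tensor_rel base_rel x y -> tensor_rel base_rel y z ->
  tensor_rel base_rel x z.
Proof.
move=> [F [finF xyF xyNF]] [G [finG yzG yzNG]]; exists (F `|` G); split.
- by rewrite finite_setU.
- move=> i _; rewrite /base_rel.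
  transitivity (y i).1.
    by have [/xyF|/xyNF ->] := pselect (F i).
  by have [/yzG|/yzNG ->] := pselect (G i).
- move=> i nFG; rewrite xyNF; last by move=> Fi; apply: nFG; left.
  by apply: yzNG => Gi; apply: nFG; right.
Qed.

(** A class of [base_rel] has two points, so a coordinate either stays or is toggled; [F] collects
    those that change. *)
Lemma tensor_rel_flip x y : tensor_rel base_rel x y <-> exists F, y = flip F x.
Proof.
split; last first.
  move=> [F ->]; exists [set` F]; split; first exact: finite_fset.
    by move=> i /= iF; rewrite /base_rel /flip iF.
  by move=> i /= iF; rewrite /flip (negbTE (introN idP iF)).
move=> [F [finF xyF xyNF]].
exists (fset_set (F `&` [set i | x i <> y i])); apply/funext => i; rewrite /flip.
rewrite in_fset_set; last exact: finite_setIl.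
case: ifPn => [/set_mem[Fi xy]|/negP nF].
  exact: base_rel_toggle (xyF i Fi) xy.
apply: contrapT => yx; apply: nF; apply/mem_set.
have xy : x i <> y i by move=> xy; apply: yx.
by split => //; apply: contrapT => /xyNF.
Qed.

(** Shifts preserve the tensor relation, so in a chain of steps all the shifts can be performed
    first and the remaining changes merged into one flip. *)
Lemma bernoulli_relP (w : X * X) : bernoulli_rel base_rel act w <->
  exists g F, w.2 = flip F (shift act g w.1).
Proof.
case: w => x y; rewrite /bernoulli_rel/=; split; last first.
  move=> [g [F ->]]; apply: (rst_trans _ _ _ (shift act g x)).
    by apply: rst_step; right; exists g.
  by apply: rst_step; left; apply/tensor_rel_flip; exists F.
suff H : clos_refl_sym_trans (I -> nat * bool)
    (fun x y => tensor_rel base_rel x y \/ orbit_rel act x y) x y ->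
    exists g, tensor_rel base_rel (shift act g x : X) y.
  by move/H => [g /tensor_rel_flip[F ->]]; exists g, F.
have trefl (u : X) : tensor_rel base_rel u u.
  by exists set0; split => //; exact: finite_set0.
elim=> {x y} [x y [xy|[g ->]]|x|x y _ [g xy]|x y z _ [g xy] _ [h yz]].
- by exists 1%g; rewrite shift1.
- by exists g.
- by exists 1%g; rewrite shift1.
- exists g^-1%g; have := tensor_rel_shift g^-1%g (tensor_rel_sym xy).
  by rewrite shiftK.
- exists (h * g)%g; rewrite shiftM.
  exact: tensor_rel_trans (tensor_rel_shift h xy) yz.
Qed.

End bernoulli_relation.

(** On a finite nonempty [I] the uniform mean is invariant under all permutations. *)
Lemma infinite_index (R : realType) (L : groupType) (I : countType) (act : L -> I -> I) :
  is_action act -> [set: I] !=set0 ->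
  ~ (exists m : set I -> R, invariant_mean act m) ->
  forall J : seq I, exists i, i \notin J.
Proof.
move=> act_action [i0 _] nomean J; apply: contrapT => noi; apply: nomean.
have J_all i : i \in J by apply: contrapT => /negP iJ; apply: noi; exists i.
pose F : {fset I} := [fset i in J]%fset.
have F_all i : i \in F by rewrite !inE.
exists (fun A => density R A F); split.
- by move=> A; exact: density_ge0.
- rewrite densityT (_ : (F == fset0) = false) ?subr0//.
  by apply/negbTE/eqP => F0; have := F_all i0; rewrite F0.
- by move=> A B AB; exact: densityU.
- move=> g A; rewrite -[RHS](density_image _ _ _ (actK act_action g)).
  congr density; apply/fsetP => i; rewrite F_all.
  apply/esym/imfsetP; exists (act g^-1%g i); first exact: F_all.
  by rewrite (actVK act_action).
Qed.

Section far_flip.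
Context (I : countType) (R : realType) (gamma : nat -> {posnum R}).
Local Notation X := (prod_space (nat * bool)%type I).
Variable mu : probability X R.
Hypothesis mu_eta : is_product_measure (eta gamma) mu.

(* [Z] is almost a cylinder, hence almost invariant under the flips of the
   coordinates that the cylinder does not involve. *)
Lemma far_flip (Z : set X) (y0 : nat * bool) : measurable Z -> 0 < pr mu Z ->
  (forall J : seq I, exists i, i \notin J) ->
  exists i : I, 0 < pr mu (Z `&` [set x | x i = y0] `&` flip [fset i]%fset @^-1` Z).
Proof.
move=> mZ Z0 inf.
pose w := eta_mass gamma y0; pose rho := flip_ratio gamma (toggle y0).
have w0 : 0 < w by exact: eta_mass_gt0.
have rho0 : 0 < rho by exact: flip_ratio_gt0.
(* Three losses must stay below [w * pr mu Z]: [w * eps] from replacing [Z] by [B], [eps] from the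
   part of [B] outside [Z], and [rho * eps] from the image of that part under the flip. With this
   choice they add up to half of it. *)
pose eps := w * pr mu Z / (2 * (w + 1 + rho)).
have den0 : 0 < w + 1 + rho by rewrite !addr_gt0.
have eps0 : 0 < eps by rewrite divr_gt0// mulr_gt0.
have [B cB ZB] := cylinder_approx mu_eta mZ eps0.
have mB := cylinder_measurable mu_eta cB.
have [Zq [q [J [b [mq uJ bJ BE]]]]] := cB.
have [i iJ] := inf J; exists i.
pose phi : X -> X := flip [fset i]%fset.
pose S : set X := [set x | x i = y0].
have mS : measurable S by apply: (measurable_coord i (B := [set y0])); exact: measurable_base.
have mphi (A : set X) : measurable A -> measurable (phi @^-1` A).
  exact: measurable_flip_preimage.
have Bi (x y : X) : (forall j, j != i -> x j = y j) -> B x -> B y.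
  move=> xy; rewrite BE /cyl/= (bJ _ (discretize q y))// => j jJ.
  rewrite /discretize xy//; by apply/eqP => ji; move: iJ; rewrite -ji jJ.
have phiB x : B x -> B (phi x).
  apply: Bi => j ji; by rewrite /phi /flip in_fset1 (negbTE ji).
have BS : pr mu (B `&` S) = w * pr mu B.
  apply: etrans (congr1 (@fine R) (coord_independence mu_eta (measurable_base [set y0]) mB Bi)) _.
  by apply: fineM; apply: fin_num_measure => //; exact: measurable_base.
have mD : measurable (B `\` Z) by exact: measurableD.
have flipS : pr mu (S `&` phi @^-1` (B `\` Z)) <= rho * pr mu (B `\` Z).
  pose A := (B `\` Z) `&` [set x | x i = toggle y0].
  have mT : measurable [set x : X | x i = toggle y0].
    by apply: (measurable_coord i (B := [set toggle y0])); exact: measurable_base.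
  have mA : measurable A by exact: measurableI.
  have -> : S `&` phi @^-1` (B `\` Z) = phi @^-1` A.
    apply/seteqP; split => x; rewrite /A /S /phi/= /flip in_fset1 eqxx.
      by move=> [-> []].
    by move=> [[Bx nZ] /(congr1 toggle)]; rewrite !toggleK.
  have := flip_scaling mu_eta (F := [fset i]%fset) (s := rho) mA.
  have jac x : A x -> flip_jacobian gamma [fset i]%fset x = rho.
    by move=> [_ /= xi]; rewrite /flip_jacobian big_seq_fset1 xi.
  move=> /(_ jac) h; have -> : pr mu (phi @^-1` A) = rho * pr mu A.
    apply: etrans (congr1 (@fine R) h) _.
    by apply: fineM => //; exact: fin_num_measure.
  by rewrite ler_wpM2l ?(ltW rho0)//; apply: le_pr => // x [].
have mphiZ := mphi Z mZ; have mphiD := mphi _ mD.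
set E := _ `&` _ `&` _.
have mE : measurable E by apply: measurableI => //; exact: measurableI.
have cover : pr mu (B `&` S) <= pr mu E + (pr mu (B `\` Z) + pr mu (S `&` phi @^-1` (B `\` Z))).
  have mSD : measurable (S `&` phi @^-1` (B `\` Z)) by exact: measurableI.
  apply: (@le_trans _ _ (pr mu (E `|` ((B `\` Z) `|` (S `&` phi @^-1` (B `\` Z)))))).
    apply: le_pr.
    - exact: measurableI.
    - by apply: measurableU => //; exact: measurableU.
    - move=> x [Bx Sx]; have [Zx|nZx] := pselect (Z x); last by right; left.
      have [Zpx|nZpx] := pselect (Z (phi x)); first by left.
      by right; right; split => //; split => //; exact: phiB.
  apply: le_trans (le_prU _ _ _) _ => //; first exact: measurableU.
  by rewrite lerD2l; exact: le_prU.
have BZ : pr mu (B `\` Z) < eps.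
  apply: le_lt_trans ZB; apply: le_pr => //; first exact: measurableY.
  by move=> x [Bx nZ]; right.
have := pr_near mu mZ mB; rewrite ler_norml => /andP[_ ZB2].
have wB : w * (pr mu Z - eps) < w * pr mu B.
  by rewrite ltr_pM2l//; lra.
have rB : rho * pr mu (B `\` Z) < rho * eps by rewrite ltr_pM2l.
have epsE : eps * (w + 1 + rho) = w * pr mu Z / 2.
  by rewrite /eps; field; rewrite gt_eqF.
have wZ : 0 < w * pr mu Z by rewrite mulr_gt0.
rewrite BS in cover; rewrite mulrBr in wB.
have sumE : eps * w + eps + eps * rho = w * pr mu Z / 2 by rewrite -epsE; ring.
have arith (wz ew wb e er rb fs bz p : R) : wz - ew < wb -> rb < er -> fs <= rb ->
    wb <= p + (bz + fs) -> 0 < wz -> bz < e -> ew + e + er = wz / 2 -> 0 < p by lra.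
rewrite (mulrC w eps) in wB; rewrite (mulrC rho eps) in rB.
exact: arith wB rB flipS cover wZ BZ sumE.
Qed.

End far_flip.

(** * Almost periodic measures *)

Section density_levels.
Context d (X : measurableType d) (R : realType).

(** Monotonicity of the integral of the derivative of [mu] with respect to [nu]. These comparisons
    are all that later steps use of it, and they remain meaningful when [nu A] is infinite. *)
Lemma density_levels (nu : {sigma_finite_measure set X -> \bar R})
    (mu : probability X R) : mu `<< nu ->
  exists f : X -> R, [/\ measurable_fun setT f, forall x, 0 <= f x,
    forall a A, 0 <= a -> measurable A -> (forall x, A x -> a <= f x) ->
      (a%:E * nu A <= mu A)%E &
    forall a A, 0 <= a -> measurable A -> (forall x, A x -> f x <= a) ->
      (mu A <= a%:E * nu A)%E].
Proof.
move=> dom; have [f [f0 ffin fint fE]] := radon_nikodym_sigma_finite dom.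
have mf : measurable_fun setT f by case/integrableP : fint.
have fK x : f x = (fine (f x))%:E by rewrite fineK.
exists (fine \o f); split.
- by apply: measurableT_comp => //; exact: measurable_fine.
- by move=> x; rewrite fine_ge0.
- move=> a A a0 mA Aa; rewrite fE// -integral_cst//.
  apply: ge0_le_integral => //.
  + exact: measurable_funTS.
  + by move=> x Ax; rewrite /cst fK lee_fin; exact: Aa.
- move=> a A a0 mA Aa; rewrite fE// -integral_cst//.
  apply: ge0_le_integral => //.
  + exact: measurable_funTS.
  + by move=> x Ax; rewrite /cst fK lee_fin; exact: Aa.
Qed.

(* If [psi] preserves [mu] and scales [nu] by [c^-1] on [D], then [dmu/dnu]
   gets multiplied by [c] along [psi] on [D]. *)
Lemma density_increment (nu : {measure set X -> \bar R}) (mu : probability X R)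
    (f : X -> R) (psi psi' : X -> X) (D : set X) (c : R) :
  measurable_fun setT f -> (forall x, 0 <= f x) ->
  (forall a A, 0 <= a -> measurable A -> (forall x, A x -> a <= f x) ->
      (a%:E * nu A <= mu A)%E) ->
  (forall a A, 0 <= a -> measurable A -> (forall x, A x -> f x <= a) ->
      (mu A <= a%:E * nu A)%E) ->
  measurable_fun setT psi -> measurable_fun setT psi' -> cancel psi' psi ->
  measurable D -> 0 < c ->
  (forall A, measurable A -> A `<=` D -> nu A = (c%:E * nu (psi' @^-1` A))%E) ->
  (forall A, measurable A -> mu (psi' @^-1` A) = mu A) ->
  nu.-negligible (D `&` [set x | f (psi x) <> c * f x]).
Proof.
move=> mf f0 lev1 lev2 mpsi mpsi' psi'K mD c0 scal inv.
have mfp : measurable_fun setT (f \o psi) by exact: measurableT_comp.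
have mset (h : X -> R) (B : set R) : measurable_fun setT h -> measurable B ->
    measurable (h @^-1` B).
  by move=> mh mB; rewrite -[X in measurable X]setTI; exact: mh.
have mp' A : measurable A -> measurable (psi' @^-1` A).
  by move=> mA; rewrite -[X in measurable X]setTI; exact: mpsi'.
have cV0 : 0 < c^-1 by rewrite invr_gt0.
have scalV A : measurable A -> A `<=` D -> nu (psi' @^-1` A) = (c^-1%:E * nu A)%E.
  by move=> mA AD; rewrite (scal _ mA AD) muleA -EFinM mulVf ?gt_eqF// mul1e.
(* Two competing bounds on one set: as [mu A <= 1] and [b > 0], the first makes [nu A] finite, and
   [a < b] then forces it to be [0]. *)
have null (A : set X) (a b : R) : measurable A -> 0 <= a -> a < b ->
    (b%:E * (c^-1%:E * nu A) <= mu A)%E -> (mu A <= a%:E * (c^-1%:E * nu A))%E ->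
    nu A = 0%E.
  move=> mA a0 ab h1 h2.
  have fin : nu A \is a fin_num.
    rewrite ge0_fin_numE// ltey; apply/eqP => Aoo; move: h1; rewrite Aoo.
    rewrite gt0_muley ?lte_fin// gt0_muley ?lte_fin; last exact: le_lt_trans ab.
    by rewrite leye_eq => /eqP muA; have := probability_le1 mu mA; rewrite muA.
  have := le_trans h1 h2; rewrite -(fineK fin) -!EFinM lee_fin.
  have n0 : 0 <= fine (nu A) by rewrite fine_ge0.
  rewrite !mulrA => h3; congr EFin; apply/eqP; rewrite eq_le n0 andbT.
  rewrite leNgt; apply/negP => n1; move: h3; rewrite ler_pM2r// ler_pM2r//.
  by rewrite leNgt ab.
pose B1 (a b : R) := D `&` ((f \o psi) @^-1` [set` `]-oo, a]] `&` f @^-1` [set` `[b / c, +oo[]).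
pose B2 (a b : R) := D `&` ((f \o psi) @^-1` [set` `[b, +oo[] `&` f @^-1` [set` `]-oo, a / c]]).
have mB1 a b : measurable (B1 a b).
  by apply: measurableI => //; apply: measurableI; apply: mset => //; exact: measurable_itv.
have mB2 a b : measurable (B2 a b).
  by apply: measurableI => //; apply: measurableI; apply: mset => //; exact: measurable_itv.
have B1D a b : B1 a b `<=` D by move=> x [].
have B2D a b : B2 a b `<=` D by move=> x [].
have B10 a b : 0 <= a -> a < b -> nu (B1 a b) = 0%E.
  move=> a0 ab; apply: (null _ a b) => //.
    rewrite muleA -EFinM; apply: lev1 => //.
      by rewrite mulr_ge0 ?(ltW cV0)// (le_trans a0 (ltW ab)).
    by move=> x [_ [_ /=]]; rewrite in_itv/= andbT.
  rewrite -(inv _ (mB1 a b)) -(scalV _ (mB1 a b) (@B1D a b)); apply: lev2 => //; first exact: mp'.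
  by move=> x [_ [/=]]; rewrite in_itv/= psi'K.
have B20 a b : 0 <= a -> a < b -> nu (B2 a b) = 0%E.
  move=> a0 ab; apply: (null _ a b) => //.
    rewrite -(inv _ (mB2 a b)) -(scalV _ (mB2 a b) (@B2D a b)); apply: lev1 => //; first exact: le_trans a0 (ltW ab).
      exact: mp'.
    by move=> x [_ [/=]]; rewrite in_itv/= psi'K andbT.
  rewrite muleA -EFinM; apply: lev2 => //; first by rewrite mulr_ge0 ?(ltW cV0).
  by move=> x [_ [_ /=]]; rewrite in_itv.
(* A strict inequality between [f (psi x)] and [c * f x] is witnessed by two rationals in between,
   so countably many of the null sets [B1] and [B2] suffice. *)
pose N (k : nat) : set X := if (choice.unpickle k : option (rat * rat)) is Some (a, b) then
  if (0 <= ratr a :> R) && (ratr a < ratr b :> R) then B1 (ratr a) (ratr b) `|` B2 (ratr a) (ratr b) else set0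
  else set0.
apply: (@negligibleS _ _ _ _ (\bigcup_k N k)).
  move=> x [Dx /= neq].
  have between (u v : R) : 0 <= u -> u < v -> exists a b : rat,
      [/\ u <= ratr a, ratr b <= v, (0 <= ratr a :> R) & (ratr a < ratr b :> R)].
    move=> u0 uv; have [b] := rat_in_itvoo uv; rewrite in_itv/= => /andP[ub bv].
    have [a] := rat_in_itvoo ub; rewrite in_itv/= => /andP[ua ab].
    by exists a, b; rewrite (ltW ua) (ltW bv) ab (le_trans u0 (ltW ua)).
  have code (a b : rat) : exists k, choice.unpickle k = Some (a, b).
    by exists (choice.pickle (a, b)); exact: choice.pickleK.
  have [lt|gt|//] := ltgtP (f (psi x)) (c * f x).
    have [a [b [h1 h2 h3 h4]]] := between _ _ (f0 _) lt.
    have [k kab] := code a b; exists k => //; rewrite /N kab h3 h4; left.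
    split => //; split; rewrite /= in_itv/= ?andbT//.
    by rewrite ler_pdivrMr// mulrC.
  have [a [b [h1 h2 h3 h4]]] := between _ _ (mulr_ge0 (ltW c0) (f0 _)) gt.
  have [k kab] := code a b; exists k => //; rewrite /N kab h3 h4; right.
  split => //; split; rewrite /= in_itv/= ?andbT//.
  by rewrite ler_pdivlMr// mulrC.
apply: negligible_bigcup => k; rewrite /N.
case: choice.unpickle => [[a b]|]; last exact: negligible_set0.
case: ifP => [/andP[a0 ab]|_]; last exact: negligible_set0.
apply: negligibleU.
  by apply/(negligibleP nu (mB1 _ _)); exact: B10.
by apply/(negligibleP nu (mB2 _ _)); exact: B20.
Qed.

End density_levels.

(** * Strong ergodicity from the spectral gap *)

Lemma gap_strongly_ergodic d (Y : measurableType d) (R : realType) (L : groupType)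
    (I : countType) (act : L -> I -> I) (eta : probability Y R)
    (mu : probability (prod_space Y I) R) (Rel : set (prod_space Y I * prod_space Y I)) :
  is_action act -> is_product_measure eta mu -> has_spectral_gap mu act ->
  (forall g x, Rel (x, Defs.shift act g x)) -> strongly_ergodic mu Rel.
Proof.
move=> act_action mu_eta [S [kappa kappa0 gap]] relg A mA asym.
pose th g : prod_space Y I -> prod_space Y I := Defs.shift act g.
have thimg g (B : set (prod_space Y I)) : th g @` B = th g^-1%g @^-1` B.
  apply/seteqP; split => [_ [x Bx <-]|x Bx]; first by rewrite /= /th (shiftK act_action).
  by exists (th g^-1%g x) => //; rewrite /th (shiftVK act_action).
have fg g : full_group mu Rel (th g).
  split; last by apply: aeW => x; exact: relg.
  split.
  - by exists (th g^-1%g); [exact: shiftK|exact: shiftVK].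
  - exact: measurable_shift.
  - by move=> B mB; rewrite thimg; exact: measurable_shift_preimage.
  - by move=> B mB; rewrite /th (shift_measure mu_eta act_action).
have mY g n : measurable (A n `+` th g @` A n).
  by apply: measurableY => //; rewrite thimg; exact: measurable_shift_preimage.
(* [escape] concerns the preimage under the shift by [g], which is the image under the inverse
   shift; hence the full group element to test is [th g^-1]. *)
have esc g : escape mu act g (A n) @[n --> \oo] --> (0 : R).
  have h : pr mu (A n `+` th g^-1%g @` A n) @[n --> \oo] --> (0 : R).
    have := asym _ (fg g^-1%g).
    rewrite (_ : (fun n => _) = EFin \o (fun n => pr mu (A n `+` th g^-1%g @` A n))).
      by move/fine_cvgP => [].
    by apply/funext => n /=; rewrite prE.
  apply: (squeeze_cvgr _ (cvg_cst 0) h); apply: nearW => n.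
  rewrite pr_ge0 /=; apply: le_pr => //.
    by apply: measurableD => //; exact: measurable_shift_preimage.
  by move=> x [Ax nAx]; left; split => //; rewrite thimg invgK.
have sum0 : (\sum_(g <- S) escape mu act g (A n)) @[n --> \oo] --> (0 : R).
  elim: (S) => [|g s IH].
    by under eq_fun do rewrite big_nil; exact: cvg_cst.
  under eq_fun do rewrite big_cons.
  by have := cvgD (esc g) IH; rewrite addr0; apply; exact: eventually_filter.
have v0 : pr mu (A n) * (1 - pr mu (A n)) @[n --> \oo] --> (0 : R).
  have k0 : (kappa^-1 * \sum_(g <- S) escape mu act g (A n)) @[n --> \oo] --> (0 : R).
    by have := cvgMl_tmp (a := kappa^-1) sum0; rewrite mulr0; apply; exact: eventually_filter.
  apply: (squeeze_cvgr _ (cvg_cst 0) k0); apply: nearW => n.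
  rewrite mulr_ge0 ?pr_ge0 ?subr_ge0 ?pr_le1//=.
  by rewrite -(ler_pM2l kappa0) mulVKf ?gt_eqF//; exact: gap.
rewrite (_ : (fun n => _) = EFin \o (fun n => pr mu (A n) * (1 - pr mu (A n)))).
  by apply: cvg_comp v0 _; exact: cvg_refl.
by apply/funext => n /=; rewrite (prE mu (mA n)) -EFinB -EFinM.
Qed.

(** * The Bernoulli relation: almost periodicity, strong ergodicity and Sd *)

Section bernoulli_relation_invariants.
Context (R : realType) (L : groupType) (I : countType) (act : L -> I -> I).
Hypothesis countable_L : countable [set: L].
Hypothesis I_nonempty : [set: I] !=set0.
Hypothesis act_action : is_action act.
Hypothesis no_invariant_mean : ~ exists m : set I -> R, invariant_mean act m.
Variables (Gamma : set R) (gamma : nat -> {posnum R}).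
Hypothesis Gamma_subgroup : pos_subgroup Gamma.
Hypothesis Gamma_countable : countable Gamma.
Hypothesis gamma_enum : range (fun n => (gamma n)%:num) = Gamma `&` [set t | 0 < t < 1].
Local Notation X := (prod_space (nat * bool)%type I).
Variable mu : probability X R.
Hypothesis mu_eta : is_product_measure (eta gamma) mu.
Local Notation shift := (Defs.shift act).

Let Rel := bernoulli_rel (I := I) base_rel act.

Variable e : nat -> L * {fset I}.
Hypothesis e_surj : forall p, exists k, e k = p.

(** [e] runs through all pairs of a group element and a finite set of coordinates to flip. As shifts
    preserve [mu], the Jacobian [c] sees only the flip, evaluated after the shift. *)
Let psi k (x : X) : X := flip (e k).2 (shift (e k).1 x).
Let psi' k (x : X) : X := shift (e k).1^-1%g (flip (e k).2 x).
Let c k (x : X) : R := flip_jacobian gamma (e k).2 (shift (e k).1 x).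

Let mpsi k : measurable_fun setT (psi k).
Proof. exact: (measurableT_comp (measurable_flip (e k).2) (measurable_shift act (e k).1)). Qed.

Let mpsi' k : measurable_fun setT (psi' k).
Proof. exact: (measurableT_comp (measurable_shift act (e k).1^-1%g) (measurable_flip (e k).2)). Qed.

Let psiK k : cancel (psi k) (psi' k).
Proof. by move=> x; rewrite /psi /psi' flipK (shiftK act_action). Qed.

Let psi'K k : cancel (psi' k) (psi k).
Proof. by move=> x; rewrite /psi /psi' (shiftVK act_action) flipK. Qed.

Let RelE w : Rel w <-> exists k, w.2 = psi k w.1.
Proof.
rewrite /Rel (bernoulli_relP act_action); split.
  by move=> [g [F ->]]; have [k ek] := e_surj (g, F); exists k; rewrite /psi ek.
by move=> [k ->]; exists (e k).1, (e k).2.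
Qed.

Let gammaG n : Gamma (gamma n)%:num.
Proof.
have : (Gamma `&` [set t | 0 < t < 1]) (gamma n)%:num by rewrite -gamma_enum; exists n.
by case.
Qed.

Let GammaV t : Gamma t -> Gamma t^-1.
Proof. case: Gamma_subgroup => _ _ _; exact. Qed.

Let jacobianG F (x : X) : Gamma (flip_jacobian gamma F x).
Proof.
case: Gamma_subgroup => _ G1 GM _.
rewrite /flip_jacobian; elim/big_ind : _ => // i _.
case: (x i) => n b; rewrite flip_ratioE; case: b; [exact: GammaV|exact: gammaG].
Qed.

Let scaling k s (A : set X) : measurable A -> (forall x, A x -> c k x = s) ->
  mu (psi' k @^-1` A) = (s%:E * mu A)%E.
Proof.
move=> mA Ac; rewrite -(shift_measure mu_eta act_action (e k).1^-1%g mA).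
apply: (flip_scaling mu_eta (F := (e k).2)).
  exact: measurable_shift_preimage.
by move=> x /Ac; rewrite /c (shiftVK act_action).
Qed.

Let mc k s : measurable [set x | c k x = s].
Proof.
exact: (measurable_shift_preimage act (e k).1 (flip_jacobian_level gamma (e k).2 s)).
Qed.

Lemma bernoulli_almost_periodic : almost_periodic_measure Rel mu.
Proof.
case: Gamma_subgroup => Gpos _ _ _.
exact: (scaling_almost_periodic (@measurable_diag_prod I) mpsi mpsi' psiK psi'K RelE
  (mu := mu) (c := c) Gamma_countable Gpos GammaV mc (fun k x => jacobianG _ _) scaling).
Qed.

Lemma bernoulli_delta_range_sub : delta_range Rel mu `<=` Gamma.
Proof.
case: Gamma_subgroup => Gpos _ _ _.
exact: (scaling_delta_range (@measurable_diag_prod I) mpsi mpsi' psiK psi'K RelE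
  (mu := mu) (c := c) Gamma_countable Gpos GammaV mc (fun k x => jacobianG _ _) scaling).
Qed.

Let gap : has_spectral_gap mu act.
Proof. exact: (spectral_gap mu_eta act_action countable_L no_invariant_mean). Qed.

Lemma bernoulli_strongly_ergodic : strongly_ergodic mu Rel.
Proof.
apply: (gap_strongly_ergodic act_action mu_eta gap) => g x.
apply/(bernoulli_relP act_action); exists g, fset0.
by apply/funext => i; rewrite /flip in_fset0.
Qed.

Section given_measure.
Variable nu : {sigma_finite_measure set X -> \bar R}.
Hypotheses (nu_mu : nu `<< mu) (mu_nu : mu `<< nu).
Variables (delta : X * X -> R) (C : set R).
Hypothesis deltaE : is_delta Rel nu delta.
Hypothesis C_countable : countable C.
Hypothesis delta_C : nu_r nu (Rel `\` delta @^-1` C) = 0%E.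

Let null_mu (A : set X) : nu.-negligible A -> mu.-negligible A.
Proof.
move=> [N [mN N0 AN]]; exists N; split => //.
by move/null_content_dominatesP : mu_nu; apply.
Qed.

Let flip0 (x : X) : flip fset0 x = x.
Proof. by apply/funext => i; rewrite /flip in_fset0. Qed.

(* The density of [mu] with respect to [nu] has an atom, since [ln f] has
   countably many increments along the action of [L]. *)
Lemma proportional_piece : exists (a : R) (Z : set X),
  [/\ 0 < a, measurable Z, 0 < pr mu Z &
   forall A, measurable A -> A `<=` Z -> mu A = (a%:E * nu A)%E].
Proof.
have [f [mf f0 lev1 lev2]] := density_levels mu_nu.
have mlev a : measurable [set x | f x = a].
  by have := mf measurableT [set a] (measurable_set1 a); rewrite setTI.
(* Discards the points where the logarithm of [f] is meaningless. *)
have fpos : mu [set x | f x = 0] = 0%E.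
  apply/eqP; rewrite -measure_le0; apply: le_trans (lev2 0 _ _ (mlev 0) _) _ => //.
    by move=> x ->.
  by rewrite mul0e.
pose H x := ln (f x).
have mH : measurable_fun setT H.
  by apply: measurableT_comp mf; exact: measurable_ln.
have incr g : exists2 C' : set R, countable C' &
    {ae mu, forall x, C' (H (shift g x) - H x)}.
  exists [set ln t | t in C].
    exact: card_le_trans (card_image_le _ _) C_countable.
  have [k ek] := e_surj (g, fset0).
  have psiE : psi k = shift g by apply/funext => x; rewrite /psi ek /= flip0.
  have psi'E : psi' k = shift g^-1%g by apply/funext => x; rewrite /psi' ek /= flip0.
  have mslice B : measurable B -> measurable [set x | B (delta (lsec psi k x))].
    move=> mB.
    exact: (measurable_delta_slice (@measurable_diag_prod I) mpsi RelE (nu := nu) deltaE k mB).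
  pose N1 := [set x | ~ C (delta (lsec psi k x))].
  have mN1 : measurable N1.
    by apply: (mslice (~` C)); apply: measurableC; exact: countable_measurable.
  have N1null : mu.-negligible N1.
    apply/negligibleP => //.
    apply: etrans (esym (shift_measure mu_eta act_action g^-1%g mN1)) _.
    move/null_content_dominatesP : mu_nu; apply; first exact: measurable_shift_preimage.
    rewrite -psi'E; exact: (delta_countable_slice (@measurable_diag_prod I) mpsi mpsi' psiK psi'K RelE (nu := nu) deltaE
      k C_countable delta_C).
  have N3null : mu.-negligible [set x | f x = 0] by apply/negligibleP.
  have N4null : mu.-negligible (shift g @^-1` [set x | f x = 0]).
    apply/negligibleP; first exact: measurable_shift_preimage.
    exact: etrans (shift_measure mu_eta act_action g (mlev 0)) fpos.
  (* Where [delta] has a value [t > 0], [density_increment] applies with the factor [t]; values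
     [t <= 0] do not occur. *)
  have N2null t : mu.-negligible ([set x | delta (lsec psi k x) = t] `&`
      [set x | f (shift g x) <> t * f x]).
    have [t0|t0] := ltP 0 t; last first.
      rewrite (_ : _ `&` _ = set0); first exact: negligible_set0.
      apply/seteqP; split => // x [/= dt _]; case: deltaE => _ dpos _.
      have := dpos (lsec psi k x); rewrite dt ltNge t0 => F.
      by suff: false by []; apply: F; apply/RelE; exists k.
    apply: null_mu.
    have mD : measurable [set x | delta (lsec psi k x) = t].
      by apply: (mslice [set t]); exact: measurable_set1.
    apply: (density_increment (nu := nu) (mu := mu) (psi := shift g : X -> X)
      (psi' := shift g^-1%g) (D := [set x | delta (lsec psi k x) = t]) (c := t) mf f0) => //.
    - exact: measurable_shift.
    - exact: measurable_shift.
    - exact: (shiftVK act_action).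
    - move=> A mA At; rewrite -psi'E.
      exact: (delta_cst_scaling (@measurable_diag_prod I) mpsi mpsi' psiK psi'K RelE
        (nu := nu) deltaE mA At).
    - by move=> A mA; exact: (shift_measure mu_eta act_action).
  have [v Cv] := countable_range 0 C_countable.
  have N2 : mu.-negligible (\bigcup_n ([set x | delta (lsec psi k x) = v n] `&`
      [set x | f (shift g x) <> v n * f x])) by apply: negligible_bigcup.
  apply: negligibleS (negligibleU (negligibleU N1null N2) (negligibleU N3null N4null)).
  move=> x nC; apply: contrapT => nN; apply: nC.
  have Cx : C (delta (lsec psi k x)).
    by apply: contrapT => nCx; apply: nN; left; left.
  exists (delta (lsec psi k x)) => //.
  have fx : 0 < f x.
    by rewrite lt_neqAle f0 andbT eq_sym; apply/eqP => fx; apply: nN; right; left.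
  have fgx : f (shift g x) = delta (lsec psi k x) * f x.
    apply: contrapT => fgx; apply: nN; left; right.
    by have [n _ vn] := Cv _ Cx; exists n => //; rewrite vn.
  have dx : 0 < delta (lsec psi k x).
    by case: deltaE => _ dpos _; apply: dpos; apply/RelE; exists k.
  by rewrite /H fgx lnM ?posrE// addrK.
have [S [kappa kappa0 gapS]] := gap.
have [r Hr] := gap_atom (P := mu) mH (phi := fun g => shift g)
  (fun g _ => measurable_shift act g) kappa0 gapS (fun g _ => incr g).
have mHr : measurable [set x | H x = r].
  by have := mH measurableT [set r] (measurable_set1 r); rewrite setTI.
exists (expR r), [set x | f x = expR r]; split.
- exact: expR_gt0.
- exact: mlev.
(* At a zero of [f] the logarithm takes a default value, so the level set of [H] may exceed that of
   [f], but only by a null set. *)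
- have f0pr : pr mu [set x | f x = 0] = 0 by rewrite /pr fpos.
  apply: lt_le_trans Hr _.
  have := le_prU mu (mlev (expR r)) (mlev 0); rewrite f0pr addr0; apply: le_trans.
  apply: le_pr => //; first exact: measurableU.
  move=> x /= <-; have [fx|fx] := eqVneq (f x) 0; [by right|left].
  by rewrite /= lnK// posrE lt_neqAle eq_sym fx f0.
- move=> A mA AZ; apply/eqP; rewrite eq_le.
  by rewrite lev1 ?lev2// ?expR_ge0// => x /AZ ->.
Qed.

Lemma sub_delta_range : Gamma `<=` delta_range Rel nu.
Proof.
have [a [Z [a0 mZ Z0 muZ]]] := proportional_piece.
have nuZ A : measurable A -> A `<=` Z -> nu A = (a^-1%:E * mu A)%E.
  by move=> mA AZ; rewrite muZ// muleA -EFinM mulVf ?gt_eqF// mul1e.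
have nufin A : measurable A -> A `<=` Z -> (nu A < +oo)%E.
  move=> mA AZ; rewrite nuZ// (prE mu mA) -EFinM; exact: ltry.
have nu0 A : measurable A -> A `<=` Z -> 0 < pr mu A -> nu A <> 0%E.
  move=> mA AZ A0; rewrite nuZ// (prE mu mA) -EFinM => -[] /eqP.
  by rewrite mulf_eq0 invr_eq0 !gt_eqF.
have range k t D := delta_range_of_scaling (@measurable_diag_prod I) mpsi mpsi' psiK psi'K RelE
  (nu := nu) deltaE (k := k) (t := t) (D := D) C_countable delta_C.
(* The cocycle compares a set with its image, hence the inverse of the factor by which the flip
   scales [mu]. *)
have flip_range n b : delta_range Rel nu (flip_ratio gamma (n, b))^-1.
  have [i Hi] := far_flip mu_eta (n, b) mZ Z0
    (infinite_index act_action I_nonempty no_invariant_mean).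
  set D := _ `&` _ `&` _ in Hi.
  have [k ek] := e_surj (1%g, [fset i]%fset).
  have psi'E : psi' k = flip [fset i]%fset.
    by apply/funext => x; rewrite /psi' ek /= invg1 (shift1 act_action).
  have mphi A : measurable A -> measurable (flip [fset i]%fset @^-1` A : set X).
    exact: measurable_flip_preimage.
  have mD : measurable D.
    apply: measurableI; last exact: mphi.
    apply: measurableI => //; apply: (measurable_coord i (B := [set (n, b)])).
    exact: measurable_base.
  have DZ : D `<=` Z by move=> x [[]].
  have DZ' A : A `<=` D -> flip [fset i]%fset @^-1` A `<=` Z.
    by move=> AD x /AD[_ /=]; rewrite flipK.
  apply: (range k _ D) => //.
  - exact: nu0.
  - by rewrite psi'E; apply: nufin; [exact: mphi|exact: DZ'].
  - move=> A mA AD; rewrite psi'E [RHS](_ : _ =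
      ((flip_ratio gamma (n, b))^-1%:E * (a^-1%:E * mu (flip [fset i]%fset @^-1` A)))%E).
      rewrite (flip_scaling mu_eta (s := flip_ratio gamma (n, b)))//; last first.
        by move=> x /AD[[_ /= xi] _]; rewrite /flip_jacobian big_seq_fset1 xi.
      rewrite muleCA [X in (_ * X)%E]muleA -EFinM mulVf ?gt_eqF ?flip_ratio_gt0// mul1e.
      by apply: nuZ => //; exact: subset_trans AD DZ.
    by congr (_ * _)%E; apply: nuZ; [exact: mphi|exact: DZ'].
case: Gamma_subgroup => Gpos _ _ _ t Gt; have t0 := Gpos _ Gt.
have enum u : Gamma u -> u < 1 -> exists n, (gamma n)%:num = u.
  move=> Gu u1; have : (Gamma `&` [set v | 0 < v < 1]) u.
    by split => //=; rewrite Gpos.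
  by rewrite -gamma_enum => -[n _ <-]; exists n.
(* The enumeration contains only values below [1], realised at points [(n, true)]; larger values
   come from the inverses at [(n, false)], and [1] from the identity on [Z]. *)
have [t1|t1|->] := ltgtP t 1.
- have [n <-] := enum _ Gt t1.
  by have := flip_range n true; rewrite flip_ratioE invrK.
- have tV1 : t^-1 < 1 by rewrite invf_lt1.
  have [n gn] := enum _ (GammaV Gt) tV1.
  by have := flip_range n false; rewrite flip_ratioE gn invrK.
have [k ek] := e_surj (1%g, fset0).
have psi'E : psi' k = id.
  by apply/funext => x; rewrite /psi' ek /= invg1 (shift1 act_action) flip0.
apply: (range k _ Z) => //.
- exact: nu0.
- by rewrite psi'E; exact: nufin.
- by move=> A mA AZ; rewrite psi'E mul1e.
Qed.

End given_measure.

(** One measure, [mu] itself, bounds the intersection from above; the lower bound holds for every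
    admissible measure separately. *)
Lemma bernoulli_Sd : Sd mu Rel = Gamma.
Proof.
apply/seteqP; split => [t tSd|t Gt nu [[nu_mu mu_nu] [delta dE [C cC C0]]]].
  apply: bernoulli_delta_range_sub; apply: (tSd mu); split.
    by split.
  exact: bernoulli_almost_periodic.
exact: (sub_delta_range mu_nu dE cC C0).
Qed.

End bernoulli_relation_invariants.

Theorem theorem6p3 (R : realType)
  (Lambda : groupType) (countable_Lambda : countable [set: Lambda])
  (I : countType) (I_nonempty : [set: I] !=set0)
  (act : Lambda -> I -> I) (act_action : is_action act)
  (no_invariant_mean : ~ exists m : set I -> R, invariant_mean act m)
  (Gamma : set R) (Gamma_subgroup : pos_subgroup Gamma)
  (Gamma_countable : countable Gamma) (Gamma_nontrivial : Gamma <> [set 1])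
  (gamma : nat -> {posnum R})
  (gamma_enum : range (fun n => (gamma n)%:num) = Gamma `&` [set t | 0 < t < 1])
  (mu : probability (prod_space (nat * bool)%type I) R)
  (mu_product : is_product_measure (eta gamma) mu) :
  let Rel := bernoulli_rel (I := I) base_rel act in
  [/\ almost_periodic mu Rel,
      strongly_ergodic mu Rel
    & Sd mu Rel = Gamma].
Proof.
have [e e_surj] : exists e : nat -> Lambda * {fset I}, forall p, exists n, e n = p.
  apply: (countable_enumeration (1%g, fset0)).
  rewrite -setXTT; apply: countableX => //; exact: countableP.
split.
- exists mu; first by split.
  exact: (bernoulli_almost_periodic act_action Gamma_subgroup Gamma_countable
    gamma_enum mu_product e_surj).
- exact: (bernoulli_strongly_ergodic countable_Lambda act_action no_invariant_mean mu_product).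
- exact: (bernoulli_Sd countable_Lambda I_nonempty act_action no_invariant_mean
    Gamma_subgroup Gamma_countable gamma_enum mu_product e_surj).
Qed.
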